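(* Let $X$ and $Y$ be operator spaces that are strongly TRO equivalent by TRO's $M_1$ and $M_2$, i.e. $X=[M_2YM_1^*]^{-\|\cdot\|}$ and $Y=[M_2^*XM_1]^{-\|\cdot\|}$, and let $$A=[M_2M_2^*]^{-\|\cdot\|},\quad B=[M_1M_1^*]^{-\|\cdot\|},\quad C=[M_2^*M_2]^{-\|\cdot\|},\quad D=[M_1^*M_1]^{-\|\cdot\|}.$$ Then there is a bijection (up to unitary equivalence, i.e. between unitary equivalence classes) between the non-degenerate completely contractive bimodule maps of ${}_AX_B$ and the non-degenerate completely contractive bimodule maps of ${}_CY_D$. This bijection preserves non-degenerate faithful CES representations.
   Context: An operator space is a norm closed subspace of $\mathcal{B}(K_1,K_2)$ ($K_1,K_2$ Hilbert spaces). $[S]^{-\|\cdot\|}$ denotes the norm closed linear span of $S$, and $[S]$ the closed linear span of a set $S$ of vectors. A TRO is an operator space $M$ with $MM^*M\subseteq M$. Operator spaces $X\subseteq \mathcal{B}(K_1,K_2)$ and $Y\subseteq \mathcal{B}(H_1,H_2)$ are strongly TRO equivalent by $M_1,M_2$ if $M_1\subseteq \mathcal{B}(H_1,K_1)$ and $M_2\subseteq\mathcal{B}(H_2,K_2)$ are TRO's satisfying the two displayed identities for $X$ and $Y$. In this case $A,B,C,D$ are C*-algebras, $X$ is an $A$-$B$-bimodule and $Y$ is a $C$-$D$-bimodule by operator multiplication. For C*-algebras $A,B$ and an operator space $X$ that is an $A$-$B$-bimodule with completely contractive bilinear module actions (a C*-bimodule ${}_AX_B$), a completely contractive bimodule map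 $(\pi,\phi,\sigma)\colon {}_AX_B\to\mathcal{B}(K_1,K_2)$ consists of a completely contractive linear map $\phi\colon X\to \mathcal{B}(K_1,K_2)$ and $*$-representations $\pi\colon A\to\mathcal{B}(K_2)$, $\sigma\colon B\to\mathcal{B}(K_1)$ with $\phi(axb)=\pi(a)\phi(x)\sigma(b)$ for all $a\in A,x\in X,b\in B$ (with one-sided versions $\phi(ax)=\pi(a)\phi(x)$, $\phi(xb)=\phi(x)\sigma(b)$). The map $\phi$ is non-degenerate if $K_2=[\phi(X)K_1]$ and $K_1=[\phi(X)^*K_2]$; $(\pi,\phi,\sigma)$ is non-degenerate if $\pi,\phi,\sigma$ are all non-degenerate. It is a faithful CES representation if $\phi$ is completely isometric and $\pi,\sigma$ are faithful. Two bimodule maps $(\pi,\phi,\sigma)$ into $\mathcal{B}(K_1,K_2)$ and $(\pi',\phi',\sigma')$ into $\mathcal{B}(K_1',K_2')$ are unitarily equivalent if there are unitaries $V\in\mathcal{B}(K_1,K_1')$, $U\in\mathcal{B}(K_2,K_2')$ with $(\pi',\phi',\sigma')=(U\pi(\cdot)U^*,U\phi(\cdot)V^*,V\sigma(\cdot)V^* )$. *)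

(* Defs.v *)
From HB Require Import structures.
From mathcomp Require Import all_boot all_order all_algebra.
From mathcomp Require Import complex.
From mathcomp Require Import boolp classical_sets functions reals topology normedtype.

Set Implicit Arguments.
Unset Strict Implicit.
Unset Printing Implicit Defensive.

Import Order.TTheory GRing.Theory Num.Theory.
Import numFieldNormedType.Exports.

Local Open Scope classical_set_scope.
Local Open Scope ring_scope.

(* The form is linear in its first argument and conjugate-linear in its
   second one. *)
HB.mixin Record CompleteNormedModule_isHilbert (R : realType) V
    & CompleteNormedModule R[i] V := {
  hdot : {dot V for @Num.conj R[i]} ;
  hdot_norm : forall x : V, `|x| ^+ 2 = hdot x x
}.

#[short(type="hilbertType")]
HB.structure Definition Hilbert (R : realType) :=
  {V of CompleteNormedModule_isHilbert R V & CompleteNormedModule R[i] V}.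

(* The norm of a normed module over R[i] takes its values in R[i]; rnorm is the
   same number, seen in R. *)
Definition rnorm (R : realType) (V : normedModType R[i]) (x : V) : R :=
  complex.Re `|x|.

Section RealNorm.
Variables (R : realType) (V : normedModType R[i]).
Implicit Types x y : V.

Lemma rnormE x : `|x| = (rnorm x)%:C%C.
Proof.
by rewrite /rnorm; have := normr_ge0 x; case: `|x| => a b; rewrite lecE => /andP[/eqP/= -> _].
Qed.

Lemma rnorm_le x (c : R) : (`|x| <= c%:C%C) = (rnorm x <= c).
Proof. by rewrite rnormE lecR. Qed.

Lemma rnorm_ge0 x : 0 <= rnorm x.
Proof. by have := normr_ge0 x; rewrite rnormE (lecR 0). Qed.

Lemma rnormD x y : rnorm (x + y) <= rnorm x + rnorm y.
Proof. by have := ler_normD x y; rewrite !rnormE -rmorphD lecR. Qed.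

Lemma rnormZ (c : R[i]) x : rnorm (c *: x) = complex.Re `|c| * rnorm x.
Proof.
apply: (@complexI R); rewrite rmorphM -!rnormE normrZ.
by congr (_ * _); rewrite /= RRe_real// normr_real.
Qed.

Lemma rnorm0_eq0 x : rnorm x = 0 -> x = 0.
Proof. by move=> x0; apply/normr0_eq0; rewrite rnormE x0. Qed.

Lemma rnorm0 : rnorm (0 : V) = 0.
Proof. by rewrite /rnorm normr0. Qed.

End RealNorm.

Section BoundedOperators.
Variables (R : realType) (H K : hilbertType R).

Definition bounded_op_pred : {pred H -> K} :=
  [pred f : H -> K | `[< linear f /\ continuous f >]].

Lemma bounded_op_predP (f : H -> K) :
  reflect (linear f /\ continuous f) (f \in bounded_op_pred).
Proof. exact: asboolP. Qed.

Record bounded_op := BoundedOp {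
  bounded_op_val :> H -> K ;
  bounded_opP : bounded_op_val \in bounded_op_pred
}.

HB.instance Definition _ := [isSub for bounded_op_val].
HB.instance Definition _ := [Choice of bounded_op by <:].

Lemma bounded_op_submod_closed : GRing.submod_closed bounded_op_pred.
Proof.
split=> [|c f g].
  apply/bounded_op_predP; split; last exact: cst_continuous.
  by move=> c x y; rewrite /= /GRing.zero /= scaler0 addr0.
move=> /bounded_op_predP[lf cf] /bounded_op_predP[lg cg].
  apply/bounded_op_predP; split.
  move=> a x y; rewrite !fctE lf lg.
  by rewrite !scalerDr !scalerA (mulrC c a) addrACA.
move=> x; apply: continuousD; last exact: cg.
exact: continuous_comp (cf x) (@scaler_continuous _ _ c _).
Qed.

HB.instance Definition _ := GRing.isSubmodClosed.Build R[i] (H -> K)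
  bounded_op_pred bounded_op_submod_closed.
HB.instance Definition _ := [SubChoice_isSubLmodule of bounded_op by <:].

Implicit Types T S : bounded_op.

Lemma bounded_op_linear T : linear T.
Proof. by case: T => f /= /bounded_op_predP[]. Qed.

Lemma bounded_op_continuous T : continuous T.
Proof. by case: T => f /= /bounded_op_predP[]. Qed.

HB.instance Definition _ T :=
  GRing.isLinear.Build R[i] H K *:%R T (@bounded_op_linear T).

Lemma bounded_op_bound T : exists2 r : R, 0 <= r &
  forall x, rnorm (T x) <= r * rnorm x.
Proof.
have /linear_bounded_continuous/linear_boundedP := @bounded_op_continuous T.
move=> /pinfty_ex_gt0[r r0 Tr]; exists (complex.Re r).
  by move: r0; rewrite ltcE => /andP[_ /ltW].
move=> x; have := Tr x; rewrite !rnormE.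
have -> : r = (complex.Re r)%:C%C by rewrite RRe_real// gtr0_real.
by rewrite -rmorphM lecR.
Qed.

Definition opnorm T : R := sup [set rnorm (T x) | x in [set x | rnorm x <= 1]].

Lemma opnorm_has_sup T :
  has_sup [set rnorm (T x) | x in [set x | rnorm x <= 1]].
Proof.
have [r r0 Tr] := bounded_op_bound T; split.
  by exists (rnorm (T 0)), 0 => //=; rewrite rnorm0.
exists r => _ [x /= x1 <-]; rewrite (le_trans (Tr x))//.
by rewrite ler_piMr.
Qed.

Lemma opnorm_ge T x : rnorm x <= 1 -> rnorm (T x) <= opnorm T.
Proof. by move=> x1; apply: ub_le_sup; [have [] := opnorm_has_sup T|exists x]. Qed.

Lemma opnorm_le T r : (forall x, rnorm x <= 1 -> rnorm (T x) <= r) ->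
  opnorm T <= r.
Proof.
move=> Tr; apply: ge_sup; first by have [] := opnorm_has_sup T.
by move=> _ [x /= x1 <-]; exact: Tr.
Qed.

Lemma opnorm_ge0 T : 0 <= opnorm T.
Proof. by rewrite (le_trans _ (@opnorm_ge T 0 _))// ?rnorm_ge0// rnorm0. Qed.

Lemma rnorm_opE T x : rnorm (T x) <= opnorm T * rnorm x.
Proof.
have [->|x0] := eqVneq x 0; first by rewrite linear0 !rnorm0 mulr0.
have nx0 : 0 < rnorm x.
  by rewrite lt_neqAle rnorm_ge0 andbT; apply: contra_neq x0 => /esym/rnorm0_eq0.
have scE : complex.Re `|((rnorm x)^-1)%:C%C| = (rnorm x)^-1.
  by rewrite ger0_norm// (lecR 0) invr_ge0 ltW.
have := @opnorm_ge T (((rnorm x)^-1)%:C%C *: x).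
rewrite linearZ/= !rnormZ scE mulVf ?gt_eqF// => /(_ (lexx _)).
by rewrite ler_pdivrMl// mulrC.
Qed.

Let norm T : R[i] := (opnorm T)%:C%C.

Let ler_normD T S : norm (T + S) <= norm T + norm S.
Proof.
rewrite /norm -rmorphD lecR; apply: opnorm_le => x x1.
by rewrite (le_trans (rnormD _ _))// lerD// opnorm_ge.
Qed.

Let normZ_le (c : R[i]) T : opnorm (c *: T) <= complex.Re `|c| * opnorm T.
Proof.
apply: opnorm_le => x x1; have -> : (c *: T) x = c *: T x by [].
rewrite rnormZ ler_wpM2l ?opnorm_ge//.
by have := normr_ge0 c; rewrite lecE => /andP[].
Qed.

Let normrZ (c : R[i]) T : norm (c *: T) = `|c| * norm T.
Proof.
have cE : `|c| = (complex.Re `|c|)%:C%C by rewrite RRe_real// normr_real.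
rewrite /norm cE -rmorphM; congr (_%:C%C); apply/eqP; rewrite eq_le normZ_le andTb.
have [->|rc0] := eqVneq (complex.Re `|c|) 0; first by rewrite mul0r opnorm_ge0.
have rc_gt0 : 0 < complex.Re `|c| by rewrite lt_neqAle eq_sym rc0 -lecR -cE normr_ge0.
have c0 : c != 0 by apply: contra_neq rc0 => ->; rewrite normr0.
rewrite -ler_pdivlMl//.
have := normZ_le c^-1 (c *: T); rewrite scalerA mulVf// scale1r.
suff -> : complex.Re `|c^-1| = (complex.Re `|c|)^-1 by [].
by rewrite normfV cE -fmorphV.
Qed.

Let normr0_eq0 T : norm T = 0 -> T = 0.
Proof.
move=> /complexI T0; apply/val_inj/funext => x /=.
apply: rnorm0_eq0; apply/eqP; rewrite eq_le rnorm_ge0 andbT.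
by rewrite (le_trans (rnorm_opE T x))// T0 mul0r.
Qed.

HB.instance Definition _ :=
  Lmodule_isNormed.Build R[i] bounded_op ler_normD normrZ normr0_eq0.

End BoundedOperators.

Notation "''B(' H , K )" := (bounded_op H K) (format "''B(' H ,  K )") : type_scope.

Lemma bounded_op_comp_subproof (R : realType) (H K L : hilbertType R)
  (T : 'B(K, L)) (S : 'B(H, K)) : T \o S \in @bounded_op_pred R H L.
Proof.
apply/bounded_op_predP; split; first by move=> c x y; rewrite /= !linearP.
by move=> x; apply: continuous_comp; exact: bounded_op_continuous.
Qed.

Definition op_comp (R : realType) (H K L : hilbertType R)
  (T : 'B(K, L)) (S : 'B(H, K)) : 'B(H, L) :=
  BoundedOp (bounded_op_comp_subproof T S).

Notation "T *o S" := (op_comp T S) (at level 40, left associativity) : ring_scope.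

(* By Riesz's representation theorem the set below is always a singleton, so
   that the default value 0 is never used. *)
Definition adj (R : realType) (H K : hilbertType R) (T : 'B(H, K)) : 'B(K, H) :=
  xget 0 [set S : 'B(K, H) | forall x y, hdot (T x) y = hdot x (S y)].

Arguments adj {R H K} T.

Definition op_mulset (R : realType) (H K L : hilbertType R)
  (A : set 'B(K, L)) (B : set 'B(H, K)) : set 'B(H, L) :=
  [set a *o b | a in A & b in B].

Notation "A `*o B" := (op_mulset A B) (at level 40, left associativity) : classical_set_scope.
Notation "A ^*o" := (adj @` A) (at level 2, format "A ^*o") : classical_set_scope.

Definition closed_span (K : numFieldType) (V : normedModType K) (S : set V) : set V :=
  closure [set v | exists n (c : 'I_n -> K) (s : 'I_n -> V),
    (forall i, S (s i)) /\ v = \sum_(i < n) c i *: s i].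

(* The norm of the operator matrix T in B(H^n, K^n), where H^n and K^n are
   Hilbert direct sums. *)
Definition mx_opnorm (R : realType) (H K : hilbertType R) n
    (T : 'M['B(H, K)]_n) : R :=
  sup [set Num.sqrt (\sum_i rnorm (\sum_j T i j (xi j)) ^+ 2) |
       xi in [set xi : 'I_n -> H | \sum_j rnorm (xi j) ^+ 2 <= 1]].

Definition operator_space (R : realType) (H K : hilbertType R)
    (X : set 'B(H, K)) : Prop :=
  [/\ closed X, X 0 & forall (c : R[i]) x y, X x -> X y -> X (c *: x + y)].

Definition TRO (R : realType) (H K : hilbertType R) (M : set 'B(H, K)) : Prop :=
  operator_space M /\ M `*o M^*o `*o M `<=` M.

Definition strongly_TRO_equiv (R : realType) (H1 H2 K1 K2 : hilbertType R)
    (X : set 'B(K1, K2)) (Y : set 'B(H1, H2))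
    (M1 : set 'B(H1, K1)) (M2 : set 'B(H2, K2)) : Prop :=
  [/\ TRO M1, TRO M2,
      X = closed_span (M2 `*o Y `*o M1^*o) &
      Y = closed_span (M2^*o `*o X `*o M1)].

(* A map on a space X of operators is represented by a function on the whole of
   B(H, K), of which only the values on X matter. *)

Definition linear_on (K : numFieldType) (V W : lmodType K)
    (X : set V) (f : V -> W) : Prop :=
  forall (c : K) x y, X x -> X y -> f (c *: x + y) = c *: f x + f y.

Section Maps.
Variables (R : realType) (H K H' K' : hilbertType R).
Implicit Types (X : set 'B(H, K)) (phi : 'B(H, K) -> 'B(H', K')).

Definition completely_contractive X phi : Prop :=
  linear_on X phi /\
  forall n (x : 'M['B(H, K)]_n), (forall i j, X (x i j)) ->
    mx_opnorm (map_mx phi x) <= mx_opnorm x.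

Definition completely_isometric X phi : Prop :=
  linear_on X phi /\
  forall n (x : 'M['B(H, K)]_n), (forall i j, X (x i j)) ->
    mx_opnorm (map_mx phi x) = mx_opnorm x.

Definition map_nondegenerate X phi : Prop :=
  closed_span [set phi x xi | x in X & xi in setT] = setT /\
  closed_span [set adj (phi x) eta | x in X & eta in setT] = setT.

End Maps.

Section StarRepresentations.
Variables (R : realType) (H H' : hilbertType R).
Implicit Types (A : set 'B(H, H)) (pi : 'B(H, H) -> 'B(H', H')).

Definition star_representation A pi : Prop :=
  [/\ linear_on A pi,
      forall a b, A a -> A b -> pi (a *o b) = pi a *o pi b &
      forall a, A a -> pi (adj a) = adj (pi a)].

Definition star_nondegenerate A pi : Prop :=
  closed_span [set pi a xi | a in A & xi in setT] = setT.

End StarRepresentations.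

(* A triple (pi, phi, sigma) without any condition yet. *)
Record bimodule_triple (R : realType) (K1 K2 : hilbertType R) := BimoduleTriple {
  bm_dom : hilbertType R ;
  bm_cod : hilbertType R ;
  bm_left : 'B(K2, K2) -> 'B(bm_cod, bm_cod) ;
  bm_map : 'B(K1, K2) -> 'B(bm_dom, bm_cod) ;
  bm_right : 'B(K1, K1) -> 'B(bm_dom, bm_dom)
}.

Section BimoduleMaps.
Variables (R : realType) (K1 K2 : hilbertType R).
Variables (A : set 'B(K2, K2)) (X : set 'B(K1, K2)) (B : set 'B(K1, K1)).
Implicit Types r s : bimodule_triple K1 K2.

Definition cc_bimodule_map r : Prop :=
  let: pi := bm_left r in let: phi := bm_map r in let: sigma := bm_right r in
  [/\ completely_contractive X phi,
      star_representation A pi /\ star_representation B sigma,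
      forall a x b, A a -> X x -> B b ->
        phi (a *o x *o b) = pi a *o phi x *o sigma b,
      forall a x, A a -> X x -> phi (a *o x) = pi a *o phi x &
      forall x b, X x -> B b -> phi (x *o b) = phi x *o sigma b].

Definition nondegenerate r : Prop :=
  [/\ star_nondegenerate A (bm_left r), map_nondegenerate X (bm_map r) &
      star_nondegenerate B (bm_right r)].

Definition faithful_CES r : Prop :=
  [/\ completely_isometric X (bm_map r), set_inj A (bm_left r) &
      set_inj B (bm_right r)].

Definition unitary (H H' : hilbertType R) (U : 'B(H, H')) : Prop :=
  cancel U (adj U) /\ cancel (adj U) U.

Definition unitarily_equivalent r s : Prop :=
  exists (V : 'B(bm_dom r, bm_dom s)) (U : 'B(bm_cod r, bm_cod s)),
  [/\ unitary V /\ unitary U,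
      forall a, A a -> bm_left s a = U *o bm_left r a *o adj U,
      forall x, X x -> bm_map s x = U *o bm_map r x *o adj V &
      forall b, B b -> bm_right s b = V *o bm_right r b *o adj V].

Definition nondegenerate_class : Type :=
  {c : bimodule_triple K1 K2 -> Prop |
    exists r, [/\ cc_bimodule_map r, nondegenerate r &
      c = fun s => [/\ cc_bimodule_map s, nondegenerate s &
                       unitarily_equivalent r s]]}.

End BimoduleMaps.

(* Main.v *)
(* Non-degenerate maps are induced along the TRO's. Given (pi, phi, sigma) on
   B(L1, L2), the Hilbert spaces E1 = M1^* (x)_B L1 and E2 = M2^* (x)_A L2 carry
   the map psi with <psi(y) (m^* (x) z), n^* (x) t> = <phi(n y m^* ) z, t>.

   This form is bounded because of the Cauchy-Schwarz inequality
     |<phi(n y m^* ) z, t>|^2 <= |y|^2 <sigma(m m^* ) z, z> <pi(n n^* ) t, t>,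
   which comes from the polar factorization n = (e + n n^* )^(1/2) n' with a
   contraction n' in M2. Its amplification to matrices, with columns of elements
   of M1 and M2 in place of m and n, makes psi completely contractive.

   The maps m |-> rho_i(m) : E_i -> L_i adjoint to z |-> m^* (x) z satisfy
   rho1(m) rho1(m')^* = sigma(m m'^* ), rho1(m)^* rho1(m') = sigma'(m^* m'),
   phi(n y m^* ) = rho2(n) psi(y) rho1(m)^*, psi(n^* x m) = rho2(n)^* phi(x) rho1(m),
   and so on. These identities are symmetric in the two sides and, by
   non-degeneracy, determine each side from the other up to unitary equivalence;
   hence the correspondence is a bijection of classes. If phi is completely
   isometric, they give |e y f^*| = |phi(e y f^* )| <= |psi(y)| for matrix
   contractions e and f over M2 and M1, and the Cauchy-Schwarz inequality for the
   identity representation, with the constant |psi(y)|, yields |y| <= |psi(y)|. *)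
Require Import Defs.
From HB Require Import structures.
From mathcomp Require Import all_boot all_order all_algebra.
From mathcomp Require Import complex ring lra.
From mathcomp Require Import boolp classical_sets functions reals topology normedtype.
(* Again, since sesquilinear.v declares another [nondegenerate]. *)
Import Defs.

Set Implicit Arguments.
Unset Strict Implicit.
Unset Printing Implicit Defensive.

Import Order.TTheory GRing.Theory Num.Theory.
Import numFieldNormedType.Exports.

Local Open Scope classical_set_scope.
Local Open Scope ring_scope.

(** * Hilbert space preliminaries *)

(** The algebras may lack a unit and [pi], [sigma] act on them alone, so scalars are carried
    separately throughout: square roots and inverses are produced as a scalar plus an element of the
    algebra, by iterations that stay inside it. Boundedness of the form has to be shown on sums of
    elementary tensors. Such a sum becomes one vector after amplification by a column, so even the
    existence of [psi] uses the bound on [phi] for matrices of every size. To have one argument for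
    operators and matrices, direct sums are described by frames: matrices over A, X, B, M1, M2 are
    then operators satisfying the same hypotheses. The ranges of M1^* and M2^* may fail to be dense.
    In the isometric part the transferred operator is therefore recognised as y only because both
    vanish on the orthogonal complements, which for y follows from Y = [M2^* X M1]. Replacing M1 and
    M2 by their adjoints swaps the two sides, so existence, uniqueness and faithfulness are proved
    in one direction and used in both. *)

Section ComplexAbs.
Variable R : realType.
Implicit Types (c z : R[i]) (r : R).

Definition cabs z : R := complex.Re `|z|.

Lemma cabsE z : `|z| = (cabs z)%:C%C.
Proof. by rewrite /cabs RRe_real// normr_real. Qed.

Lemma cabs_ge0 z : 0 <= cabs z.
Proof. by rewrite -lecR -cabsE normr_ge0. Qed.

Lemma cabsM c z : cabs (c * z) = cabs c * cabs z.
Proof. by apply: (@complexI R); rewrite rmorphM -!cabsE normrM. Qed.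

Lemma cabsD c z : cabs (c + z) <= cabs c + cabs z.
Proof. by rewrite -lecR rmorphD -!cabsE ler_normD. Qed.

Lemma cabsN z : cabs (- z) = cabs z.
Proof. by rewrite /cabs normrN. Qed.

Lemma cabsB c z : cabs (c - z) <= cabs c + cabs z.
Proof. by rewrite -(cabsN z) cabsD. Qed.

Lemma cabs0 : cabs 0 = 0.
Proof. by rewrite /cabs normr0. Qed.

Lemma cabs1 : cabs 1 = 1.
Proof. by rewrite /cabs normr1. Qed.

Lemma cabs_eq0 z : cabs z = 0 -> z = 0.
Proof. by move=> z0; apply/normr0_eq0; rewrite cabsE z0. Qed.

Lemma cabs_conj z : cabs (z^* ) = cabs z.
Proof. by rewrite /cabs norm_conjC. Qed.

Lemma cabs_real r : cabs r%:C%C = `|r|.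
Proof.
apply: (@complexI R); rewrite -cabsE.
have [r0|r0] := leP 0 r; first by rewrite !ger0_norm ?ler0c.
by rewrite -normrN -rmorphN -(normrN r) !ger0_norm ?ler0c ?oppr_ge0 ?(ltW r0).
Qed.

Lemma cabs_sqr z : ((cabs z) ^+ 2)%:C%C = z * z^*.
Proof. by rewrite -normCK rmorphXn cabsE. Qed.

Lemma Re_le_cabs z : complex.Re z <= cabs z.
Proof.
by rewrite (le_trans (ler_norm _))// -lecR -cabsE normc_ge_Re.
Qed.

Lemma normr_Re_cabs z : `|complex.Re z| <= cabs z.
Proof. by rewrite -lecR -cabsE normc_ge_Re. Qed.

Lemma cabsi : cabs ('i%C : R[i]) = 1.
Proof. by rewrite /cabs complexiE normCi. Qed.

Lemma normr_Im_cabs z : `|complex.Im z| <= cabs z.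
Proof.
have := normr_Re_cabs (z * 'i%C); rewrite cabsM cabsi mulr1.
by rewrite ReiNIm normrN.
Qed.

Lemma cabs_le_Re_Im z : cabs z <= `|complex.Re z| + `|complex.Im z|.
Proof.
rewrite [in cabs z](complexE z) (le_trans (cabsD _ _))// cabsM !cabs_real.
by rewrite cabsi mul1r.
Qed.

Lemma conjcM c z : (c * z)^* = c^* * z^*. Proof. exact: rmorphM. Qed.
Lemma conjcB c z : (c - z)^* = c^* - z^*. Proof. exact: rmorphB. Qed.
Lemma conjcN c : (- c)^* = - c^*. Proof. exact: rmorphN. Qed.

Lemma conjC_real_complex r : ((r%:C)%C)^* = r%:C%C.
Proof. exact: conjc_real. Qed.

Lemma cRe_conj z : complex.Re (z^* ) = complex.Re z.
Proof. by case: z. Qed.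

Lemma Re_realM r z : complex.Re (r%:C%C * z) = r * complex.Re z.
Proof. by case: z => a b /=; rewrite mul0r subr0. Qed.

Lemma ReD c z : complex.Re (c + z) = complex.Re c + complex.Re z.
Proof. by case: c; case: z. Qed.

Lemma ReN z : complex.Re (- z) = - complex.Re z.
Proof. by case: z. Qed.

(* The discriminant of a nonnegative quadratic form in one complex variable. *)
Lemma quad_form_discr (a b : R) z : 0 <= a -> 0 <= b ->
  (forall c, 0 <= a + 2 * complex.Re (c * z) + cabs c ^+ 2 * b) ->
  cabs z ^+ 2 <= a * b.
Proof.
move=> a0 b0 Q.
have Qr (t : R) : 0 <= a - 2 * t * cabs z ^+ 2 + t ^+ 2 * cabs z ^+ 2 * b.
  (* With [c = - t z^*] the product [c z] is real, so the form becomes a real quadratic in [t]. *)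
  have := Q ((- t)%:C%C * z^* ).
  rewrite -mulrA (mulrC (z^*)) -cabs_sqr -rmorphM/= cabsM cabs_conj cabs_real.
  by rewrite exprMn real_normK ?num_real// sqrrN mulNr mulrN mulrA.
have [b00|bn0] := eqVneq b 0.
  have [z0|zn0] := eqVneq (cabs z ^+ 2) 0; first by rewrite z0 mulr_ge0.
  (* For [b = 0] the form is affine in [t]; this [t] gives it the value [- a - 2]. *)
  have := Qr ((a + 1) / cabs z ^+ 2); rewrite b00 !mulr0 addr0 mulrA mulfVK//.
  by move=> ?; exfalso; lra.
have bgt0 : 0 < b by rewrite lt_neqAle eq_sym bn0.
(* The quadratic is evaluated at its minimum [t = 1 / b]. *)
have -> : cabs z ^+ 2 = a * b - b * (a - 2 * b^-1 * cabs z ^+ 2 + b^-1 ^+ 2 * cabs z ^+ 2 * b).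
  by field.
by rewrite gerBl mulr_ge0.
Qed.

End ComplexAbs.

(** * Scalar products and their norms *)

Section DotProduct.
Variables (R : realType) (H : hilbertType R).
Implicit Types (x y z : H) (c : R[i]).

Lemma hdotDl x y z : hdot (x + y) z = hdot x z + hdot y z.
Proof. exact: linearDl. Qed.
Lemma hdotDr x y z : hdot x (y + z) = hdot x y + hdot x z.
Proof. exact: raddfD. Qed.
Lemma hdotZl c x z : hdot (c *: x) z = c * hdot x z.
Proof. exact: linearZl_LR. Qed.
Lemma hdotZr c x z : hdot x (c *: z) = c^* * hdot x z.
Proof. exact: linearZ. Qed.
Lemma hdot0l z : hdot 0 z = 0.
Proof. exact: linear0l. Qed.
Lemma hdot0r z : hdot z 0 = 0.
Proof. exact: raddf0. Qed.
Lemma hdotNl x z : hdot (- x) z = - hdot x z.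
Proof. exact: linearNl. Qed.
Lemma hdotNr x z : hdot x (- z) = - hdot x z.
Proof. exact: raddfN. Qed.
Lemma hdotBl x y z : hdot (x - y) z = hdot x z - hdot y z.
Proof. by rewrite hdotDl hdotNl. Qed.
Lemma hdotBr x y z : hdot x (y - z) = hdot x y - hdot x z.
Proof. by rewrite hdotDr hdotNr. Qed.
Lemma hdot_suml (I : Type) (r : seq I) (P : pred I) (F : I -> H) z :
  hdot (\sum_(i <- r | P i) F i) z = \sum_(i <- r | P i) hdot (F i) z.
Proof. by apply: (big_morph (fun x => hdot x z)) => [? ?|]; rewrite ?hdotDl ?hdot0l. Qed.
Lemma hdot_sumr (I : Type) (r : seq I) (P : pred I) (F : I -> H) z :
  hdot z (\sum_(i <- r | P i) F i) = \sum_(i <- r | P i) hdot z (F i).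
Proof. by apply: (big_morph (hdot z)) => [? ?|]; rewrite ?hdotDr ?hdot0r. Qed.

Lemma hdotC x y : hdot x y = (hdot y x)^*.
Proof. by rewrite (hermitian_subproof x y) expr0 mul1r. Qed.

Lemma hdotxx x : hdot x x = (rnorm x ^+ 2)%:C%C.
Proof. by rewrite -hdot_norm rnormE rmorphXn. Qed.

Lemma rnorm_sqr x : rnorm x ^+ 2 = complex.Re (hdot x x).
Proof. by rewrite hdotxx. Qed.

Lemma rnorm_sqrD x y :
  rnorm (x + y) ^+ 2 = rnorm x ^+ 2 + 2 * complex.Re (hdot x y) + rnorm y ^+ 2.
Proof.
rewrite rnorm_sqr hdotDl !hdotDr !ReD -!rnorm_sqr (hdotC y x) cRe_conj; ring.
Qed.

Lemma rnormN x : rnorm (- x) = rnorm x.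
Proof. by rewrite /rnorm normrN. Qed.

Lemma rnorm_sqrB x y :
  rnorm (x - y) ^+ 2 = rnorm x ^+ 2 - 2 * complex.Re (hdot x y) + rnorm y ^+ 2.
Proof. by rewrite rnorm_sqrD hdotNr ReN rnormN mulrN. Qed.

Lemma rnormZ_cabs c x : rnorm (c *: x) = cabs c * rnorm x.
Proof. exact: rnormZ. Qed.

Lemma rnormB x y : rnorm (x - y) <= rnorm x + rnorm y.
Proof. by rewrite -(rnormN y) rnormD. Qed.

Lemma rnorm_distD z x y : rnorm (x - y) <= rnorm (x - z) + rnorm (z - y).
Proof. by rewrite -[x in leLHS](subrK z) -addrA rnormD. Qed.

Lemma cauchy_schwarz x y : cabs (hdot x y) <= rnorm x * rnorm y.
Proof.
rewrite -(@ler_pXn2r _ 2)// ?nnegrE ?cabs_ge0 ?mulr_ge0 ?rnorm_ge0//.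
rewrite exprMn mulrC.
rewrite [leRHS]mulrC; apply: quad_form_discr; rewrite ?sqr_ge0// => c.
rewrite -cabs_conj -exprMn -rnormZ_cabs.
have -> : c * hdot x y = hdot x (c^* *: y) by rewrite hdotZr conjCK.
by rewrite -rnorm_sqrD sqr_ge0.
Qed.

Lemma eq_hdotl x y : (forall z, hdot x z = hdot y z) -> x = y.
Proof.
move=> xy; apply/eqP; rewrite -subr_eq0; apply/eqP/rnorm0_eq0/eqP.
by rewrite -sqrf_eq0 rnorm_sqr hdotBl xy subrr.
Qed.

Lemma eq_hdotr x y : (forall z, hdot z x = hdot z y) -> x = y.
Proof. by move=> xy; apply: eq_hdotl => z; rewrite hdotC xy -hdotC. Qed.

Lemma hdot_self_eq0 x : hdot x x = 0 -> x = 0.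
Proof.
by move=> x0; apply/rnorm0_eq0/eqP; rewrite -sqrf_eq0 rnorm_sqr x0.
Qed.

End DotProduct.

Section NormTopology.
Variables (R : realType) (V : normedModType R[i]).
Implicit Types (S : set V) (x y : V).

(** A positive element of [R[i]] is real, so the balls of the topology can be measured by [rnorm]
    with real radii. *)
Lemma closure_rnorm S x : closure S x <->
  forall e : R, 0 < e -> exists2 y, S y & rnorm (x - y) < e.
Proof.
split=> [Sx e e0|Sx B].
  have e0' : 0 < e%:C%C by rewrite ltcR.
  have [y [Sy]] := Sx _ (nbhsx_ballx x _ e0').
  by rewrite -ball_normE /= rnormE ltcR; exists y.
move=> /nbhs_ballP[e /= e0 xB].
have eE : e = (complex.Re e)%:C%C by rewrite RRe_real// gtr0_real.
have [|y Sy xy] := Sx (complex.Re e); first by rewrite -ltcR -eE.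
exists y; split=> //; apply: xB.
by rewrite -ball_normE /= eE rnormE ltcR.
Qed.

Lemma closed_rnorm S : closed S <-> forall x,
  (forall e : R, 0 < e -> exists2 y, S y & rnorm (x - y) < e) -> S x.
Proof.
split=> [cS x /closure_rnorm /cS//|cS x /closure_rnorm /cS//].
Qed.

Definition seq_lim (u : nat -> V) (l : V) := forall e : R, 0 < e ->
  exists N, forall n, (N <= n)%N -> rnorm (u n - l) < e.

Definition cauchy_seq (u : nat -> V) := forall e : R, 0 < e ->
  exists N, forall m n, (N <= m)%N -> (N <= n)%N -> rnorm (u m - u n) < e.

Lemma closed_seq_lim S (u : nat -> V) l :
  closed S -> (forall n, S (u n)) -> seq_lim u l -> S l.
Proof.
move=> /closed_rnorm cS Su ul; apply: cS => e /ul[N uN].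
by exists (u N) => //; rewrite -opprB /rnorm normrN; exact: uN.
Qed.

End NormTopology.

Lemma complete_seq_lim (R : realType) (V : completeNormedModType R[i])
  (u : nat -> V) : cauchy_seq u -> exists l, seq_lim u l.
Proof.
move=> uC.
have : cauchy (u @ \oo).
  apply: cauchy_exP => e e0.
  have eE : e = (complex.Re e)%:C%C by rewrite RRe_real// gtr0_real.
  have [|N uN] := uC (complex.Re e); first by rewrite -ltcR -eE.
  exists (u N); exists N => // n /= Nn.
  by rewrite -ball_normE /= eE rnormE ltcR; exact: uN.
move=> /cauchy_cvg /cvg_ex[l ul]; exists l => e e0.
have e0' : 0 < e%:C%C :> R[i] by rewrite ltcR.
have /ul[N _ uN] := nbhsx_ballx l _ e0'.
exists N => n Nn; have := uN n Nn.
by rewrite -ball_normE /= -opprB normrN rnormE ltcR.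
Qed.

Section ClosedSpan.
Variables (R : realType) (V : normedModType R[i]).
Implicit Types (S P : set V) (x y : V) (c : R[i]).

Lemma sub_closed_span S : S `<=` closed_span S.
Proof.
move=> x Sx; apply: subset_closure; exists 1, (fun=> 1), (fun=> x).
by split => //; rewrite big_ord_recl big_ord0 scale1r addr0.
Qed.

Lemma closed_span0 S : closed_span S 0.
Proof.
apply: subset_closure; exists 0, (fun=> 0), (fun=> 0).
by split=> [[]|] //; rewrite big_ord0.
Qed.

Lemma closed_closed_span S : closed (closed_span S).
Proof. exact: closed_closure. Qed.

Lemma closed_spanP S c x y :
  closed_span S x -> closed_span S y -> closed_span S (c *: x + y).
Proof.
move=> /closure_rnorm Sx /closure_rnorm Sy; apply/closure_rnorm => e e0.
have e20 : 0 < e / 2 by rewrite divr_gt0.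
(* The [+ 1] keeps the quotient defined when [c = 0]; the same device recurs in later estimates. *)
have c1 : 0 < cabs c + 1 by rewrite ltr_wpDl// cabs_ge0.
have [_ [n [a [s [Ss ->]]]] xs] := Sx _ (divr_gt0 e20 c1).
have [_ [m [b [t [St ->]]]] yt] := Sy _ e20.
exists (c *: (\sum_(i < n) a i *: s i) + \sum_(i < m) b i *: t i).
  exists (n + m)%N, (fun i : 'I_(n + m) =>
    match fintype.split i with inl j => c * a j | inr j => b j end),
    (fun i : 'I_(n + m) => match fintype.split i with inl j => s j | inr j => t j end).
  split=> [i|]; first by case: (fintype.split i).
  rewrite big_split_ord/= scaler_sumr; congr (_ + _); apply: eq_bigr => i _.
    by rewrite (unsplitK (inl i)) scalerA.
  by rewrite (unsplitK (inr i)).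
rewrite opprD addrACA -scalerBr (le_lt_trans (rnormD _ _))//.
rewrite (splitr e) ltr_leD// ?(ltW yt)//.
rewrite rnormZ -/(cabs c).
have [->|c0] := eqVneq (cabs c) 0; first by rewrite mul0r.
have {}c0 : 0 < cabs c by rewrite lt_neqAle eq_sym c0 cabs_ge0.
rewrite (@lt_le_trans _ _ (cabs c * (e / 2 / (cabs c + 1))))// ?ltr_pM2l//.
set h := e / 2 in e20 *.
by rewrite mulrC -mulrA ler_piMr ?(ltW e20)// mulrC ler_pdivrMr// mul1r lerDl.
Qed.

(** The induction principle for closed spans, by which properties of generators reach the algebras
    and [X], [Y]. *)
Lemma closed_span_min S P : P 0 -> (forall c x y, P x -> P y -> P (c *: x + y)) ->
  closed P -> S `<=` P -> closed_span S `<=` P.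
Proof.
move=> P0 PD cP SP x Sx; apply: cP; move: x Sx; apply: closureS => _ [n [c [s [Ss ->]]]].
elim/big_ind : _ => //.
  by move=> x y Px Py; rewrite -(scale1r x); apply: PD.
by move=> i _; rewrite -[_ *: _]addr0; apply: PD => //; exact: SP.
Qed.

End ClosedSpan.

(** * The Riesz representation theorem *)

Section Riesz.
Variables (R : realType) (H : hilbertType R).
Implicit Types (x y w v : H) (c k : R[i]).

Lemma seq_lim_hdot_eq (u : nat -> H) l w k :
  seq_lim u l -> (forall e : R, 0 < e -> exists N, forall n, (N <= n)%N ->
    cabs (hdot (u n) w - k) <= e) -> hdot l w = k.
Proof.
move=> ul uk; apply/eqP; rewrite -subr_eq0; apply/eqP/cabs_eq0/eqP.
rewrite eq_le cabs_ge0 andbT; apply/ler_addgt0Pr => e e0; rewrite add0r.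
have e20 : 0 < e / 2 by rewrite divr_gt0.
have w1 : 0 < rnorm w + 1 by rewrite ltr_wpDl// rnorm_ge0.
have [N1 uN1] := ul _ (divr_gt0 e20 w1).
have [N2 uN2] := uk _ e20.
pose n := maxn N1 N2.
have -> : hdot l w - k = (hdot (u n) w - k) - hdot (u n - l) w.
  by rewrite hdotBl; ring.
rewrite (le_trans (cabsB _ _))// (splitr e) lerD ?uN2 ?leq_maxr//.
rewrite (le_trans (cauchy_schwarz _ _))//.
rewrite (@le_trans _ _ (e / 2 / (rnorm w + 1) * rnorm w))//.
  by rewrite ler_wpM2r ?rnorm_ge0// ltW// uN1 ?leq_maxl.
by rewrite -mulrA ler_piMr ?(ltW e20)// mulrC ler_pdivrMr// mul1r lerDl.
Qed.

(* A bounded conjugate-linear functional on a subspace is given by its graph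
   [G]; the representing vector is the limit of a sequence minimizing
   [|w|^2 - 2 Re k] over the graph. *)
Lemma riesz_graph (G : H -> R[i] -> Prop) (C : R) :
  0 <= C -> G 0 0 ->
  (forall c w w' k k', G w k -> G w' k' -> G (c *: w + w') (c^* * k + k')) ->
  (forall w k, G w k -> cabs k <= C * rnorm w) ->
  exists v, [/\ forall w k, G w k -> hdot v w = k, rnorm v <= C &
    closure [set w | exists k, G w k] v].
Proof.
move=> C0 G0 GD GC.
pose Q (p : H * R[i]) : R := rnorm p.1 ^+ 2 - 2 * complex.Re p.2.
pose D : set R := [set Q p | p in [set p | G p.1 p.2]].
have D0 : D !=set0 by exists (Q (0, 0)), (0, 0).
(* On the graph [Q] is at least [(|w| - C)^2 - C^2]. *)
have Dlb : has_lbound D.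
  exists (- C ^+ 2) => _ [[w k] /= Gwk <-].
  rewrite /Q/=; have := le_trans (Re_le_cabs _) (GC _ _ Gwk).
  have := sqr_ge0 (rnorm w - C); rewrite sqrrB; lra.
have D_inf : has_inf D by [].
pose I := inf D.
have IQ w k : G w k -> I <= Q (w, k).
  by move=> Gwk; apply: ge_inf => //; exists (w, k).
have exu n : exists p, G p.1 p.2 /\ Q p < I + n.+1%:R^-1.
  have n0 : 0 < n.+1%:R^-1 :> R by rewrite invr_gt0.
  by have [_ [p /= Gp <-] pI] := inf_adherent n0 D_inf; exists p.
have [u uP] := boolp.choice exu.
have half : cabs 2^-1 = 2^-1 :> R.
  have -> : (2^-1 : R[i]) = (2^-1)%:C%C by rewrite fmorphV rmorph_nat.
  by rewrite cabs_real ger0_norm ?invr_ge0.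
(* The midpoint of [u m] and [u n] lies in the graph, where [Q] is at least [I]; the parallelogram
   identity then bounds the distance by the two excesses over [I]. *)
have uC m n : rnorm ((u m).1 - (u n).1) ^+ 2 <= 2 * (m.+1%:R^-1 + n.+1%:R^-1).
  have [Gm Qm] := uP m; have [Gn Qn] := uP n.
  have c2 : (2^-1 : R[i])^* = 2^-1 by rewrite fmorphV/= conjC_nat.
  have G2 := GD 2^-1 _ _ _ _ Gm (GD (2^-1) _ _ _ _ Gn G0).
  rewrite !addr0 c2 -mulrDr -scalerDr in G2.
  have := IQ _ _ G2; rewrite /Q/= rnormZ_cabs half.
  have -> : complex.Re (2^-1 * ((u m).2 + (u n).2)) =
     2^-1 * (complex.Re (u m).2 + complex.Re (u n).2).
    have -> : (2^-1 : R[i]) = (2^-1)%:C%C by rewrite fmorphV rmorph_nat.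
    by rewrite Re_realM ReD.
  move: Qm Qn; rewrite /Q exprMn (rnorm_sqrD (u m).1 (u n).1) rnorm_sqrB.
  set a := complex.Re (hdot _ _); set a1 := rnorm _ ^+ 2; set a2 := rnorm _ ^+ 2.
  set b1 := complex.Re _; set b2 := complex.Re _.
  set i1 := m.+1%:R^-1; set i2 := n.+1%:R^-1; lra.
have [l ul] : exists l, seq_lim (fun n => (u n).1) l.
  apply: complete_seq_lim => e e0.
  have e2 : 0 < e ^+ 2 / 4 by rewrite divr_gt0// exprn_gt0.
  have [N] := ltr_add_invr e2; rewrite add0r => NP.
  exists N => m n Nm Nn.
  rewrite -(@ltr_pXn2r _ 2)// ?nnegrE ?rnorm_ge0 ?(ltW e0)//.
  apply: (le_lt_trans (uC m n)).
  have mono j : (N <= j)%N -> j.+1%:R^-1 < e ^+ 2 / 4.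
    move=> Nj; apply: le_lt_trans NP.
    by rewrite lef_pV2 ?posrE// ler_nat.
  have := mono _ Nm; have := mono _ Nn.
  by set i1 := n.+1%:R^-1; set i2 := m.+1%:R^-1; set f := e ^+ 2; lra.
have lE w k : G w k -> hdot l w = k.
  move=> Gwk; apply: seq_lim_hdot_eq ul _ => e e0.
  have w1 : 0 < rnorm w ^+ 2 + 1 by rewrite ltr_wpDl// sqr_ge0.
  have e2 : 0 < e ^+ 2 / (rnorm w ^+ 2 + 1) by rewrite divr_gt0// exprn_gt0.
  have [N] := ltr_add_invr e2; rewrite add0r => NP.
  exists N => n Nn.
  have [Gn Qn] := uP n.
  (* Moving [u n] along [w] by any complex multiple lowers [Q] by less than [1 / n.+1], so the
     discriminant bounds the defect of [u n] as a representing vector. *)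
  have zn : cabs (hdot (u n).1 w - k) ^+ 2 <= n.+1%:R^-1 * rnorm w ^+ 2.
    apply: quad_form_discr; rewrite ?sqr_ge0 ?invr_ge0// => c.
    have := IQ _ _ (GD c^* _ _ _ _ Gwk Gn); rewrite conjCK /Q/=.
    rewrite rnorm_sqrD rnormZ_cabs exprMn cabs_conj ReD hdotZl.
    have -> : complex.Re (c^* * hdot w (u n).1) = complex.Re (c * hdot (u n).1 w).
      by rewrite hdotC -rmorphM cRe_conj.
    rewrite mulrBr ReD ReN; move: Qn; rewrite /Q.
    set i1 := n.+1%:R^-1; lra.
  rewrite -(@ler_pXn2r _ 2)// ?nnegrE ?cabs_ge0 ?(ltW e0)//.
  apply: (le_trans zn).
  have n1 : n.+1%:R^-1 <= e ^+ 2 / (rnorm w ^+ 2 + 1).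
    rewrite (le_trans _ (ltW NP))// lef_pV2 ?posrE// ler_nat//.
  rewrite (le_trans (ler_wpM2r (sqr_ge0 _) n1))//.
  by rewrite -mulrA ler_piMr ?sqr_ge0// mulrC ler_pdivrMr// mul1r lerDl.
exists l; split => //; last first.
  apply: (closed_seq_lim (u := fun n => (u n).1)) ul; first exact: closed_closure.
  by move=> n; apply: subset_closure; exists (u n).2; have [] := uP n.
apply/ler_addgt0Pr => e e0.
have e20 : 0 < e / 2 by rewrite divr_gt0.
have [N uN] := ul _ e20.
have [GN _] := uP N.
have lN := uN N (leqnn _).
(* The limit [l] may lie outside the domain of the graph, so its norm is estimated through [u N]:
   there [l] takes the value of the functional, which [C] bounds. *)
have N1 : rnorm (u N).1 ^+ 2 <= rnorm (u N).1 * (C + e / 2).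
  have -> : rnorm (u N).1 ^+ 2 = complex.Re (hdot l (u N).1 + hdot ((u N).1 - l) (u N).1).
    by rewrite hdotBl addrC subrK -rnorm_sqr.
  rewrite ReD (lE _ _ GN) mulrDr lerD//.
    by rewrite mulrC (le_trans (Re_le_cabs _))// GC.
  rewrite (le_trans (Re_le_cabs _))// (le_trans (cauchy_schwarz _ _))// mulrC.
  by rewrite ler_wpM2l ?rnorm_ge0// ltW.
have N2 : rnorm (u N).1 <= C + e / 2.
  have [->|n0] := eqVneq (rnorm (u N).1) 0; first by rewrite addr_ge0// divr_ge0// ltW.
  have n0' : 0 < rnorm (u N).1 by rewrite lt_neqAle eq_sym n0 rnorm_ge0.
  by rewrite -(ler_pM2l n0') -expr2.
have -> : l = (u N).1 - ((u N).1 - l) by rewrite opprB addrC subrK.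
rewrite (le_trans (rnormB _ _))// (splitr e) addrA lerD// ltW//.
Qed.

End Riesz.

Section LinearCombinations.
Variables (R : realType) (H : hilbertType R).
Implicit Types (x y v w : H) (c : R[i]).

Definition lincomb (I : Type) (f : I -> H) (l : seq (R[i] * I)) : H :=
  \sum_(p <- l) p.1 *: f p.2.

Definition scale_list (I : Type) c (l : seq (R[i] * I)) :=
  [seq (c * p.1, p.2) | p <- l].

Lemma lincomb_cat (I : Type) (f : I -> H) l1 l2 :
  lincomb f (l1 ++ l2) = lincomb f l1 + lincomb f l2.
Proof. exact: big_cat. Qed.

Lemma lincomb_scale (I : Type) (f : I -> H) c l :
  lincomb f (scale_list c l) = c *: lincomb f l.
Proof.
by rewrite /lincomb /scale_list big_map scaler_sumr; apply: eq_bigr => p _; rewrite scalerA.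
Qed.

Lemma lincomb1 (I : Type) (f : I -> H) i : lincomb f [:: (1, i)] = f i.
Proof. by rewrite /lincomb big_seq1 scale1r. Qed.

Lemma lincomb_closed_span (I : Type) (f : I -> H) l :
  closed_span (range f) (lincomb f l).
Proof.
elim: l => [|p l IH]; first by rewrite /lincomb big_nil; exact: closed_span0.
rewrite /lincomb big_cons; apply: closed_spanP => //.
by apply: sub_closed_span; exists p.2.
Qed.

(** The bound also makes the prescription consistent: two combinations of the [f i] with the same
    value get the same number. This is why the functional is passed on as a graph and not as a
    function. *)
Lemma rep_vector (I : Type) (f : I -> H) (k : I -> R[i]) (C : R) : 0 <= C ->
  (forall l, cabs (\sum_(p <- l) (p.1)^* * k p.2) <= C * rnorm (lincomb f l)) ->
  exists v, [/\ forall i, hdot v (f i) = k i, rnorm v <= C &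
    closed_span (range f) v].
Proof.
move=> C0 kC.
pose G w (z : R[i]) := exists l, w = lincomb f l /\ z = \sum_(p <- l) (p.1)^* * k p.2.
have [|c w w' z z' [l [-> ->]] [l' [-> ->]]|w z [l [-> ->]]|v [vG vC Gv]] :=
  @riesz_graph _ _ G C C0.
- by exists [::]; rewrite /lincomb !big_nil.
- exists (scale_list c l ++ l'); rewrite lincomb_cat lincomb_scale; split => //.
  rewrite big_cat big_map mulr_sumr/=; congr (_ + _).
  by apply: eq_bigr => p _; rewrite rmorphM mulrA.
- exact: kC.
exists v; split => // [i|].
  rewrite -(lincomb1 f i); apply: vG; exists [:: (1, i)].
  by rewrite big_seq1 conjC1 mul1r.
apply: closed_closed_span; move: v Gv {vG vC}; apply: closureS => _ [_ [l [-> _]]].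
exact: lincomb_closed_span.
Qed.

Lemma closed_hdot0 w : closed [set x | hdot x w = 0].
Proof.
apply/closed_rnorm => x xP /=; apply: cabs_eq0; apply/eqP.
rewrite eq_le cabs_ge0 andbT; apply/ler_addgt0Pr => e e0; rewrite add0r.
have w1 : 0 < rnorm w + 1 by rewrite ltr_wpDl// rnorm_ge0.
have [y /= yw xy] := xP _ (divr_gt0 e0 w1).
rewrite -[hdot x w]subr0 -yw -hdotBl (le_trans (cauchy_schwarz _ _))//.
rewrite (@le_trans _ _ (e / (rnorm w + 1) * rnorm w))//.
  by rewrite ler_wpM2r ?rnorm_ge0// ltW.
by rewrite -mulrA ler_piMr ?(ltW e0)// mulrC ler_pdivrMr// mul1r lerDl.
Qed.

Lemma closed_span_orth (S : set H) v w :
  (forall s, S s -> hdot s w = 0) -> closed_span S v -> hdot v w = 0.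
Proof.
move=> Sw; apply: (@closed_span_min _ _ S [set v | hdot v w = 0]) => //=.
- exact: hdot0l.
- by move=> c x y /= xw yw; rewrite hdotDl hdotZl xw yw mulr0 addr0.
- exact: closed_hdot0.
Qed.

Lemma closed_span_orth_eq0 (S : set H) v :
  (forall s, S s -> hdot s v = 0) -> closed_span S v -> v = 0.
Proof. by move=> Sv vS; apply: hdot_self_eq0; exact: closed_span_orth vS. Qed.

Definition spanning (S : set H) := closed_span S = setT.

(** The projection is the vector of the closed span that represents the functional [hdot v] on
    [S]. *)
Lemma orth_projection (S : set H) v : exists2 p, closed_span S p &
  forall s, S s -> hdot s (v - p) = 0.
Proof.
pose f (s : {s | S s}) : H := sval s.
have [|l|p [pE _ pS]] := @rep_vector _ f (fun s => hdot v (f s)) (rnorm v).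
- exact: rnorm_ge0.
- have -> : \sum_(p <- l) (p.1)^* * hdot v (f p.2) = hdot v (lincomb f l).
    by rewrite hdot_sumr; apply: eq_bigr => p _; rewrite hdotZr.
  exact: cauchy_schwarz.
exists p => [|s Ss].
  suff <- : range f = S by [].
  by apply/seteqP; split=> [_ [[s Ss] _ <-]//|s Ss]; exists (exist _ s Ss).
by rewrite hdotC hdotBl (pE (exist _ s Ss)) subrr conjC0.
Qed.

(** Density is tested below by orthogonality, through this equivalence. *)
Lemma spanningP (S : set H) :
  spanning S <-> forall v, (forall s, S s -> hdot s v = 0) -> v = 0.
Proof.
split=> [tS v Sv|SP].
  by apply: (closed_span_orth_eq0 Sv); rewrite tS.
apply/seteqP; split=> // v _.
have [p Sp vp] := orth_projection S v.
by rewrite -[v](subrK p) (SP _ vp) add0r.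
Qed.

End LinearCombinations.

(** * Bounded operators *)

Section Operators.
Variables (R : realType).
Implicit Types (H K L : hilbertType R).

Lemma opP H K (T S : 'B(H, K)) : (forall x, T x = S x) -> T = S.
Proof. by move=> TS; apply/val_inj/funext. Qed.

Lemma op_eq_hdot H K (T S : 'B(H, K)) :
  (forall x y, hdot (T x) y = hdot (S x) y) -> T = S.
Proof. by move=> TS; apply: opP => x; apply: eq_hdotl. Qed.

Lemma op0E H K x : (0 : 'B(H, K)) x = 0. Proof. by []. Qed.
Lemma opDE H K (T S : 'B(H, K)) x : (T + S) x = T x + S x. Proof. by []. Qed.
Lemma opNE H K (T : 'B(H, K)) x : (- T) x = - T x. Proof. by []. Qed.
Lemma opBE H K (T S : 'B(H, K)) x : (T - S) x = T x - S x. Proof. by []. Qed.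
Lemma opZE H K c (T : 'B(H, K)) x : (c *: T) x = c *: T x. Proof. by []. Qed.
Lemma op_sumE H K (I : Type) (r : seq I) (P : pred I) (F : I -> 'B(H, K)) x :
  (\sum_(i <- r | P i) F i) x = \sum_(i <- r | P i) F i x.
Proof. by apply: (big_morph (fun T : 'B(H, K) => T x)). Qed.
Lemma op_linD H K (T : 'B(H, K)) x y : T (x + y) = T x + T y.
Proof. exact: linearD. Qed.
Lemma op_linB H K (T : 'B(H, K)) x y : T (x - y) = T x - T y.
Proof. exact: linearB. Qed.
Lemma op_linN H K (T : 'B(H, K)) x : T (- x) = - T x.
Proof. exact: linearN. Qed.
Lemma op_linZ H K (T : 'B(H, K)) c x : T (c *: x) = c *: T x.
Proof. exact: linearZ. Qed.
Lemma op_lin0 H K (T : 'B(H, K)) : T 0 = 0.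
Proof. exact: linear0. Qed.
Lemma op_lin_sum H K (T : 'B(H, K)) (I : Type) (r : seq I) (P : pred I) (F : I -> H) :
  T (\sum_(i <- r | P i) F i) = \sum_(i <- r | P i) T (F i).
Proof. exact: linear_sum. Qed.
Lemma op_compE H K L (T : 'B(K, L)) (S : 'B(H, K)) x : (T *o S) x = T (S x).
Proof. by []. Qed.

Lemma bounded_linear_op H K (f : H -> K) (C : R) :
  (forall c x y, f (c *: x + y) = c *: f x + f y) ->
  (forall x, rnorm (f x) <= C * rnorm x) -> exists T : 'B(H, K), forall x, T x = f x.
Proof.
move=> lf bf.
pose g : {linear H -> K} := HB.pack f (GRing.isLinear.Build _ _ _ _ f lf).
have fP : f \in @bounded_op_pred R H K.
  apply/bounded_op_predP; split => //.
  apply/(@linear_bounded_continuous _ _ _ g)/linear_boundedP.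
  near=> r => x; rewrite !rnormE.
  have rC : `|C|%:C%C <= r by near: r; apply: nbhs_pinfty_ge; rewrite realE ler0c normr_ge0.
  have rE : r = (complex.Re r)%:C%C.
    by rewrite RRe_real// ger0_real// (le_trans _ rC)// ler0c.
  rewrite rE -rmorphM lecR (le_trans (bf x))// ler_wpM2r ?rnorm_ge0//.
  by rewrite (le_trans (ler_norm _))// -lecR -rE.
by exists (BoundedOp fP).
Unshelve. all: by end_near. Qed.

Lemma opnorm_le_bound H K (T : 'B(H, K)) (C : R) : 0 <= C ->
  (forall x, rnorm (T x) <= C * rnorm x) -> opnorm T <= C.
Proof.
move=> C0 TC; apply: opnorm_le => x x1.
by rewrite (le_trans (TC x))// ler_piMr.
Qed.

Lemma opnorm_le_form H K (T : 'B(H, K)) (C : R) : 0 <= C ->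
  (forall x y, cabs (hdot (T x) y) <= C * rnorm x * rnorm y) -> opnorm T <= C.
Proof.
move=> C0 TC; apply: opnorm_le_bound => // x.
have [->|Tx0] := eqVneq (rnorm (T x)) 0; first by rewrite mulr_ge0 ?rnorm_ge0.
have Tx : 0 < rnorm (T x) by rewrite lt_neqAle eq_sym Tx0 rnorm_ge0.
rewrite -(ler_pM2r Tx) -expr2 rnorm_sqr (le_trans (Re_le_cabs _))//.
Qed.

Lemma rnorm_opnorm H K (T : 'B(H, K)) : rnorm T = opnorm T.
Proof. by []. Qed.

Lemma opnormD H K (T S : 'B(H, K)) : opnorm (T + S) <= opnorm T + opnorm S.
Proof. by rewrite -!rnorm_opnorm; exact: rnormD. Qed.
Lemma opnormN H K (T : 'B(H, K)) : opnorm (- T) = opnorm T.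
Proof. by rewrite -!rnorm_opnorm /rnorm normrN. Qed.
Lemma opnormB H K (T S : 'B(H, K)) : opnorm (T - S) <= opnorm T + opnorm S.
Proof. by rewrite -(opnormN S) opnormD. Qed.
Lemma opnormZ H K c (T : 'B(H, K)) : opnorm (c *: T) = cabs c * opnorm T.
Proof. by rewrite -!rnorm_opnorm; exact: rnormZ. Qed.
Lemma opnorm0 H K : opnorm (0 : 'B(H, K)) = 0.
Proof. by rewrite -!rnorm_opnorm; exact: rnorm0. Qed.

Lemma opnorm_comp H K L (T : 'B(K, L)) (S : 'B(H, K)) :
  opnorm (T *o S) <= opnorm T * opnorm S.
Proof.
apply: opnorm_le_bound => [|x]; first by rewrite mulr_ge0 ?opnorm_ge0.
rewrite op_compE (le_trans (rnorm_opE _ _))// -mulrA ler_wpM2l ?opnorm_ge0//.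
exact: rnorm_opE.
Qed.

Lemma op_compA H K L M (T : 'B(L, M)) (S : 'B(K, L)) (Q : 'B(H, K)) :
  T *o (S *o Q) = T *o S *o Q.
Proof. exact: opP. Qed.
Lemma op_compDl H K L (T S : 'B(K, L)) (Q : 'B(H, K)) :
  (T + S) *o Q = T *o Q + S *o Q.
Proof. exact: opP. Qed.
Lemma op_compDr H K L (T S : 'B(H, K)) (Q : 'B(K, L)) :
  Q *o (T + S) = Q *o T + Q *o S.
Proof. by apply: opP => x; rewrite !(opDE, op_compE) linearD. Qed.
Lemma op_compZl H K L c (T : 'B(K, L)) (Q : 'B(H, K)) :
  (c *: T) *o Q = c *: (T *o Q).
Proof. exact: opP. Qed.
Lemma op_compZr H K L c (T : 'B(H, K)) (Q : 'B(K, L)) :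
  Q *o (c *: T) = c *: (Q *o T).
Proof. by apply: opP => x; rewrite !(opZE, op_compE) linearZ. Qed.
Lemma op_comp0l H K L (Q : 'B(H, K)) : (0 : 'B(K, L)) *o Q = 0.
Proof. exact: opP. Qed.
Lemma op_comp0r H K L (Q : 'B(K, L)) : Q *o (0 : 'B(H, K)) = 0.
Proof. by apply: opP => x; rewrite !(op0E, op_compE) linear0. Qed.
Lemma op_compNr H K L (T : 'B(H, K)) (Q : 'B(K, L)) : Q *o (- T) = - (Q *o T).
Proof. by apply: opP => x; rewrite !(opNE, op_compE) linearN. Qed.
Lemma op_compBl H K L (T S : 'B(K, L)) (Q : 'B(H, K)) :
  (T - S) *o Q = T *o Q - S *o Q.
Proof. exact: opP. Qed.
Lemma op_compBr H K L (T S : 'B(H, K)) (Q : 'B(K, L)) :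
  Q *o (T - S) = Q *o T - Q *o S.
Proof. by rewrite op_compDr op_compNr. Qed.
Lemma op_comp_suml H K L (I : Type) (r : seq I) (P : pred I)
  (F : I -> 'B(K, L)) (Q : 'B(H, K)) :
  (\sum_(i <- r | P i) F i) *o Q = \sum_(i <- r | P i) (F i *o Q).
Proof.
by apply: (big_morph (fun T => T *o Q)) => [? ?|]; rewrite ?op_compDl ?op_comp0l.
Qed.
Lemma op_comp_sumr H K L (I : Type) (r : seq I) (P : pred I)
  (F : I -> 'B(H, K)) (Q : 'B(K, L)) :
  Q *o (\sum_(i <- r | P i) F i) = \sum_(i <- r | P i) (Q *o F i).
Proof.
by apply: (big_morph (op_comp Q)) => [? ?|]; rewrite ?op_compDr ?op_comp0r.
Qed.

Lemma op_id_subproof H : (fun x : H => x) \in @bounded_op_pred R H H.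
Proof. by apply/bounded_op_predP; split=> // x; apply: cvg_id. Qed.

Definition op_id H : 'B(H, H) := BoundedOp (op_id_subproof H).

Lemma op_comp1l H K (T : 'B(H, K)) : op_id K *o T = T.
Proof. exact: opP. Qed.
Lemma op_comp1r H K (T : 'B(H, K)) : T *o op_id H = T.
Proof. exact: opP. Qed.
Lemma opnorm_id H : opnorm (op_id H) <= 1.
Proof. by apply: opnorm_le. Qed.

(** The Riesz vectors [w j] are the images of the [g j] under the adjoint, and a second use of Riesz
    turns them into [T]. When the families do not span, the last two conclusions still determine
    [T]: it is 0 off the first closed span and takes its values in the second. *)
Lemma form_op H K (I J : Type) (f : I -> H) (g : J -> K) (k : I -> J -> R[i])
    (C : R) : 0 <= C ->
  (forall l m, cabs (\sum_(p <- l) \sum_(q <- m) p.1 * (q.1)^* * k p.2 q.2) <=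
     C * rnorm (lincomb f l) * rnorm (lincomb g m)) ->
  exists T : 'B(H, K), [/\ forall i j, hdot (T (f i)) (g j) = k i j,
    opnorm T <= C,
    forall x, (forall i, hdot (f i) x = 0) -> T x = 0 &
    forall x, closed_span (range g) (T x)].
Proof.
move=> C0 kC.
have row j : exists w, [/\ forall i, hdot w (f i) = (k i j)^*,
    rnorm w <= C * rnorm (g j) & closed_span (range f) w].
  apply: rep_vector => [|l]; first by rewrite mulr_ge0 ?rnorm_ge0.
  have := kC l [:: (1, j)]; rewrite lincomb1 mulrAC.
  rewrite -cabs_conj rmorph_sum/=; congr (cabs _ <= _); apply: eq_bigr => p _.
  by rewrite big_seq1 conjC1 mulr1 rmorphM.
have [w wP] := boolp.choice row.
have wE i j : hdot (f i) (w j) = k i j by have [wi _ _] := wP j; rewrite hdotC wi conjCK.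
have lw m l : hdot (lincomb f l) (lincomb w m) =
    \sum_(p <- l) \sum_(q <- m) p.1 * (q.1)^* * k p.2 q.2.
  rewrite hdot_suml; apply: eq_bigr => p _; rewrite hdot_sumr.
  by apply: eq_bigr => q _; rewrite hdotZl hdotZr wE mulrA.
(* The Riesz vector [v] that acts on the [f i] like [lincomb w m] satisfies the bound. Both vectors
   lie in the closed span of the [f i] and have the same products with them, so they agree. *)
have wC m : rnorm (lincomb w m) <= C * rnorm (lincomb g m).
  have [v [vE vC vS]] : exists v, [/\ forall i, hdot v (f i) = hdot (lincomb w m) (f i),
      rnorm v <= C * rnorm (lincomb g m) & closed_span (range f) v].
    apply: rep_vector => [|l]; first by rewrite mulr_ge0 ?rnorm_ge0.
    have -> : \sum_(p <- l) (p.1)^* * hdot (lincomb w m) (f p.2) =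
        hdot (lincomb w m) (lincomb f l).
      by rewrite hdot_sumr; apply: eq_bigr => p _; rewrite hdotZr.
    by rewrite hdotC cabs_conj lw mulrAC.
  suff <- : v = lincomb w m by [].
  apply/eqP; rewrite -subr_eq0; apply/eqP/(@closed_span_orth_eq0 _ _ (range f)).
    by move=> _ [i _ <-]; rewrite hdotC hdotBl vE subrr conjC0.
  rewrite addrC -scaleN1r; apply: closed_spanP => //.
  elim: m {vE vC lw vS} => [|q m IH]; rewrite /lincomb ?big_nil ?big_cons.
    exact: closed_span0.
  by apply: closed_spanP => //; have [] := wP q.2.
have img x : exists v, [/\ forall j, hdot v (g j) = hdot x (w j),
    rnorm v <= C * rnorm x & closed_span (range g) v].
  apply: rep_vector => [|m]; first by rewrite mulr_ge0 ?rnorm_ge0.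
  have -> : \sum_(p <- m) (p.1)^* * hdot x (w p.2) = hdot x (lincomb w m).
    by rewrite hdot_sumr; apply: eq_bigr => p _; rewrite hdotZr.
  rewrite (le_trans (cauchy_schwarz _ _))// [leRHS]mulrAC mulrC ler_wpM2r ?rnorm_ge0//.
have [T TP] := boolp.choice img.
have Tlin c x y : T (c *: x + y) = c *: T x + T y.
  have [vE _ vS] := TP (c *: x + y).
  have [xE _ xS] := TP x; have [yE _ yS] := TP y.
  apply/eqP; rewrite -subr_eq0; apply/eqP/(@closed_span_orth_eq0 _ _ (range g)).
    move=> _ [j _ <-]; rewrite hdotC hdotBl vE 2!hdotDl !hdotZl xE yE.
    by rewrite subrr conjC0.
  rewrite addrC -scaleN1r; apply: closed_spanP => //.
  exact: closed_spanP.
have [|T' T'E] := @bounded_linear_op _ _ T C Tlin; first by move=> x; have [] := TP x.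
exists T'; split=> [i j||x fx|x].
- by rewrite T'E; have [-> _ _] := TP (f i).
- by apply: opnorm_le_bound => // x; rewrite T'E; have [] := TP x.
- rewrite T'E; have [xE _ xS] := TP x.
  apply: (@closed_span_orth_eq0 _ _ (range g)) => // _ [j _ <-].
  rewrite hdotC xE; have [_ _ wS] := wP j.
  rewrite -hdotC; apply: closed_span_orth wS => _ [i _ <-]; exact: fx.
- by rewrite T'E; have [] := TP x.
Qed.

Lemma adj_exists H K (T : 'B(H, K)) :
  exists S : 'B(K, H), forall x y, hdot (T x) y = hdot x (S y).
Proof.
have [||S [SE _ _ _]] := @form_op K H K H id id (fun y x => hdot y (T x)) (opnorm T).
- exact: opnorm_ge0.
- move=> l m.
  have -> : \sum_(p <- l) \sum_(q <- m) p.1 * (q.1)^* * hdot p.2 (T q.2) =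
     hdot (lincomb id l) (T (lincomb id m)).
    rewrite linear_sum hdot_suml; apply: eq_bigr => p _; rewrite hdot_sumr.
    by apply: eq_bigr => q _; rewrite linearZ hdotZl hdotZr mulrA.
  rewrite (le_trans (cauchy_schwarz _ _))// mulrAC mulrC ler_wpM2r ?rnorm_ge0//.
  exact: rnorm_opE.
by exists S => x y; rewrite hdotC -SE -hdotC.
Qed.

Lemma adjP H K (T : 'B(H, K)) x y : hdot (T x) y = hdot x (adj T y).
Proof.
rewrite /adj; case: xgetP => [S _ -> //|no].
by have [S SE] := adj_exists T; have := no S.
Qed.

Lemma adjP' H K (T : 'B(H, K)) x y : hdot (adj T x) y = hdot x (T y).
Proof. by rewrite hdotC -adjP -hdotC. Qed.

Lemma adj_uniq H K (T : 'B(H, K)) (S : 'B(K, H)) :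
  (forall x y, hdot (T x) y = hdot x (S y)) -> adj T = S.
Proof. by move=> TS; apply: opP => y; apply: eq_hdotr => x; rewrite -adjP. Qed.

Lemma adjK H K (T : 'B(H, K)) : adj (adj T) = T.
Proof. by apply: adj_uniq => x y; rewrite adjP'. Qed.
Lemma adjD H K (T S : 'B(H, K)) : adj (T + S) = adj T + adj S.
Proof. by apply: adj_uniq => x y; rewrite opDE hdotDl !adjP opDE hdotDr. Qed.
Lemma adjZ H K c (T : 'B(H, K)) : adj (c *: T) = c^* *: adj T.
Proof. by apply: adj_uniq => x y; rewrite opZE hdotZl adjP opZE hdotZr conjCK. Qed.
Lemma adj0 H K : adj (0 : 'B(H, K)) = 0.
Proof. by apply: adj_uniq => x y; rewrite !op0E hdot0l hdot0r. Qed.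
Lemma adjN H K (T : 'B(H, K)) : adj (- T) = - adj T.
Proof. by apply: adj_uniq => x y; rewrite opNE hdotNl adjP opNE hdotNr. Qed.
Lemma adjB H K (T S : 'B(H, K)) : adj (T - S) = adj T - adj S.
Proof. by rewrite adjD adjN. Qed.
Lemma adj_comp H K L (T : 'B(K, L)) (S : 'B(H, K)) :
  adj (T *o S) = adj S *o adj T.
Proof. by apply: adj_uniq => x y; rewrite !op_compE !adjP. Qed.
Lemma adj_id H : adj (op_id H) = op_id H.
Proof. exact: adj_uniq. Qed.
Lemma adj_sum H K (I : Type) (r : seq I) (P : pred I) (F : I -> 'B(H, K)) :
  adj (\sum_(i <- r | P i) F i) = \sum_(i <- r | P i) adj (F i).
Proof. by apply: (big_morph (@adj R H K)) => [? ?|]; rewrite ?adjD ?adj0. Qed.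

Lemma rnorm_sqr_adj H K (T : 'B(H, K)) x :
  rnorm (T x) ^+ 2 = complex.Re (hdot ((adj T *o T) x) x).
Proof. by rewrite rnorm_sqr adjP hdotC cRe_conj. Qed.

Lemma opnorm_adj_le H K (T : 'B(H, K)) : opnorm (adj T) <= opnorm T.
Proof.
apply: opnorm_le_form => [|x y]; first exact: opnorm_ge0.
rewrite adjP' (le_trans (cauchy_schwarz _ _))// mulrAC mulrC ler_wpM2r ?rnorm_ge0//.
exact: rnorm_opE.
Qed.

Lemma opnorm_adj H K (T : 'B(H, K)) : opnorm (adj T) = opnorm T.
Proof.
by apply/eqP; rewrite eq_le opnorm_adj_le/= -{1}(adjK T) opnorm_adj_le.
Qed.

Lemma comp_adj_eq0 H K (T : 'B(H, K)) : T *o adj T = 0 -> T = 0.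
Proof.
move=> TT; rewrite -(adjK T); suff -> : adj T = 0 by rewrite adj0.
apply: opP => x; apply: hdot_self_eq0; rewrite adjP'.
by rewrite -op_compE TT op0E hdot0r.
Qed.

Lemma op_seq_lim H K (u : nat -> 'B(H, K)) :
  cauchy_seq u -> exists T, seq_lim u T.
Proof.
move=> uC.
have exl x : exists l, seq_lim (fun n => u n x) l.
  apply: complete_seq_lim => e e0.
  have x1 : 0 < rnorm x + 1 by rewrite ltr_wpDl// rnorm_ge0.
  have [N uN] := uC _ (divr_gt0 e0 x1).
  exists N => m n Nm Nn; rewrite -opBE (le_lt_trans (rnorm_opE _ _))//.
  rewrite (@le_lt_trans _ _ (e / (rnorm x + 1) * rnorm x))//.
    by rewrite ler_wpM2r ?rnorm_ge0// ltW//; exact: uN.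
  by rewrite -mulrA gtr_pMr// mulrC ltr_pdivrMr// mul1r ltrDl.
have [T TE] := boolp.choice exl.
have Tlin c x y : T (c *: x + y) = c *: T x + T y.
  apply: eq_hdotl => z; apply: (seq_lim_hdot_eq (TE _)) => e e0.
  pose D := (cabs c + 1) * (rnorm z + 1).
  have D0 : 0 < D by rewrite mulr_gt0// ltr_wpDl ?cabs_ge0 ?rnorm_ge0.
  have e20 : 0 < e / 2 by rewrite divr_gt0.
  have [N1 xN] := TE x _ (divr_gt0 e20 D0).
  have [N2 yN] := TE y _ (divr_gt0 e20 D0).
  exists (maxn N1 N2) => n; rewrite geq_max => /andP[/xN xn /yN yn].
  rewrite -hdotBl linearP opprD addrACA -scalerBr.
  rewrite (le_trans (cauchy_schwarz _ _))//.
  rewrite (@le_trans _ _ ((cabs c + 1) * (e / D) * rnorm z))//.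
    rewrite ler_wpM2r ?rnorm_ge0// (le_trans (rnormD _ _))// mulrDl mul1r.
    rewrite rnormZ_cabs lerD//.
      rewrite ler_wpM2l ?cabs_ge0// (le_trans (ltW xn))//.
      by rewrite ler_pM2r ?invr_gt0// ler_pdivrMr// mulr_natr mulr2n lerDl ltW.
    rewrite (le_trans (ltW yn))//.
    by rewrite ler_pM2r ?invr_gt0// ler_pdivrMr// mulr_natr mulr2n lerDl ltW.
  have -> : (cabs c + 1) * (e / D) * rnorm z = e / (rnorm z + 1) * rnorm z.
    rewrite /D; field; apply/andP; split; first by rewrite gt_eqF// ltr_wpDl ?rnorm_ge0.
    by rewrite gt_eqF// ltr_wpDl ?cabs_ge0.
  by rewrite -mulrA ler_piMr ?(ltW e0)// mulrC ler_pdivrMr ?ltr_wpDl ?rnorm_ge0// mul1r lerDl.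
have dist e : 0 < e -> exists N, forall n, (N <= n)%N -> forall x,
    rnorm (u n x - T x) <= e * rnorm x.
  move=> e0; have [N uN] := uC e e0; exists N => n Nn x.
  apply/ler_addgt0Pr => d d0; have [M TM] := TE x d d0.
  rewrite (le_trans (rnorm_distD (u (maxn N M) x) _ _))// lerD//.
    rewrite -opBE (le_trans (rnorm_opE _ _))// ler_wpM2r ?rnorm_ge0// ltW//.
    by apply: uN => //; rewrite leq_maxl.
  by rewrite ltW// TM// leq_maxr.
have [N0 uN0] := dist 1 ltr01.
have [|T' T'E] := @bounded_linear_op _ _ T (1 + opnorm (u N0)) Tlin.
  move=> x; rewrite -[T x](subKr (u N0 x)) (le_trans (rnormB _ _))// addrC mulrDl.
  by rewrite lerD ?uN0 ?rnorm_opE.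
exists T' => e e0.
have e20 : 0 < e / 2 by rewrite divr_gt0.
have [N uN] := dist _ e20; exists N => n Nn.
rewrite (@le_lt_trans _ _ (e / 2))//; last by rewrite ltr_pdivrMr// mulr_natr mulr2n ltrDl.
by apply: opnorm_le_bound; rewrite ?ltW// => x; rewrite opBE T'E uN.
Qed.

End Operators.

(** * Cauchy sequences and completeness *)

Section Completeness.
Variable R : realType.

Lemma real_cauchy_lim (r : nat -> R) :
  (forall e : R, 0 < e ->
    exists N, forall m n, (N <= m)%N -> (N <= n)%N -> `|r m - r n| < e) ->
  exists l, forall e : R, 0 < e ->
    exists N, forall n, (N <= n)%N -> `|r n - l| < e.
Proof.
move=> rC.
have : cauchy (r @ \oo).
  apply: cauchy_exP => e e0; have [N rN] := rC e e0.
  exists (r N); exists N => // n /= Nn.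
  by rewrite -ball_normE /=; exact: rN.
move=> /cauchy_cvg /cvg_ex[l rl]; exists l => e e0.
have /rl[N _ rN] := nbhsx_ballx l _ e0.
exists N => n Nn; have := rN n Nn.
by rewrite -ball_normE /= distrC.
Qed.

Lemma complex_cauchy_lim (z : nat -> R[i]) :
  (forall e : R, 0 < e ->
    exists N, forall m n, (N <= m)%N -> (N <= n)%N -> cabs (z m - z n) < e) ->
  exists l, forall e : R, 0 < e ->
    exists N, forall n, (N <= n)%N -> cabs (z n - l) < e.
Proof.
move=> zC.
have [|a aP] := @real_cauchy_lim (fun n => complex.Re (z n)).
  move=> e /zC[N zN]; exists N => m n /zN{}zN /zN; apply: le_lt_trans.
  by rewrite -ReN -ReD normr_Re_cabs.
have [|b bP] := @real_cauchy_lim (fun n => complex.Im (z n)).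
  move=> e /zC[N zN]; exists N => m n /zN{}zN /zN; apply: le_lt_trans.
  by rewrite (le_trans _ (normr_Im_cabs _))// raddfB.
exists (Complex a b) => e e0.
have e20 : 0 < e / 2 by rewrite divr_gt0.
have [N1 aN] := aP _ e20; have [N2 bN] := bP _ e20.
exists (maxn N1 N2) => n; rewrite geq_max => /andP[/aN an /bN bn].
rewrite (le_lt_trans (cabs_le_Re_Im _))// (splitr e) ltrD//.
  by rewrite raddfB.
by rewrite raddfB.
Qed.

(** The Hilbert structure asks for completeness in terms of filters, whereas the kernel space is
    handled with sequences. Centres of balls of radius [n.+1%:R^-1] that belong to the filter form a
    Cauchy sequence with the same limit. *)
Lemma complete_of_seq_lim (V : normedModType R[i]) :
  (forall u : nat -> V, cauchy_seq u -> exists l, seq_lim u l) ->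
  forall F : set_system V, ProperFilter F -> cauchy F -> cvg F.
Proof.
move=> VC F PF /cauchyP Fc.
have ex n : exists x, F (ball x (n.+1%:R^-1)%:C%C).
  by apply: Fc; rewrite ltcR invr_gt0.
have [u uF] := boolp.choice ex.
have inv_small (e : R) : 0 < e -> exists N, forall n, (N <= n)%N -> n.+1%:R^-1 < e.
  move=> e0; have [N] := ltr_add_invr e0; rewrite add0r => NP.
  exists N => n Nn; apply: le_lt_trans NP.
  by rewrite lef_pV2 ?posrE// ler_nat.
have [|l ul] := VC u.
  move=> e e0; have e20 : 0 < e / 2 by rewrite divr_gt0.
  have [N NP] := inv_small _ e20; exists N => m n Nm Nn.
  have [x []] := filter_ex (filterI (uF m) (uF n)).
  rewrite -!ball_normE /= !rnormE !ltcR => mx nx.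
  have -> : u m - u n = (u m - x) - (u n - x) by rewrite opprB addrA subrK.
  rewrite (le_lt_trans (rnormD _ _))// /rnorm normrN -!/(rnorm _).
  by rewrite (splitr e) ltrD// ?(lt_trans mx)// ?(lt_trans nx)// NP.
apply/cvg_ex; exists l => B /nbhs_ballP[e /= e0 lB].
have eE : e = (complex.Re e)%:C%C by rewrite RRe_real// gtr0_real.
have e0' : 0 < complex.Re e by rewrite -ltcR -eE.
have e20 : 0 < complex.Re e / 2 by rewrite divr_gt0.
have [N1 N1P] := inv_small _ e20; have [N2 N2P] := ul _ e20.
pose n := maxn N1 N2.
apply: filterS (uF n) => x; rewrite -ball_normE /= rnormE ltcR => nx.
apply: lB; rewrite -ball_normE /= eE rnormE ltcR.
have -> : l - x = (u n - x) - (u n - l).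
  by rewrite opprB [RHS]addrC addrA subrK.
rewrite (le_lt_trans (rnormD _ _))// /rnorm normrN -!/(rnorm _).
rewrite (splitr (complex.Re e)) ltrD ?N2P ?leq_maxr//.
by rewrite (lt_trans nx)// N1P// leq_maxl.
Qed.

End Completeness.

(** * The Hilbert space of a positive definite kernel *)

Section KernelForm.
Variables (R : realType) (S : Type) (k : S -> S -> R[i]).
Implicit Types (l m : seq (R[i] * S)) (c : R[i]) (F : S -> R[i]).

Definition kform l m : R[i] :=
  \sum_(p <- l) \sum_(q <- m) p.1 * (q.1)^* * k p.2 q.2.

(** For [F] in the kernel space this is the scalar product of [F] with the combination of kernel
    vectors that [m] stands for, by the reproducing property. *)
Definition evalf F m : R[i] := \sum_(q <- m) (q.1)^* * F q.2.

Definition kfun l : S -> R[i] := fun t => \sum_(p <- l) p.1 * k p.2 t.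

Lemma evalf_kfun l m : evalf (kfun l) m = kform l m.
Proof.
rewrite /kform exchange_big; apply: eq_bigr => q _; rewrite mulr_sumr.
by apply: eq_bigr => p _; rewrite mulrA (mulrC (q.1)^*).
Qed.

Lemma evalf_cat F m1 m2 : evalf F (m1 ++ m2) = evalf F m1 + evalf F m2.
Proof. exact: big_cat. Qed.

Lemma evalf_scale F c m : evalf F (scale_list c m) = c^* * evalf F m.
Proof.
rewrite /evalf big_map mulr_sumr; apply: eq_bigr => p _.
by rewrite rmorphM mulrA.
Qed.

Lemma evalfP c F G m :
  evalf (c *: F + G) m = c * evalf F m + evalf G m.
Proof.
rewrite /evalf mulr_sumr -big_split; apply: eq_bigr => p _ /=.
by rewrite mulrDr -[(c *: F) _]/(c * F p.2) mulrCA.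
Qed.

Lemma evalf1 F s : evalf F [:: (1, s)] = F s.
Proof. by rewrite /evalf big_seq1 conjC1 mul1r. Qed.

Lemma kform_catl l1 l2 m : kform (l1 ++ l2) m = kform l1 m + kform l2 m.
Proof. exact: big_cat. Qed.
Lemma kform_catr l m1 m2 : kform l (m1 ++ m2) = kform l m1 + kform l m2.
Proof. by rewrite -!evalf_kfun evalf_cat. Qed.
Lemma kform_scaler c l m : kform l (scale_list c m) = c^* * kform l m.
Proof. by rewrite -!evalf_kfun evalf_scale. Qed.
Lemma kform_scalel c l m : kform (scale_list c l) m = c * kform l m.
Proof.
rewrite /kform big_map mulr_sumr; apply: eq_bigr => p _.
by rewrite mulr_sumr; apply: eq_bigr => q _; rewrite !mulrA.
Qed.

End KernelForm.

Record pd_kernel (R : realType) (S : Type) := PDKernel {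
  pdk :> S -> S -> R[i] ;
  pdk_herm : forall s t, pdk s t = (pdk t s)^* ;
  pdk_pos : forall l, 0 <= complex.Re (kform pdk l l) }.

Section KernelSpace.
Variables (R : realType) (S : Type) (k : pd_kernel R S).
Implicit Types (l m : seq (R[i] * S)) (c : R[i]).

Let kn l : R := Num.sqrt (complex.Re (kform k l l)).

Let kn_ge0 l : 0 <= kn l. Proof. exact: sqrtr_ge0. Qed.

Let kn_sqr l : kn l ^+ 2 = complex.Re (kform k l l).
Proof. by rewrite sqr_sqrtr ?pdk_pos. Qed.

Let kform_herm l m : kform k l m = (kform k m l)^*.
Proof.
rewrite /kform exchange_big rmorph_sum; apply: eq_bigr => p _.
rewrite rmorph_sum; apply: eq_bigr => q _.
rewrite -[RHS]/((p.1 * (q.1)^* * k p.2 q.2)^*).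
by rewrite !conjcM conjCK -pdk_herm (mulrC q.1).
Qed.

Let kformxx l : kform k l l = (kn l ^+ 2)%:C%C.
Proof.
rewrite kn_sqr; apply/esym/RRe_real/CrealP; exact/esym/kform_herm.
Qed.

Let kform_cs l m : cabs (kform k l m) <= kn l * kn m.
Proof.
rewrite -(@ler_pXn2r _ 2)// ?nnegrE ?cabs_ge0 ?mulr_ge0//.
rewrite exprMn; apply: quad_form_discr; rewrite ?sqr_ge0// => c.
have := pdk_pos k (l ++ scale_list c^* m).
rewrite kform_catl !kform_catr !kform_scaler !kform_scalel !conjCK.
rewrite [kform k m l]kform_herm -conjcM !ReD cRe_conj mulrA.
rewrite !kformxx -cabs_sqr -rmorphM/=; lra.
Qed.

(* [F] is within [d] of the kernel sum of [l], in the norm dual to [kn]; the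
   functions that such sums approximate form the completion. *)
Definition appr (F : S -> R[i]) l (d : R) :=
  forall m, cabs (evalf F m - kform k l m) <= d * kn m.

Definition kspace_pred : {pred S -> R[i]} :=
  [pred F : S -> R[i] | `[< forall d : R, 0 < d -> exists l, appr F l d >]].

Lemma kspace_predP (F : S -> R[i]) :
  reflect (forall d : R, 0 < d -> exists l, appr F l d) (F \in kspace_pred).
Proof. exact: asboolP. Qed.

Record kspace := KSpace { kspace_val :> S -> R[i] ; kspaceP : kspace_val \in kspace_pred }.

HB.instance Definition _ := [isSub for kspace_val].
HB.instance Definition _ := [Choice of kspace by <:].

Lemma kspace_submod_closed : GRing.submod_closed kspace_pred.
Proof.
split=> [|c F G].
  apply/kspace_predP => d d0; exists [::] => m.
  rewrite /kform big_nil subr0 /evalf big1 ?cabs0 ?mulr_ge0 ?(ltW d0)//.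
  by move=> q _; rewrite mulr0.
move=> /kspace_predP aF /kspace_predP aG; apply/kspace_predP => d d0.
have c1 : 0 < cabs c + 1 by rewrite ltr_wpDl// cabs_ge0.
have d20 : 0 < d / 2 by rewrite divr_gt0.
have [l lP] := aF _ (divr_gt0 d20 c1); have [m mP] := aG _ d20.
exists (scale_list c l ++ m) => n.
rewrite kform_catl kform_scalel evalfP opprD addrACA -mulrBr.
rewrite (le_trans (cabsD _ _))// [in leRHS](splitr d) mulrDl lerD// cabsM.
rewrite (le_trans (ler_wpM2l (cabs_ge0 _) (lP n)))// mulrA ler_wpM2r//.
set h := d / 2 in d20 *.
by rewrite mulrC -mulrA ler_piMr ?(ltW d20)// mulrC ler_pdivrMr// mul1r lerDl.
Qed.

HB.instance Definition _ := GRing.isSubmodClosed.Build R[i] (S -> R[i])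
  kspace_pred kspace_submod_closed.
HB.instance Definition _ := [SubChoice_isSubLmodule of kspace by <:].

Implicit Types F G : kspace.

(** The norm dual to the seminorm [kn]. Elements of the completion are functions on [S], so no
    quotient by null combinations has to be formed. *)
Definition knorm F : R := sup [set cabs (evalf F m) | m in [set m | kn m <= 1]].

Lemma kspace_bound F : exists2 C : R, 0 <= C & forall m, cabs (evalf F m) <= C * kn m.
Proof.
have /kspace_predP/(_ 1 ltr01)[l lP] := kspaceP F.
exists (kn l + 1); first by rewrite addr_ge0.
move=> m; rewrite -[evalf F m](subrK (kform k l m)) (le_trans (cabsD _ _))//.
by rewrite addrC mulrDl lerD// ?kform_cs// mul1r -[kn m]mul1r.
Qed.

Lemma knorm_has_sup F : has_sup [set cabs (evalf F m) | m in [set m | kn m <= 1]].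
Proof.
have [C C0 FC] := kspace_bound F; split.
  exists (cabs (evalf F [::])), [::] => //=.
  by rewrite /kn /kform big_nil sqrtr0.
by exists C => _ [m /= m1 <-]; rewrite (le_trans (FC m))// ler_piMr.
Qed.

Lemma knorm_ge F m : cabs (evalf F m) <= knorm F * kn m.
Proof.
(* A null combination cannot be normalised, but any bound for [F] makes its value there 0. *)
have [m0|m0] := eqVneq (kn m) 0.
  by have [C C0 FC] := kspace_bound F; rewrite m0 mulr0 -(mulr0 C) -m0 FC.
have {}m0 : 0 < kn m by rewrite lt_neqAle eq_sym m0 kn_ge0.
rewrite -ler_pdivrMr//; apply: ub_le_sup; first by have [] := knorm_has_sup F.
have e1 : cabs ((kn m)^-1)%:C%C = (kn m)^-1.
  by rewrite cabs_real ger0_norm// invr_ge0 ltW.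
exists (scale_list ((kn m)^-1)%:C%C m) => /=; last first.
  by rewrite evalf_scale cabsM cabs_conj e1 mulrC.
rewrite -(@ler_pXn2r _ 2)// ?nnegrE ?ler01// expr1n kn_sqr.
rewrite kform_scalel kform_scaler kformxx conjC_real_complex -!rmorphM /=.
by rewrite expr2 mulKf ?mulVf ?gt_eqF.
Qed.

Lemma knorm_le F (C : R) : 0 <= C ->
  (forall m, cabs (evalf F m) <= C * kn m) -> knorm F <= C.
Proof.
move=> C0 FC; apply: ge_sup; first by have [] := knorm_has_sup F.
by move=> _ [m /= m1 <-]; rewrite (le_trans (FC m))// ler_piMr.
Qed.

Lemma knorm_ge0 F : 0 <= knorm F.
Proof.
apply: ub_le_sup; first by have [] := knorm_has_sup F.
exists [::]; first by rewrite /= /kn /kform big_nil sqrtr0.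
by rewrite /evalf big_nil cabs0.
Qed.

Let evalfD F G m : evalf (F + G : kspace) m = evalf F m + evalf G m.
Proof.
by rewrite /evalf -big_split; apply: eq_bigr => p _; rewrite /= -mulrDr.
Qed.

Let evalfN F m : evalf (- F : kspace) m = - evalf F m.
Proof. by rewrite /evalf -sumrN; apply: eq_bigr => p _; rewrite -mulrN. Qed.

Let evalfZ c F m : evalf (c *: F : kspace) m = c * evalf F m.
Proof.
by rewrite /evalf mulr_sumr; apply: eq_bigr => p _; rewrite mulrCA.
Qed.

Let ler_knormD F G : (knorm (F + G))%:C%C <= (knorm F)%:C%C + (knorm G)%:C%C :> R[i].
Proof.
rewrite -rmorphD lecR; apply: knorm_le => [|m]; first by rewrite addr_ge0 ?knorm_ge0.
by rewrite evalfD (le_trans (cabsD _ _))// mulrDl lerD ?knorm_ge.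
Qed.

Let knormZ_le c F : knorm (c *: F) <= cabs c * knorm F.
Proof.
apply: knorm_le => [|m]; first by rewrite mulr_ge0 ?cabs_ge0 ?knorm_ge0.
by rewrite evalfZ cabsM -mulrA ler_wpM2l ?cabs_ge0 ?knorm_ge.
Qed.

Let knormZ c F : (knorm (c *: F))%:C%C = `|c| * (knorm F)%:C%C :> R[i].
Proof.
rewrite cabsE -rmorphM; congr (_%:C%C); apply/eqP; rewrite eq_le knormZ_le/=.
have [->|c0] := eqVneq c 0; first by rewrite cabs0 mul0r knorm_ge0.
have cc : 0 < cabs c.
  by rewrite lt_neqAle cabs_ge0 andbT eq_sym; apply: contra_neq c0 => /cabs_eq0.
rewrite -ler_pdivlMl//.
have := knormZ_le c^-1 (c *: F); rewrite scalerA mulVf// scale1r.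
suff -> : cabs c^-1 = (cabs c)^-1 by [].
by apply: (@mulfI _ (cabs c)); rewrite ?gt_eqF// -cabsM mulfV// cabs1 mulfV// gt_eqF.
Qed.

Let knorm_eq0 F : (knorm F)%:C%C = 0 :> R[i] -> F = 0.
Proof.
move=> /complexI F0; apply/val_inj/funext => s /=; apply: cabs_eq0; apply/eqP.
by rewrite eq_le cabs_ge0 andbT -evalf1 (le_trans (knorm_ge _ _))// F0 mul0r.
Qed.

HB.instance Definition _ := Lmodule_isNormed.Build R[i] kspace
  ler_knormD knormZ knorm_eq0.

Let rnorm_knorm F : rnorm F = knorm F. Proof. by []. Qed.

(** Evaluations are bounded by the norm, so limits exist pointwise. The Cauchy estimate passes to
    them uniformly in [m], and the limit inherits approximating kernel sums from a late term. *)
Let kspace_seq_complete (u : nat -> kspace) : cauchy_seq u -> exists F, seq_lim u F.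
Proof.
move=> uC.
have exl s : exists z, forall e : R, 0 < e ->
    exists N, forall n, (N <= n)%N -> cabs (u n s - z) < e.
  apply: complex_cauchy_lim => e e0.
  have s1 : 0 < kn [:: (1, s)] + 1 by rewrite ltr_wpDl.
  have [N uN] := uC _ (divr_gt0 e0 s1); exists N => m n Nm Nn.
  have -> : u m s - u n s = evalf (u m - u n : kspace) [:: (1, s)] by rewrite evalf1.
  rewrite (le_lt_trans (knorm_ge _ _))// -rnorm_knorm.
  rewrite (@le_lt_trans _ _ (e / (kn [:: (1, s)] + 1) * kn [:: (1, s)]))//.
    by rewrite ler_wpM2r// ltW// uN.
  by rewrite -mulrA gtr_pMr// mulrC ltr_pdivrMr// mul1r ltrDl.
have [F FE] := boolp.choice exl.
have Feval m (e : R) : 0 < e -> exists N, forall n, (N <= n)%N ->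
    cabs (evalf (u n) m - evalf F m) < e.
  elim: m e => [|p m IH] e e0.
    by exists 0 => n _; rewrite /evalf !big_nil subrr cabs0.
  have e20 : 0 < e / 2 by rewrite divr_gt0.
  have p1 : 0 < cabs p.1 + 1 by rewrite ltr_wpDl// cabs_ge0.
  have [N1 N1P] := IH _ e20; have [N2 N2P] := FE p.2 _ (divr_gt0 e20 p1).
  exists (maxn N1 N2) => n; rewrite geq_max => /andP[/N1P n1 /N2P n2].
  rewrite /evalf !big_cons opprD addrACA -mulrBr (le_lt_trans (cabsD _ _))//.
  rewrite (splitr e) ler_ltD// cabsM cabs_conj.
  rewrite (le_trans (ler_wpM2l (cabs_ge0 _) (ltW n2)))//.
  set h := e / 2 in e20 *.
  by rewrite mulrC -mulrA ler_piMr ?(ltW e20)// mulrC ler_pdivrMr// mul1r lerDl.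
have Fu (e : R) : 0 < e -> exists N, forall n, (N <= n)%N -> forall m,
    cabs (evalf (u n) m - evalf F m) <= e * kn m.
  move=> e0; have [N uN] := uC _ e0; exists N => n Nn m.
  apply/ler_addgt0Pr => d d0; have [M MP] := Feval m d d0.
  have -> : evalf (u n) m - evalf F m = (evalf (u n) m - evalf (u (maxn N M)) m) +
      (evalf (u (maxn N M)) m - evalf F m) by rewrite addrA subrK.
  rewrite (le_trans (cabsD _ _))// lerD//; last by rewrite ltW// MP// leq_maxr.
  have -> : evalf (u n) m - evalf (u (maxn N M)) m = evalf (u n - u (maxn N M) : kspace) m.
    by rewrite evalfD evalfN.
  rewrite (le_trans (knorm_ge _ _))// ler_wpM2r// -rnorm_knorm ltW//.
  by rewrite uN// leq_maxl.
have FP : F \in kspace_pred.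
  apply/kspace_predP => d d0; have d20 : 0 < d / 2 by rewrite divr_gt0.
  have [N FN] := Fu _ d20.
  have /kspace_predP/(_ _ d20)[l lP] := kspaceP (u N).
  exists l => m.
  have -> : evalf F m - kform k l m =
      (evalf (u N) m - kform k l m) - (evalf (u N) m - evalf F m) by ring.
  by rewrite (le_trans (cabsB _ _))// (splitr d) mulrDl lerD// FN.
exists (KSpace FP) => e e0.
have e20 : 0 < e / 2 by rewrite divr_gt0.
have [N FN] := Fu _ e20; exists N => n Nn.
apply: (@le_lt_trans _ _ (e / 2)); last by rewrite ltr_pdivrMr// mulr_natr mulr2n ltrDl.
rewrite rnorm_knorm; apply: knorm_le; rewrite ?(ltW e20)// => m.
by rewrite evalfD evalfN FN.
Qed.

HB.instance Definition _ := Uniform_isComplete.Build kspace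
  (complete_of_seq_lim kspace_seq_complete).

Let apprE F l d : 0 <= d -> appr F l d ->
  kn l <= knorm F + d /\ knorm F <= kn l + d.
Proof.
move=> d0 Fl; split.
  have [->|l0] := eqVneq (kn l) 0; first by rewrite addr_ge0 ?knorm_ge0.
  have {}l0 : 0 < kn l by rewrite lt_neqAle eq_sym l0 kn_ge0.
  rewrite -(ler_pM2r l0) -expr2.
  have -> : kn l ^+ 2 = cabs (kform k l l) by rewrite kformxx cabs_real ger0_norm ?sqr_ge0.
  have -> : kform k l l = evalf F l - (evalf F l - kform k l l) by ring.
  by rewrite (le_trans (cabsB _ _))// mulrDl lerD ?knorm_ge.
apply: knorm_le => [|m]; first by rewrite addr_ge0.
rewrite -[evalf F m](subrK (kform k l m)) (le_trans (cabsD _ _))//.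
by rewrite addrC mulrDl lerD// kform_cs.
Qed.

(** The difference [b] of two approximations of [G] has [kn b] at most [d + d'], because [kn b ^+ 2]
    is the difference of the two approximation errors at [b]. *)
Let appr_dist F G l l' d d' : 0 <= d -> 0 <= d' -> appr G l d -> appr G l' d' ->
  cabs (evalf F l - evalf F l') <= knorm F * (d + d').
Proof.
move=> d0 d'0 Gl Gl'.
pose b := l ++ scale_list (-1) l'.
have -> : evalf F l - evalf F l' = evalf F b.
  by rewrite evalf_cat evalf_scale conjcN conjC1 mulN1r.
rewrite (le_trans (knorm_ge _ _))// ler_wpM2l ?knorm_ge0//.
have [->|b0] := eqVneq (kn b) 0; first by rewrite addr_ge0.
have {}b0 : 0 < kn b by rewrite lt_neqAle eq_sym b0 kn_ge0.
rewrite -(ler_pM2r b0) -expr2.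
have -> : kn b ^+ 2 = cabs (kform k b b) by rewrite kformxx cabs_real ger0_norm ?sqr_ge0.
have -> : kform k b b = (evalf G b - kform k l' b) - (evalf G b - kform k l b).
  by rewrite [kform k b b]kform_catl kform_scalel; ring.
by rewrite (le_trans (cabsB _ _))// addrC mulrDl lerD// ?Gl ?Gl'.
Qed.

(** The limit of the values of [F] at combinations tending to [G], given by its error estimate so
    that no approximating sequence enters the definition. [kdotP] shows that the set is inhabited,
    so the default 0 is never taken. *)
Definition kdot F G : R[i] := xget 0 [set z | forall l (d : R), 0 <= d ->
  appr G l d -> cabs (evalf F l - z) <= knorm F * d].

Let exists_appr F (d : R) : 0 < d -> exists l, appr F l d.
Proof. by move: d; apply/kspace_predP/kspaceP. Qed.

Let kdotP F G l (d : R) : 0 <= d -> appr G l d ->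
  cabs (evalf F l - kdot F G) <= knorm F * d.
Proof.
rewrite /kdot; case: xgetP => [z _ zP|no]; first exact: zP.
exfalso.
have ex n : exists l, appr G l n.+1%:R^-1 by apply: exists_appr; rewrite invr_gt0.
have [a aP] := boolp.choice ex.
have F1 : 0 < knorm F + 1 by rewrite ltr_wpDl// knorm_ge0.
have inv_small (e : R) : 0 < e -> exists N, forall n, (N <= n)%N -> n.+1%:R^-1 < e.
  move=> e0; have [N] := ltr_add_invr e0; rewrite add0r => NP.
  exists N => n Nn; apply: le_lt_trans NP.
  by rewrite lef_pV2 ?posrE// ler_nat.
have [|z zP] := @complex_cauchy_lim R (fun n => evalf F (a n)).
  move=> e e0; have e20 : 0 < e / 2 by rewrite divr_gt0.
  have [N NP] := inv_small _ (divr_gt0 e20 F1).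
  exists N => m n Nm Nn.
  apply: (le_lt_trans (appr_dist F _ _ (aP m) (aP n))); rewrite ?invr_ge0//.
  have Q j : (N <= j)%N -> knorm F * j.+1%:R^-1 < e / 2.
    move=> /NP jP; apply: (@le_lt_trans _ _ (knorm F * (e / 2 / (knorm F + 1)))).
      by rewrite ler_wpM2l ?knorm_ge0// ltW.
    set h := e / 2 in e20 *.
    by rewrite mulrC -mulrA gtr_pMr// mulrC ltr_pdivrMr// mul1r ltrDl.
  by rewrite mulrDr (splitr e) ltrD ?Q.
apply: (no z) => l' d' d'0 Gl'.
apply/ler_addgt0Pr => e e0; have e20 : 0 < e / 2 by rewrite divr_gt0.
have [N1 N1P] := inv_small _ (divr_gt0 e20 F1).
have [N2 N2P] := zP _ e20; pose n := maxn N1 N2.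
have -> : evalf F l' - z = (evalf F l' - evalf F (a n)) + (evalf F (a n) - z) by ring.
rewrite (le_trans (cabsD _ _))// (splitr e) addrA lerD//; last first.
  by rewrite ltW// N2P// leq_maxr.
rewrite (le_trans (appr_dist F _ _ Gl' (aP n)))// ?invr_ge0//.
rewrite mulrDr lerD// (@le_trans _ _ (knorm F * (e / 2 / (knorm F + 1))))//.
  by rewrite ler_wpM2l ?knorm_ge0// ltW// N1P// leq_maxl.
set h := e / 2 in e20 *.
by rewrite mulrC -mulrA ler_piMr ?(ltW e20)// mulrC ler_pdivrMr// mul1r lerDl.
Qed.

Let eq_small (z w : R[i]) (C : R) : 0 <= C ->
  (forall d : R, 0 < d -> d <= 1 -> cabs (z - w) <= C * d) -> z = w.
Proof.
move=> C0 zw; apply/eqP; rewrite -subr_eq0; apply/eqP/cabs_eq0/eqP.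
rewrite eq_le cabs_ge0 andbT; apply/ler_addgt0Pr => e e0; rewrite add0r.
have C1 : 0 < C + 1 by rewrite ltr_wpDl.
have m0 : 0 < Num.min 1 (e / (C + 1)) by rewrite lt_min ltr01 divr_gt0.
rewrite (le_trans (zw _ m0 _)) ?ge_min ?lexx//.
rewrite (@le_trans _ _ (C * (e / (C + 1))))//.
  by rewrite ler_wpM2l// ge_min lexx orbT.
by rewrite mulrC -mulrA ler_piMr ?(ltW e0)// mulrC ler_pdivrMr// mul1r lerDl.
Qed.

Let kdotPl c F F' G : kdot (c *: F + F') G = c * kdot F G + kdot F' G.
Proof.
apply: (@eq_small _ _ (knorm (c *: F + F') + (cabs c * knorm F + knorm F'))).
  by rewrite !addr_ge0 ?mulr_ge0 ?cabs_ge0 ?knorm_ge0.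
move=> d d0 _; have [l lP] := exists_appr G d0.
have -> : kdot (c *: F + F') G - (c * kdot F G + kdot F' G) =
   (c * (evalf F l - kdot F G) + (evalf F' l - kdot F' G)) -
    (evalf (c *: F + F' : kspace) l - kdot (c *: F + F') G).
  by rewrite evalfD evalfZ; ring.
rewrite (le_trans (cabsB _ _))// addrC mulrDl lerD// ?(kdotP _ (ltW d0))//.
rewrite (le_trans (cabsD _ _))// mulrDl lerD// ?(kdotP _ (ltW d0))// cabsM -mulrA.
by rewrite ler_wpM2l ?cabs_ge0// (kdotP _ (ltW d0)).
Qed.

(** The restriction [d <= 1] bounds [kn m] by [knorm G + 1], which keeps the error linear in [d]. *)
Let kdot_kform F G l m (d : R) : 0 <= d -> d <= 1 -> appr F l d -> appr G m d ->
  cabs (kdot F G - kform k l m) <= (knorm F + knorm G + 1) * d.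
Proof.
move=> d0 d1 Fl Gm.
have -> : kdot F G - kform k l m =
  (evalf F m - kform k l m) - (evalf F m - kdot F G) by ring.
rewrite (le_trans (cabsB _ _))// -addrA [_ + (_ + 1)]addrC mulrDl lerD//; last exact: kdotP.
rewrite (le_trans (Fl m))// mulrC ler_wpM2r//.
by have [mG _] := apprE d0 Gm; rewrite (le_trans mG)// lerD2l.
Qed.

Let kdotC F G : kdot F G = (-1) ^+ false * (kdot G F)^*.
Proof.
rewrite expr0 mul1r.
apply: (@eq_small _ _ ((knorm F + knorm G + 1) + (knorm G + knorm F + 1))).
  by rewrite !addr_ge0 ?knorm_ge0.
move=> d d0 d1; have [l lP] := exists_appr F d0; have [m mP] := exists_appr G d0.
have -> : kdot F G - (kdot G F)^* =
  (kdot F G - kform k l m) - (kdot G F - kform k m l)^*.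
  by rewrite conjcB -kform_herm; ring.
rewrite (le_trans (cabsB _ _))// cabs_conj mulrDl lerD//.
  exact: (kdot_kform (ltW d0)).
exact: (kdot_kform (ltW d0)).
Qed.

Let kdot_norm F : (knorm F)%:C%C ^+ 2 = kdot F F.
Proof.
apply: (@eq_small _ _ ((knorm F + knorm F + 1) + (knorm F + knorm F + 1))).
  by rewrite !addr_ge0 ?knorm_ge0.
move=> d d0 d1; have [l lP] := exists_appr F d0.
have -> : (knorm F)%:C%C ^+ 2 - kdot F F =
  (knorm F ^+ 2 - kn l ^+ 2)%:C%C - (kdot F F - kform k l l).
  by rewrite kformxx rmorphB !rmorphXn; ring.
rewrite (le_trans (cabsB _ _))// mulrDl lerD//; last exact: (kdot_kform (ltW d0)).
rewrite cabs_real; have [ub lb] := apprE (ltW d0) lP.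
have F0 := knorm_ge0 F; have l0 := kn_ge0 l.
rewrite subr_sqr normrM mulrC ler_pM// ?normr_ge0//.
  rewrite ger0_norm ?addr_ge0//; lra.
by rewrite ler_norml; apply/andP; split; lra.
Qed.

Let kdotPr c F G G' : kdot F (c *: G + G') = c^* * kdot F G + kdot F G'.
Proof.
by rewrite [LHS]kdotC kdotPl [kdot F G]kdotC [kdot F G']kdotC !expr0 !mul1r rmorphD rmorphM.
Qed.

Let kdot_bilinear : bilinear_for *%R (@Num.conj R[i] \; *%R) kdot.
Proof. split=> F c G G'; [exact: kdotPl|exact: kdotPr]. Qed.

HB.instance Definition _ :=
  @bilinear_isBilinear.Build _ _ _ _ _ _ kdot kdot_bilinear.
HB.instance Definition _ := @isHermitianSesquilinear.Build _ _ _ _ kdot kdotC.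

Let kdot_gt0 F : F != 0 -> 0 < kdot F F.
Proof.
move=> F0; rewrite -kdot_norm exprn_gt0// ltcR lt_neqAle knorm_ge0 andbT.
by apply: contra_neq F0 => /esym F0; apply: knorm_eq0; rewrite F0.
Qed.

HB.instance Definition _ := @isDotProduct.Build _ _ kdot kdot_gt0.

HB.instance Definition _ := @CompleteNormedModule_isHilbert.Build R kspace
  kdot kdot_norm.

Lemma kernel_fun_subproof l : kfun k l \in kspace_pred.
Proof.
apply/kspace_predP => d d0; exists l => m.
by rewrite evalf_kfun subrr cabs0 mulr_ge0 ?(ltW d0).
Qed.

Definition kernel_vector s : kspace := KSpace (kernel_fun_subproof [:: (1, s)]).

Lemma hdot_kernel_vector s t : hdot (kernel_vector s) (kernel_vector t) = k s t.
Proof.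
(* A kernel vector is exactly its own one-term kernel sum, so the estimate holds with [d = 0] and is
   an equality. *)
have := @kdotP (kernel_vector s) (kernel_vector t) [:: (1, t)] 0 (lexx _).
rewrite mulr0 => H; apply/esym/eqP; rewrite -subr_eq0; apply/eqP/cabs_eq0/eqP.
rewrite eq_le cabs_ge0 andbT; move: H.
rewrite evalf1 /= /kfun big_seq1 mul1r; apply => m.
by rewrite mul0r evalf_kfun subrr cabs0.
Qed.

Lemma kernel_vector_spanning : spanning (range kernel_vector).
Proof.
apply/spanningP => F FP; apply/val_inj/funext => t /=.
have := FP (kernel_vector t); rewrite hdotC => /(_ (ex_intro2 _ _ t I erefl)) H.
have := @kdotP F (kernel_vector t) [:: (1, t)] 0 (lexx _).
rewrite evalf1 mulr0 -[kdot _ _]/(hdot _ _).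
have -> : hdot F (kernel_vector t) = 0 by rewrite -[LHS]conjCK H conjC0.
rewrite subr0 => H'; apply/cabs_eq0/eqP; rewrite eq_le cabs_ge0 andbT; apply: H'.
by move=> m; rewrite mul0r evalf_kfun subrr cabs0.
Qed.

End KernelSpace.

(** The source of every new Hilbert space here: the direct sums behind frames and the interior
    tensor products behind the transfer. *)
Lemma kolmogorov (R : realType) (S : Type) (k : S -> S -> R[i]) :
  (forall s t, k s t = (k t s)^*) ->
  (forall l, 0 <= complex.Re (kform k l l)) ->
  exists (E : hilbertType R) (d : S -> E),
    (forall s t, hdot (d s) (d t) = k s t) /\ spanning (range d).
Proof.
move=> kh kp; pose K := PDKernel kh kp.
exists (kspace K), (@kernel_vector R S K).
split; [exact: (@hdot_kernel_vector R S K)|exact: kernel_vector_spanning].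
Qed.

(** * Square roots and polar factorization in operator *-algebras *)

Section LinearOn.
Variables (K : numFieldType) (V W : lmodType K) (X : set V) (f : V -> W).
Hypotheses (X0 : X 0) (XP : forall c x y, X x -> X y -> X (c *: x + y)).
Hypothesis fl : linear_on X f.

Lemma lin_closedZ c x : X x -> X (c *: x).
Proof. by move=> Xx; rewrite -[_ *: _]addr0; exact: XP. Qed.

Lemma lin_closedD x y : X x -> X y -> X (x + y).
Proof. by move=> Xx Xy; rewrite -(scale1r x); exact: XP. Qed.

Lemma lin_closedN x : X x -> X (- x).
Proof. by move=> Xx; rewrite -scaleN1r; exact: lin_closedZ. Qed.

Lemma lin_closedB x y : X x -> X y -> X (x - y).
Proof. by move=> Xx Xy; apply: lin_closedD => //; exact: lin_closedN. Qed.

Lemma lin_closed_sum (I : Type) (r : seq I) (P : pred I) (F : I -> V) :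
  (forall i, P i -> X (F i)) -> X (\sum_(i <- r | P i) F i).
Proof. by move=> XF; elim/big_ind : _ => //; exact: lin_closedD. Qed.

Lemma linear_on0 : f 0 = 0.
Proof.
have := fl 1 X0 X0; rewrite scaler0 addr0 scale1r => /eqP.
by rewrite -[X in X == _]addr0 (inj_eq (addrI _)) eq_sym => /eqP.
Qed.

Lemma linear_onZ c x : X x -> f (c *: x) = c *: f x.
Proof. by move=> Xx; rewrite -[c *: x]addr0 fl// linear_on0 addr0. Qed.

Lemma linear_onD x y : X x -> X y -> f (x + y) = f x + f y.
Proof. by move=> Xx Xy; rewrite -[in LHS](scale1r x) fl// scale1r. Qed.

Lemma linear_onN x : X x -> f (- x) = - f x.
Proof. by move=> Xx; rewrite -[- x]scaleN1r linear_onZ// scaleN1r. Qed.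

Lemma linear_onB x y : X x -> X y -> f (x - y) = f x - f y.
Proof. by move=> Xx Xy; rewrite linear_onD ?linear_onN//; exact: lin_closedN. Qed.

Lemma linear_on_sum (I : Type) (r : seq I) (P : pred I) (F : I -> V) :
  (forall i, P i -> X (F i)) ->
  f (\sum_(i <- r | P i) F i) = \sum_(i <- r | P i) f (F i).
Proof.
move=> XF; elim: r => [|i r IH]; first by rewrite !big_nil linear_on0.
rewrite !big_cons; case: ifP => // Pi.
by rewrite linear_onD ?IH//; [exact: XF|exact: lin_closed_sum].
Qed.

End LinearOn.

(** * Fixed points of contractions on closed sets of operators *)

Section FixedPoint.
Variables (R : realType) (H K : hilbertType R).

Lemma exprn_small (r e : R) : 0 <= r -> r < 1 -> 0 < e -> exists N, r ^+ N < e.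
Proof.
move=> r0 r1 e0; pose d := 1 - r; have d0 : 0 < d by rewrite subr_gt0.
(* Bernoulli's inequality, by [(1 - d) (1 + (n + 1) d) <= 1 + n d]. *)
have bern n : r ^+ n * (1 + n%:R * d) <= 1.
  elim: n => [|n IH]; first by rewrite expr0 mul0r addr0 mul1r.
  apply: le_trans IH; rewrite exprSr -mulrA ler_wpM2l ?exprn_ge0//.
  have -> : r = 1 - d by rewrite /d; ring.
  rewrite -natr1; have := mulr_ge0 (ler0n R n) (sqr_ge0 d); have := sqr_ge0 d.
  by rewrite expr2; set x := n%:R; nra.
have [N] := ltr_add_invr (mulr_gt0 e0 d0); rewrite add0r => NP.
exists N.+1; have := bern N.+1.
have D0 : 0 < 1 + N.+1%:R * d by rewrite ltr_pwDl// mulr_ge0// ltW.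
rewrite -ler_pdivlMr// => /le_lt_trans; apply.
rewrite mul1r (@lt_trans _ _ (N.+1%:R * d)^-1)//.
  by rewrite ltf_pV2 ?posrE ?mulr_gt0// ltrDr.
by rewrite invfM mulrC ltr_pdivrMl// mulrC.
Qed.

(** It stands in for functional calculus: used once for a square root and once for an inverse, on
    closed subsets of an algebra that the fixed point cannot leave. *)
Lemma banach_fixed_point_op (P : set 'B(H, K)) (F : 'B(H, K) -> 'B(H, K)) (r : R) :
  0 <= r -> r < 1 -> closed P -> P !=set0 -> (forall x, P x -> P (F x)) ->
  (forall x y, P x -> P y -> opnorm (F x - F y) <= r * opnorm (x - y)) ->
  exists2 x, P x & F x = x.
Proof.
move=> r0 r1 cP [x0 Px0] PF Fr.
have r10 : 0 < 1 - r by rewrite subr_gt0.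
pose x n := iter n F x0.
have Px n : P (x n) by elim: n => //= n IH; exact: PF.
pose D := opnorm (x 1%N - x 0%N).
have D0 : 0 <= D by exact: opnorm_ge0.
have step n : opnorm (x n.+1 - x n) <= r ^+ n * D.
  elim: n => [|n IH]; first by rewrite expr0 mul1r.
  rewrite (le_trans (Fr _ _ (Px n.+1) (Px n)))// exprS -mulrA ler_wpM2l//.
have dist m j : opnorm (x (m + j)%N - x m) <= r ^+ m * D * (1 - r ^+ j) / (1 - r).
  elim: j => [|j IH].
    by rewrite addn0 subrr opnorm0 expr0 subrr mulr0 mul0r.
  have -> : x (m + j.+1)%N - x m = (x (m + j).+1 - x (m + j)%N) + (x (m + j)%N - x m).
    by rewrite addnS addrA subrK.
  rewrite (le_trans (opnormD _ _))// (le_trans (lerD (step _) IH))//.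
  rewrite exprD exprS le_eqVlt; apply/orP; left; apply/eqP; field.
  by rewrite gt_eqF.
have dist' m j : opnorm (x (m + j)%N - x m) <= r ^+ m * (D / (1 - r)).
  rewrite (le_trans (dist m j))// mulrA -!mulrA ler_wpM2l ?exprn_ge0// ler_wpM2l//.
  by rewrite ler_piMl ?invr_ge0 ?(ltW r10)// gerBl exprn_ge0.
have x_cauchy : cauchy_seq x.
  move=> e e0; pose C := D / (1 - r) + 1.
  have C0 : 0 < C by rewrite ltr_wpDl// divr_ge0// ltW.
  have e20 : 0 < e / 2 / C by rewrite divr_gt0// divr_gt0.
  have [N NP] := exprn_small r0 r1 e20.
  have far n : (N <= n)%N -> opnorm (x n - x N) < e / 2.
    move=> Nn; rewrite -(subnKC Nn) (le_lt_trans (dist' _ _))//.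
    rewrite (@le_lt_trans _ _ (r ^+ N * C))//.
      by rewrite ler_wpM2l ?exprn_ge0// lerDl.
    by rewrite -ltr_pdivlMr.
  exists N => m n Nm Nn; rewrite rnorm_opnorm.
  have -> : x m - x n = (x m - x N) - (x n - x N) by rewrite opprB addrA subrK.
  by rewrite (le_lt_trans (opnormB _ _))// (splitr e) ltrD ?far.
have [y xy] := op_seq_lim x_cauchy.
have Py : P y by apply: (closed_seq_lim (u := x)).
exists y => //; apply/eqP; rewrite -subr_eq0; apply/eqP/rnorm0_eq0/eqP.
rewrite eq_le rnorm_ge0 andbT; apply/ler_addgt0Pr => e e0; rewrite add0r.
have e20 : 0 < e / 2 by rewrite divr_gt0.
have [N NP] := xy _ e20.
have -> : F y - y = (x N.+1 - y) - (F (x N) - F y).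
  by rewrite -[x N.+1]/(F (x N)) opprB [RHS]addrC addrA subrK.
rewrite rnorm_opnorm (le_trans (opnormB _ _))// (splitr e) lerD//.
  by rewrite ltW// -rnorm_opnorm NP.
rewrite (le_trans (Fr _ _ _ _))// ?(ltW (NP N _))//.
rewrite (le_trans _ (ltW (NP N (leqnn _))))// rnorm_opnorm.
by rewrite ler_piMl ?opnorm_ge0// ltW.
Qed.

End FixedPoint.

(** Composition is not commutative, so operator identities are first paired with vectors: words in
    operators become atoms of commutative expressions in [R[i]], to which [ring] and [field]
    apply. *)
Ltac expand_hdot := do 3! (rewrite ?(opDE, opBE, opNE, opZE, op0E, op_compE, op_linD,
  op_linB, op_linN, op_linZ, op_lin0, hdotDl, hdotBl, hdotNl, hdotZl, hdot0l) /=).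

Section StarAlgebras.
Variables (R : realType).
Implicit Types (H K L : hilbertType R).

Definition star_algebra H (A : set 'B(H, H)) : Prop :=
  [/\ operator_space A, forall a b, A a -> A b -> A (a *o b) &
      forall a, A a -> A (adj a)].

Lemma closed_adj_fixed H : closed [set a : 'B(H, H) | adj a = a].
Proof.
apply/closed_rnorm => a aP; apply/eqP; rewrite -subr_eq0; apply/eqP/rnorm0_eq0/eqP.
rewrite eq_le rnorm_ge0 andbT; apply/ler_addgt0Pr => e e0; rewrite add0r.
have e20 : 0 < e / 2 by rewrite divr_gt0.
have [b /= bb ab] := aP _ e20.
have -> : adj a - a = adj (a - b) - (a - b) by rewrite adjB bb opprB addrA subrK.
rewrite rnorm_opnorm (le_trans (opnormB _ _))// opnorm_adj (splitr e).
by rewrite lerD// ltW.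
Qed.

Lemma closed_opnorm_le H K (T : 'B(H, K)) (r : R) :
  closed [set a : 'B(H, K) | opnorm (T + a) <= r].
Proof.
apply/closed_rnorm => a aP /=; apply/ler_addgt0Pr => e e0.
have [b /= br ab] := aP _ e0.
rewrite -[a](subrK b) addrCA addrC (le_trans (opnormD _ _))// lerD//.
exact: ltW.
Qed.

(** The form of a positive operator satisfies Cauchy-Schwarz, so its off-diagonal values are
    controlled by the diagonal ones. *)
Lemma opnorm_psd_le H (T : 'B(H, H)) (C : R) : 0 <= C -> adj T = T ->
  (forall x, 0 <= complex.Re (hdot (T x) x)) ->
  (forall x, complex.Re (hdot (T x) x) <= C * rnorm x ^+ 2) -> opnorm T <= C.
Proof.
move=> C0 Ta T0 TC; apply: opnorm_le_form => // x y.
rewrite -(@ler_pXn2r _ 2)// ?nnegrE ?cabs_ge0 ?mulr_ge0 ?rnorm_ge0//.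
rewrite (@le_trans _ _ (complex.Re (hdot (T x) x) * complex.Re (hdot (T y) y)))//.
  apply: quad_form_discr => // c.
  have := T0 (x + c^* *: y).
  rewrite op_linD op_linZ !(hdotDl, hdotDr, hdotZl, hdotZr) conjCK.
  have -> : hdot (T y) x = (hdot (T x) y)^* by rewrite adjP Ta -hdotC.
  rewrite mulrA -conjcM (mulrC (c^*)) -mulrA !ReD cRe_conj mulrA -cabs_sqr Re_realM.
  by lra.
have -> : (C * rnorm x * rnorm y) ^+ 2 = (C * rnorm x ^+ 2) * (C * rnorm y ^+ 2).
  by ring.
by rewrite ler_pM.
Qed.

Lemma Re_hdot_le H (T : 'B(H, H)) x : `|complex.Re (hdot (T x) x)| <= opnorm T * rnorm x ^+ 2.
Proof.
rewrite (le_trans (normr_Re_cabs _))// (le_trans (cauchy_schwarz _ _))//.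
by rewrite expr2 mulrA ler_wpM2r ?rnorm_ge0// rnorm_opE.
Qed.

Local Notation "r %:O" := ((r)%:C%C *: op_id _) (at level 2, format "r %:O").

(* The square root [c * (1 - u)] of [alpha + e + a] is obtained from the fixed
   point [u = mu + b] of [u |-> (t + u ^ 2) / 2], [t = 1 - (alpha + e + a) / c ^ 2];
   keeping the scalar part [mu] apart shows that [s] lies in [A]. *)
Lemma star_algebra_sqrt H (A : set 'B(H, H)) a (alpha e : R) :
  star_algebra A -> A a -> adj a = a -> 0 <= alpha -> 0 < e ->
  (forall x, 0 <= alpha * rnorm x ^+ 2 + complex.Re (hdot (a x) x)) ->
  exists (beta : R) s (gamma : R) w,
    [/\ [/\ 0 < beta, beta ^+ 2 = alpha + e, A s & adj s = s],
        s *o s + (2 * beta)%:C%C *: s = a,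
        A w,
        (beta%:O + s) *o (gamma%:O + w) = op_id H &
        (gamma%:O + w) *o (beta%:O + s) = op_id H].
Proof.
move=> [[cA A0 AP] AM Aa] Aa0 asa al0 e0 apos.
(* [N = c ^+ 2] dominates [alpha + e + a], which is itself bounded below by [e]; so the operator
   [t = tau + a'] lies between 0 and [q < 1]. *)
pose N := alpha + e + opnorm a.
have N0 : 0 < N by rewrite ltr_wpDr ?opnorm_ge0// ltr_wpDl.
pose c := Num.sqrt N; have c0 : 0 < c by rewrite sqrtr_gt0.
have c2 : c ^+ 2 = N by rewrite sqr_sqrtr// ltW.
pose tau := 1 - (alpha + e) / N.
pose q := 1 - e / N.
have aeN : (alpha + e) / N <= 1 by rewrite ler_pdivrMr// mul1r /N lerDl opnorm_ge0.
have tau0 : 0 <= tau by rewrite subr_ge0.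
have tauq : tau <= q by rewrite lerD2l lerN2 ler_pM2r ?invr_gt0// lerDr.
have q1 : q < 1 by rewrite gtrBl divr_gt0.
have q0 : 0 <= q := le_trans tau0 tauq.
(* [mu] and [r] are the smaller roots of [x = (tau + x^2) / 2] and [x = (q + x^2) / 2]: the scalar
   part of the fixed point, and the radius of a ball that the iteration preserves and contracts by
   the factor [r]. *)
pose mu := 1 - Num.sqrt (1 - tau).
pose r := 1 - Num.sqrt (1 - q).
have muE : (1 - mu) ^+ 2 = 1 - tau.
  by rewrite /mu subKr sqr_sqrtr// subr_ge0 (le_trans tauq)// ltW.
have rE : (1 - r) ^+ 2 = 1 - q by rewrite /r subKr sqr_sqrtr// subr_ge0 ltW.
have mu1 : 0 < 1 - mu by rewrite subKr sqrtr_gt0 subr_gt0 (le_lt_trans tauq).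
have mu0 : 0 <= mu.
  by rewrite subr_ge0 -[leRHS]sqrtr1 ler_wsqrtr// gerBl.
have mur : mu <= r by rewrite lerD2l lerN2 ler_wsqrtr// lerD2l lerN2.
have r1 : r < 1 by rewrite gtrBl sqrtr_gt0 subr_gt0.
have r0 : 0 <= r := le_trans mu0 mur.
pose a' : 'B(H, H) := (- N^-1)%:C%C *: a.
have Aa' : A a' by exact: lin_closedZ.
have a'sa : adj a' = a' by rewrite adjZ asa conjC_real_complex.
have tq : opnorm (tau%:O + a') <= q.
  have tE x : complex.Re (hdot ((tau%:O + a') x) x) =
      rnorm x ^+ 2 - N^-1 * ((alpha + e) * rnorm x ^+ 2 + complex.Re (hdot (a x) x)).
    rewrite opDE hdotDl !opZE !hdotZl ReD !Re_realM -rnorm_sqr /tau; field.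
    by rewrite gt_eqF.
  apply: opnorm_psd_le => // [|x|x].
  - by rewrite adjD adjZ adj_id a'sa conjC_real_complex.
  - rewrite tE subr_ge0 ler_pdivrMl// /N [leRHS]mulrDl lerD2l.
    by rewrite (le_trans (ler_norm _))// Re_hdot_le.
  - rewrite tE /q mulrBl mul1r lerD2l lerN2 [leLHS]mulrAC [leLHS]mulrC.
    rewrite ler_pM2l ?invr_gt0//; have := apos x; rewrite mulrDl.
    by set z := rnorm x ^+ 2; lra.
have aE : a = (- N)%:C%C *: a'.
  rewrite /a' scalerA -rmorphM/= mulrNN mulfV ?gt_eqF// scale1r//.
clearbody a' mu r.
pose half : R[i] := (2^-1)%:C%C.
pose P := [set b | A b] `&` [set b | adj b = b] `&` [set b | opnorm (mu%:O + b) <= r].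
pose F (b : 'B(H, H)) := half *: (a' + (2 * mu)%:C%C *: b + b *o b).
have FE b : mu%:O + F b = half *: (tau%:O + a' + (mu%:O + b) *o (mu%:O + b)).
  apply: op_eq_hdot => x y; rewrite /F /half; expand_hdot.
  have -> : tau = 2 * mu - mu ^+ 2 by have := muE; rewrite sqrrB expr1n; lra.
  by field.
have rE2 : r = 2^-1 * (q + r * r) by have := rE; rewrite sqrrB expr1n; lra.
have cP : closed P.
  apply: closedI; last exact: closed_opnorm_le.
  by apply: closedI => //; exact: closed_adj_fixed.
have halfE : cabs half = 2^-1 by rewrite cabs_real ger0_norm ?invr_ge0.
have PF b : P b -> P (F b).
  move=> [[/= Ab bsa] br]; split; first split => /=.
  - apply: lin_closedZ => //; apply: lin_closedD => //; last exact: AM.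
    by apply: lin_closedD => //; exact: lin_closedZ.
  - by rewrite /F adjZ !adjD adj_comp adjZ a'sa bsa /half !conjC_real_complex.
  rewrite /= FE opnormZ halfE [leRHS]rE2 ler_pM2l ?invr_gt0//.
  rewrite (le_trans (opnormD _ _))// lerD// (le_trans (opnorm_comp _ _))//.
  by rewrite ler_pM ?opnorm_ge0.
have FL b d : P b -> P d -> opnorm (F b - F d) <= r * opnorm (b - d).
  move=> [_ /= br] [_ /= dr].
  have -> : F b - F d = half *: ((mu%:O + b) *o (b - d) + (b - d) *o (mu%:O + d)).
    by apply: op_eq_hdot => x y; rewrite /F /half; expand_hdot; field.
  rewrite opnormZ halfE ler_pdivrMl// (le_trans (opnormD _ _))//.
  rewrite mulr_natl mulr2n lerD// (le_trans (opnorm_comp _ _))//.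
    by rewrite ler_wpM2r ?opnorm_ge0.
  by rewrite mulrC ler_wpM2r ?opnorm_ge0.
have [|b [[/= Ab bsa] br] Fb] := banach_fixed_point_op r0 r1 cP _ PF FL.
  exists 0; split; first by split=> //=; rewrite adj0.
  rewrite /= addr0 opnormZ cabs_real ger0_norm// (le_trans _ mur)//.
  by rewrite ler_piMr ?opnorm_id.
(* The inverse of [1 - mu - b] is sought as [nu + w]: [nu] inverts the scalar part, and what remains
   for [w] is a fixed point equation in [A]. *)
pose nu := (1 - mu)^-1.
pose G (w : 'B(H, H)) := nu%:C%C *: b + (mu%:O + b) *o w.
have [|||w /= Aw Gw] := @banach_fixed_point_op _ _ _ [set w | A w] G r r0 r1 cA.
- by exists 0.
- move=> w /= Aw; apply: lin_closedD => //; first exact: lin_closedZ.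
  rewrite op_compDl op_compZl op_comp1l; apply: lin_closedD => //; last exact: AM.
  exact: lin_closedZ.
- move=> v w _ _; rewrite /G opprD addrACA subrr add0r -op_compBr.
  by rewrite (le_trans (opnorm_comp _ _))// ler_wpM2r ?opnorm_ge0.
pose V : 'B(H, H) := nu%:O + w.
have V1 : (op_id H - (mu%:O + b)) *o V = op_id H.
  have nuE : nu = 1 + mu * nu by rewrite /nu; field; rewrite gt_eqF.
  have -> : (op_id H - (mu%:O + b)) *o V =
      (nu - mu * nu)%:O + (w - (nu%:C%C *: b + (mu%:O + b) *o w)).
    by apply: op_eq_hdot => x y; rewrite /V; expand_hdot; ring.
  rewrite -/(G w) Gw subrr addr0; have -> : nu - mu * nu = 1 by rewrite {1}nuE addrK.
  by rewrite scale1r.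
(* [V] is a right inverse of a self-adjoint operator, so its adjoint is a left inverse and the two
   agree. *)
have usa : adj (op_id H - (mu%:O + b)) = op_id H - (mu%:O + b).
  by rewrite adjB adjD adjZ !adj_id bsa conjC_real_complex.
have V1' : adj V *o (op_id H - (mu%:O + b)) = op_id H.
  by rewrite -usa -adj_comp V1 adj_id.
have Vsa : adj V = V.
  by rewrite -[LHS]op_comp1r -V1 op_compA V1' op_comp1l.
have bE : (2 * (1 - mu))%:C%C *: b - b *o b = a'.
  apply: op_eq_hdot => x y.
  have := congr1 (fun T : 'B(H, H) => hdot (T x) y) Fb; rewrite /F /half.
  expand_hdot; rewrite !(rmorphM, rmorphB, rmorph1, rmorph_nat, fmorphV) => /=.
  move: (hdot (a' x) y) (hdot (b x) y) (hdot (b (b x)) y) => p u v E.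
  have -> : p = 2 * (2^-1 * (p + 2 * mu%:C%C * u + v)) - 2 * mu%:C%C * u - v by field.
  by rewrite E; ring.
exists (c * (1 - mu)), ((- c)%:C%C *: b), (nu / c), (c^-1%:C%C *: w).
have cn0 : c%:C%C != 0 :> R[i] by rewrite fmorph_eq0 gt_eqF.
have betaE : (c * (1 - mu))%:O + (- c)%:C%C *: b = c%:C%C *: (op_id H - (mu%:O + b)).
  by apply: op_eq_hdot => x y; expand_hdot; ring.
have gammaE : (nu / c)%:O + c^-1%:C%C *: w = c^-1%:C%C *: V.
  by rewrite /V scalerDr scalerA -rmorphM/= mulrC.
split; first split.
- by rewrite mulr_gt0.
- by rewrite exprMn c2 muE /tau subKr mulrC divfK// gt_eqF.
- exact: lin_closedZ.
- by rewrite adjZ bsa conjC_real_complex.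
- rewrite aE -bE -c2; apply: op_eq_hdot => x y; expand_hdot; ring.
- exact: lin_closedZ.
- rewrite betaE gammaE op_compZl op_compZr scalerA -rmorphM/= mulfV ?gt_eqF// scale1r.
  exact: V1.
- rewrite betaE gammaE op_compZl op_compZr scalerA -rmorphM/= mulVf ?gt_eqF// scale1r.
  by rewrite -Vsa.
Qed.

(** [alpha + e + a] is the square of [beta + s] with [s] in [A], and replacing [s] by [pi s] gives a
    square on the other side. The scalar stays outside [pi], which is a representation of [A] only;
    then [e] tends to 0. *)
Lemma star_rep_pos H K (A : set 'B(H, H)) (pi : 'B(H, H) -> 'B(K, K)) a (alpha : R) :
  star_algebra A -> star_representation A pi -> A a -> adj a = a -> 0 <= alpha ->
  (forall x, 0 <= alpha * rnorm x ^+ 2 + complex.Re (hdot (a x) x)) ->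
  forall x, 0 <= alpha * rnorm x ^+ 2 + complex.Re (hdot (pi a x) x).
Proof.
move=> Aalg [pil pim pia] Aa asa al0 apos x.
have [[cA A0 AP] AM _] := Aalg.
apply/ler_addgt0Pr => e e0; rewrite addrC.
(* Dividing [e] by [z] makes the error at [x] at most [e]. *)
pose z := rnorm x ^+ 2 + 1; have z0 : 0 < z by rewrite ltr_wpDl// sqr_ge0.
have [beta [s [_ [_ [[beta0 beta2 As ssa] sE _ _ _]]]]] :=
  star_algebra_sqrt Aalg Aa asa al0 (divr_gt0 e0 z0) apos.
have pis : adj (pi s) = pi s by rewrite -pia// ssa.
have := sqr_ge0 (rnorm ((beta%:O + pi s) x)).
have -> : rnorm ((beta%:O + pi s) x) ^+ 2 =
    (alpha + e / z) * rnorm x ^+ 2 + complex.Re (hdot (pi a x) x).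
  rewrite -sE (linear_onD pil) ?pim//; [|exact: AM|exact: lin_closedZ].
  rewrite (linear_onZ A0 pil)// -beta2 rnorm_sqr_adj rnorm_sqr.
  rewrite adjD adjZ adj_id conjC_real_complex pis.
  rewrite -Re_realM -ReD; congr complex.Re; expand_hdot; ring.
move/le_trans; apply; rewrite mulrDl addrAC [leLHS]addrC lerD2r.
by rewrite mulrAC ler_pdivrMr// ler_pM2l// lerDl.
Qed.

(** Positivity of [|a|^2 - a^* a] is preserved by [pi]. *)
Lemma star_rep_contractive H K (A : set 'B(H, H)) (pi : 'B(H, H) -> 'B(K, K)) a :
  star_algebra A -> star_representation A pi -> A a -> opnorm (pi a) <= opnorm a.
Proof.
move=> Aalg pirep Aa; have [[cA A0 AP] AM Aadj] := Aalg.
have [pil pim pia] := pirep.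
have Aaa : A (adj a *o a) by apply: AM => //; exact: Aadj.
have H1 := @star_rep_pos _ _ _ _ (- (adj a *o a)) (opnorm a ^+ 2) Aalg pirep.
apply: opnorm_le_bound => [|x]; first exact: opnorm_ge0.
have H2 : 0 <= opnorm a ^+ 2 * rnorm x ^+ 2 + complex.Re (hdot (pi (- (adj a *o a)) x) x).
  apply: H1; rewrite ?sqr_ge0//; first exact: lin_closedN.
    by rewrite adjN adj_comp adjK.
  move=> y; rewrite opNE hdotNl ReN -rnorm_sqr_adj -exprMn subr_ge0.
  by rewrite ler_pXn2r// ?nnegrE ?mulr_ge0 ?opnorm_ge0 ?rnorm_ge0// rnorm_opE.
rewrite (linear_onN A0 pil)// pim// ?pia// in H2; last exact: Aadj.
rewrite opNE hdotNl ReN -rnorm_sqr_adj -exprMn subr_ge0 in H2.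
by rewrite ler_pXn2r// ?nnegrE ?mulr_ge0 ?opnorm_ge0 ?rnorm_ge0 in H2.
Qed.

(** [f] is the inverse square root of [e + n n^*] applied to [n]. This inverse is a scalar plus an
    element of [A], so [f] stays in the module [M]. *)
Lemma polar_factor H K (A : set 'B(K, K)) (M : set 'B(H, K)) n (e : R) :
  star_algebra A -> M 0 -> (forall c x y, M x -> M y -> M (c *: x + y)) ->
  (forall a m, A a -> M m -> M (a *o m)) -> M n -> A (n *o adj n) -> 0 < e ->
  exists (beta : R) s f,
    [/\ A s, adj s = s & M f] /\
    [/\ opnorm f <= 1, n = (beta%:O + s) *o f, beta ^+ 2 = e &
      s *o s + (2 * beta)%:C%C *: s = n *o adj n].
Proof.
move=> Aalg M0 MP AM Mn Ann e0.
have nnpos x : complex.Re (hdot ((n *o adj n) x) x) = rnorm (adj n x) ^+ 2.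
  by rewrite rnorm_sqr_adj adjK.
have nsa : adj (n *o adj n) = n *o adj n by rewrite adj_comp adjK.
have [|beta [s [gamma [w [[beta0 beta2 As ssa] sE Aw inv1 inv2]]]]] :=
    star_algebra_sqrt (alpha := 0) Aalg Ann nsa (lexx _) e0.
  move=> x; by rewrite mul0r add0r nnpos sqr_ge0.
have sqE : (beta%:O + s) *o (beta%:O + s) = e%:O + n *o adj n.
  rewrite -sE; have -> : e = beta ^+ 2 by rewrite beta2 add0r.
  by apply: op_eq_hdot => x y; expand_hdot; ring.
exists beta, s, ((gamma%:O + w) *o n); split; split => //.
- rewrite op_compDl op_compZl op_comp1l; apply: MP => //; exact: AM.
- have bsa : adj (beta%:O + s) = beta%:O + s.
    by rewrite adjD adjZ adj_id ssa conjC_real_complex.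
  (* With [x = (beta + s) y], the adjoint of [f] sends [x] to [n^* y], and [n n^* <= e + n n^*]
     compares the two norms. *)
  rewrite -opnorm_adj; apply: opnorm_le_bound => // x; rewrite mul1r.
  rewrite -(@ler_pXn2r _ 2)// ?nnegrE ?rnorm_ge0//.
  rewrite adj_comp op_compE; set y := adj _ x.
  have yx : (beta%:O + s) y = x.
    by rewrite -bsa /y -op_compE -adj_comp inv2 adj_id.
  rewrite -[in leRHS]yx (rnorm_sqr_adj (_ + _)) bsa sqE opDE hdotDl ReD nnpos lerDr.
  by rewrite opZE hdotZl Re_realM -rnorm_sqr mulr_ge0 ?sqr_ge0// ltW.
- by rewrite op_compA inv1 op_comp1l.
- by rewrite beta2 add0r.
Qed.

End StarAlgebras.

(** * Operator matrices *)

Section Frames.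
Variables (R : realType).
Implicit Types (H K E F : hilbertType R).

(* A frame identifies [E] with the Hilbert direct sum of [n] copies of [H]. *)
Definition frame H E n (V : 'I_n -> 'B(H, E)) : Prop :=
  (forall i j, adj (V i) *o V j = if i == j then op_id H else 0) /\
  \sum_i V i *o adj (V i) = op_id E.

Lemma frame_id H : frame (fun _ : 'I_1 => op_id H).
Proof.
split=> [i j|]; first by rewrite !ord1 eqxx adj_id op_comp1l.
by rewrite big_ord1 adj_id op_comp1l.
Qed.

Lemma frameE H E n (V : 'I_n -> 'B(H, E)) i j x : frame V ->
  adj (V i) (V j x) = if i == j then x else 0.
Proof. by case=> Vij _; rewrite -op_compE Vij; case: eqP. Qed.

Lemma frame_decomp H E n (V : 'I_n -> 'B(H, E)) x : frame V ->
  \sum_i V i (adj (V i) x) = x.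
Proof.
case=> _ V1; rewrite -[RHS]/(op_id E x) -V1 op_sumE.
by apply: eq_bigr.
Qed.

Lemma rnorm_frame_sqr H E n (V : 'I_n -> 'B(H, E)) (x : 'I_n -> H) : frame V ->
  rnorm (\sum_i V i (x i)) ^+ 2 = \sum_i rnorm (x i) ^+ 2.
Proof.
move=> Vf; rewrite rnorm_sqr hdot_suml (big_morph _ (@ReD R) (erefl _)).
apply: eq_bigr => i _; rewrite hdot_sumr (bigD1 i)//= big1 ?addr0.
  by rewrite adjP frameE// eqxx rnorm_sqr.
by move=> j ji; rewrite adjP frameE// eq_sym (negPf ji) hdot0r.
Qed.

Lemma rnorm_frame_decomp H E n (V : 'I_n -> 'B(H, E)) x : frame V ->
  rnorm x ^+ 2 = \sum_i rnorm (adj (V i) x) ^+ 2.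
Proof. by move=> Vf; rewrite -(rnorm_frame_sqr _ Vf) frame_decomp. Qed.

(** The kernel is the scalar product on pairs with equal index and 0 otherwise; its form at [l] is
    the sum of the squared norms of the combinations [w i] of the vectors with index [i]. *)
Lemma frame_exists H n : exists E (V : 'I_n -> 'B(H, E)), frame V.
Proof.
pose k (s t : 'I_n * H) : R[i] := if s.1 == t.1 then hdot s.2 t.2 else 0.
have kh s t : k s t = (k t s)^*.
  by rewrite /k eq_sym; case: ifP => _; rewrite -?hdotC ?conjC0.
have kp l : 0 <= complex.Re (kform k l l).
  pose w i : H := \sum_(p <- l) (if p.2.1 == i then p.1 *: p.2.2 else 0).
  suff -> : kform k l l = \sum_i hdot (w i) (w i).
    rewrite (big_morph _ (@ReD R) (erefl _)) sumr_ge0// => i _.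
    by rewrite -rnorm_sqr sqr_ge0.
  have wE i : hdot (w i) (w i) = \sum_(p <- l) \sum_(q <- l)
     (if p.2.1 == i then p.1 * (q.1)^* * k p.2 q.2 else 0).
    rewrite hdot_suml; apply: eq_bigr => p _; rewrite hdot_sumr; apply: eq_bigr => q _.
    rewrite /k; have [<-|pi] := eqVneq p.2.1 i; last by rewrite hdot0l.
    rewrite eq_sym; case: ifP => _; last by rewrite hdot0r mulr0.
    by rewrite hdotZl hdotZr mulrA.
  under eq_bigr do rewrite wE.
  rewrite exchange_big; apply: eq_bigr => p _ /=.
  rewrite exchange_big; apply: eq_bigr => q _ /=.
  rewrite (bigD1 p.2.1)//= eqxx big1 ?addr0// => i; by rewrite eq_sym => /negPf->.
have [E [d [dE dS]]] := kolmogorov kh kp.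
have exV i : exists V : 'B(H, E), forall x, V x = d (i, x).
  apply: (@bounded_linear_op _ _ _ _ 1) => [c x y|x].
    have dlin z : hdot (d (i, c *: x + y)) (d z) = hdot (c *: d (i, x) + d (i, y)) (d z).
      rewrite hdotDl hdotZl !dE /k /=; case: ifP => _.
        by rewrite hdotDl hdotZl.
      by rewrite mulr0 addr0.
    apply/eqP; rewrite -subr_eq0; apply/eqP; move/spanningP: dS; apply => _ [z _ <-].
    by rewrite hdotC hdotBl dlin subrr conjC0.
  rewrite mul1r -(@ler_pXn2r _ 2)// ?nnegrE ?rnorm_ge0//.
  by rewrite !rnorm_sqr dE /k /= eqxx.
have [V VE] := boolp.choice exV.
have VV i j x : adj (V i) (V j x) = if i == j then x else 0.
  apply: eq_hdotr => z; rewrite -adjP !VE dE /k /=.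
  by case: eqP; rewrite ?hdot0r.
exists E, V; split=> [i j|].
  by apply: opP => x; rewrite op_compE VV; case: ifP.
apply: opP => x; rewrite -[RHS]/x op_sumE.
apply/eqP; rewrite -subr_eq0; apply/eqP; move/spanningP: dS; apply => _ [[j z] _ <-].
rewrite hdotBr hdot_sumr -VE (bigD1 j)//= big1 ?addr0.
  by rewrite [hdot _ (V j _)]adjP VV eqxx -adjP subrr.
by move=> i ij; rewrite adjP VV eq_sym (negPf ij) hdot0r.
Qed.

Lemma frame_ext H K E F m n (U : 'I_m -> 'B(H, E)) (V : 'I_n -> 'B(K, F))
    (T S : 'B(E, F)) : frame U -> frame V ->
  (forall i j, adj (V i) *o T *o U j = adj (V i) *o S *o U j) -> T = S.
Proof.
move=> [_ U1] [_ V1] TS.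
rewrite -(op_comp1l T) -(op_comp1l S) -V1 -(op_comp1r T) -(op_comp1r S) -U1.
rewrite !op_comp_suml; apply: eq_bigr => i _.
rewrite !op_comp_sumr; apply: eq_bigr => j _.
by have := congr1 (fun Z => V i *o Z *o adj (U j)) (TS i j); rewrite !op_compA.
Qed.

End Frames.

Section Amplification.
Variables (R : realType).
Implicit Types (H K L E F G : hilbertType R).

(** A matrix is viewed as an operator between direct sums, so results on operators apply to it
    directly. Rectangular sizes are allowed because columns occur besides square matrices. *)
Definition ampset H K E F m n (U : 'I_m -> 'B(H, E)) (V : 'I_n -> 'B(K, F))
    (X : set 'B(H, K)) : set 'B(E, F) :=
  [set T | forall i j, X (adj (V i) *o T *o U j)].

Definition mx_op H K E F m n (U : 'I_m -> 'B(H, E)) (V : 'I_n -> 'B(K, F))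
    (x : 'I_n -> 'I_m -> 'B(H, K)) : 'B(E, F) :=
  \sum_i \sum_j V i *o x i j *o adj (U j).

Lemma mx_op_entry H K E F m n (U : 'I_m -> 'B(H, E)) (V : 'I_n -> 'B(K, F)) x i j :
  frame U -> frame V -> adj (V i) *o mx_op U V x *o U j = x i j.
Proof.
move=> [UE _] [VE _].
rewrite /mx_op op_comp_sumr op_comp_suml (bigD1 i)//= [X in _ + X]big1 ?addr0; last first.
  move=> k ki; rewrite op_comp_sumr op_comp_suml big1// => l _.
  by rewrite !op_compA VE eq_sym (negPf ki) !op_comp0l.
rewrite op_comp_sumr op_comp_suml (bigD1 j)//= [X in _ + X]big1 ?addr0; last first.
  move=> l lj.
  by rewrite -!op_compA UE (negPf lj) !op_comp0r.
by rewrite !op_compA VE eqxx op_comp1l -op_compA UE eqxx op_comp1r.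
Qed.

Definition amp H K E F H' K' E' F' m n
    (U : 'I_m -> 'B(H, E)) (V : 'I_n -> 'B(K, F))
    (U' : 'I_m -> 'B(H', E')) (V' : 'I_n -> 'B(K', F'))
    (f : 'B(H, K) -> 'B(H', K')) (T : 'B(E, F)) : 'B(E', F') :=
  mx_op U' V' (fun i j => f (adj (V i) *o T *o U j)).

Lemma amp_entry H K E F H' K' E' F' m n
    (U : 'I_m -> 'B(H, E)) (V : 'I_n -> 'B(K, F))
    (U' : 'I_m -> 'B(H', E')) (V' : 'I_n -> 'B(K', F')) f T i j :
  frame U' -> frame V' ->
  adj (V' i) *o amp U V U' V' f T *o U' j = f (adj (V i) *o T *o U j).
Proof. exact: mx_op_entry. Qed.

Lemma ampset_space H K E F m n (U : 'I_m -> 'B(H, E)) (V : 'I_n -> 'B(K, F)) X :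
  operator_space X -> operator_space (ampset U V X).
Proof.
move=> [cX X0 XP]; split=> [|i j|c x y Xx Xy i j].
- apply/closed_rnorm => T TP i j; move/closed_rnorm: cX; apply=> e e0.
  pose C := opnorm (adj (V i)) * opnorm (U j) + 1.
  have C0 : 0 < C by rewrite ltr_wpDl// mulr_ge0 ?opnorm_ge0.
  have [S XS TS] := TP _ (divr_gt0 e0 C0).
  exists (adj (V i) *o S *o U j); first exact: XS.
  rewrite -op_compBl -op_compBr rnorm_opnorm (le_lt_trans (opnorm_comp _ _))//.
  rewrite (@le_lt_trans _ _ (opnorm (adj (V i)) * opnorm (T - S) * opnorm (U j)))//.
    by rewrite ler_wpM2r ?opnorm_ge0// opnorm_comp.
  rewrite mulrAC (@le_lt_trans _ _ ((C - 1) * (e / C)))//.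
    by rewrite /C addrK ler_wpM2l ?mulr_ge0 ?opnorm_ge0// ltW.
  by rewrite mulrCA gtr_pMr// ltr_pdivrMr// mul1r gtrBl.
- by rewrite op_comp0r op_comp0l.
- by rewrite op_compDr op_compDl op_compZr op_compZl; exact: XP.
Qed.

Lemma ampset_comp H K L E F G m n p (U : 'I_m -> 'B(H, E)) (V : 'I_n -> 'B(K, F))
    (W : 'I_p -> 'B(L, G)) (X : set 'B(H, K)) (Y : set 'B(K, L)) (Z : set 'B(H, L)) T S :
  frame V -> operator_space Z -> (forall y x, Y y -> X x -> Z (y *o x)) ->
  ampset V W Y T -> ampset U V X S -> ampset U W Z (T *o S).
Proof.
move=> [_ V1] [_ Z0 ZP] YXZ YT XS i j.
rewrite -(op_comp1r T) -V1 op_comp_sumr op_comp_suml op_comp_sumr op_comp_suml.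
apply: lin_closed_sum => // k _; rewrite !op_compA.
rewrite -!op_compA (op_compA (adj (W i))) (op_compA (adj (W i) *o T)).
rewrite (op_compA (adj (V k))).
exact: YXZ.
Qed.

Lemma ampset_adj H K E F m n (U : 'I_m -> 'B(H, E)) (V : 'I_n -> 'B(K, F)) X Y T :
  (forall x, X x -> Y (adj x)) -> ampset U V X T -> ampset V U Y (adj T).
Proof.
move=> XY XT i j; have := XY _ (XT j i).
by rewrite !adj_comp adjK op_compA.
Qed.

Lemma amp_linear_on H K E F H' K' E' F' m n
    (U : 'I_m -> 'B(H, E)) (V : 'I_n -> 'B(K, F))
    (U' : 'I_m -> 'B(H', E')) (V' : 'I_n -> 'B(K', F')) f X :
  linear_on X f -> linear_on (ampset U V X) (amp U V U' V' f).
Proof.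
move=> fl c x y Xx Xy; rewrite /amp /mx_op scaler_sumr -big_split; apply: eq_bigr => i _ /=.
rewrite scaler_sumr -big_split; apply: eq_bigr => j _ /=.
rewrite op_compDr op_compDl op_compZr op_compZl fl; [|exact: Xx|exact: Xy].
by rewrite op_compDr op_compDl op_compZr op_compZl.
Qed.

(** Entries of a product are sums of products, which [h] splits by linearity. The three maps may
    differ, so that one statement covers [pi pi], [pi phi], [phi sigma] and the product of a TRO
    representation with its adjoint. *)
Lemma amp_comp H K L E F G H' K' L' E' F' G' m n p
    (U : 'I_m -> 'B(H, E)) (V : 'I_n -> 'B(K, F)) (W : 'I_p -> 'B(L, G))
    (U' : 'I_m -> 'B(H', E')) (V' : 'I_n -> 'B(K', F')) (W' : 'I_p -> 'B(L', G'))
    (X : set 'B(H, K)) (Y : set 'B(K, L)) (Z : set 'B(H, L)) f g h T S :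
  frame V -> frame U' -> frame V' -> frame W' ->
  operator_space Z -> linear_on Z h ->
  (forall y x, Y y -> X x -> Z (y *o x)) ->
  (forall y x, Y y -> X x -> h (y *o x) = g y *o f x) ->
  ampset V W Y T -> ampset U V X S ->
  amp U W U' W' h (T *o S) = amp V W V' W' g T *o amp U V U' V' f S.
Proof.
move=> [_ V1] U'f V'f W'f [_ Z0 ZP] hl YXZ hgf YT XS.
apply: (frame_ext U'f W'f) => i j; rewrite amp_entry//.
have -> : adj (W i) *o (T *o S) *o U j =
    \sum_k (adj (W i) *o T *o V k) *o (adj (V k) *o S *o U j).
  rewrite -{1}(op_comp1r T) -V1 op_comp_sumr op_comp_suml op_comp_sumr op_comp_suml.
  by apply: eq_bigr => k _; rewrite !op_compA.
rewrite (linear_on_sum Z0 ZP hl); last by move=> k _; exact: YXZ.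
have -> : adj (W' i) *o (amp V W V' W' g T *o amp U V U' V' f S) *o U' j =
    \sum_k (adj (W' i) *o amp V W V' W' g T *o V' k) *o
      (adj (V' k) *o amp U V U' V' f S *o U' j).
  rewrite -{1}(op_comp1r (amp V W V' W' g T)) -(proj2 V'f).
  rewrite op_comp_sumr op_comp_suml op_comp_sumr op_comp_suml.
  by apply: eq_bigr => k _; rewrite !op_compA.
by apply: eq_bigr => k _; rewrite !amp_entry// hgf.
Qed.

Lemma amp_adj H K E F H' K' E' F' m n
    (U : 'I_m -> 'B(H, E)) (V : 'I_n -> 'B(K, F))
    (U' : 'I_m -> 'B(H', E')) (V' : 'I_n -> 'B(K', F')) (X : set 'B(H, K)) f g T :
  (forall x, X x -> g (adj x) = adj (f x)) -> ampset U V X T ->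
  amp V U V' U' g (adj T) = adj (amp U V U' V' f T).
Proof.
move=> gf XT; rewrite /amp /mx_op adj_sum exchange_big; apply: eq_bigr => i _.
rewrite adj_sum; apply: eq_bigr => j _.
rewrite !adj_comp adjK op_compA -gf; last exact: XT.
by rewrite !adj_comp adjK op_compA.
Qed.

Lemma ampset_star_algebra H E n (U : 'I_n -> 'B(H, E)) A :
  frame U -> star_algebra A -> star_algebra (ampset U U A).
Proof.
move=> Uf [sA AM Aa]; split; first exact: ampset_space.
  by move=> a b; exact: (ampset_comp Uf sA AM).
by move=> a; exact: ampset_adj.
Qed.

Lemma amp_star_rep H E H' E' n (U : 'I_n -> 'B(H, E)) (U' : 'I_n -> 'B(H', E')) A pi :
  frame U -> frame U' -> star_algebra A -> star_representation A pi ->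
  star_representation (ampset U U A) (amp U U U' U' pi).
Proof.
move=> Uf U'f [sA AM Aa] [pil pim pia]; split; first exact: amp_linear_on.
  by move=> a b Aa' Ab; apply: (amp_comp Uf U'f U'f U'f sA pil AM pim).
by move=> a Aa'; exact: (@amp_adj _ _ _ _ _ _ _ _ _ _ U U U' U' A pi pi a pia Aa').
Qed.

Lemma mx_opnorm_frame H K E F n (U : 'I_n -> 'B(H, E)) (V : 'I_n -> 'B(K, F)) T :
  frame U -> frame V ->
  mx_opnorm (\matrix_(i, j) (adj (V i) *o T *o U j)) = opnorm T.
Proof.
move=> Uf Vf; rewrite /mx_opnorm /opnorm; congr sup.
have key xi : Num.sqrt (\sum_i rnorm (\sum_j
    (\matrix_(i, j) (adj (V i) *o T *o U j)) i j (xi j)) ^+ 2) =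
    rnorm (T (\sum_j U j (xi j))).
  rewrite -[RHS]ger0_norm ?rnorm_ge0// -sqrtr_sqr; congr Num.sqrt.
  rewrite (rnorm_frame_decomp _ Vf); apply: eq_bigr => i _; congr (rnorm _ ^+ 2).
  by rewrite op_lin_sum op_lin_sum; apply: eq_bigr => j _; rewrite mxE.
apply/seteqP; split=> [_ [xi /= xi1 <-]|_ [x /= x1 <-]].
  exists (\sum_j U j (xi j)) => /=; last by rewrite key.
  by rewrite -(@ler_pXn2r _ 2)// ?nnegrE ?rnorm_ge0// expr1n rnorm_frame_sqr.
exists (fun j => adj (U j) x) => /=; last by rewrite key frame_decomp.
by rewrite -rnorm_frame_decomp// -(expr1n _ 2) ler_pXn2r// ?nnegrE ?rnorm_ge0.
Qed.

Lemma mx_opnorm_op H K E F n (U : 'I_n -> 'B(H, E)) (V : 'I_n -> 'B(K, F))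
    (x : 'M['B(H, K)]_n) :
  frame U -> frame V -> mx_opnorm x = opnorm (mx_op U V x).
Proof.
move=> Uf Vf; rewrite -(mx_opnorm_frame _ Uf Vf); congr mx_opnorm.
by apply/matrixP => i j; rewrite mxE mx_op_entry.
Qed.

Lemma mx_opnorm_amp H K E F H' K' E' F' n
    (U : 'I_n -> 'B(H, E)) (V : 'I_n -> 'B(K, F))
    (U' : 'I_n -> 'B(H', E')) (V' : 'I_n -> 'B(K', F')) f (x : 'M['B(H, K)]_n) :
  frame U -> frame V -> frame U' -> frame V' ->
  mx_opnorm (map_mx f x) = opnorm (amp U V U' V' f (mx_op U V x)).
Proof.
move=> Uf Vf U'f V'f; rewrite (mx_opnorm_op _ U'f V'f); congr opnorm.
apply: (frame_ext U'f V'f) => i j.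
by rewrite amp_entry// !mx_op_entry// mxE.
Qed.

Lemma mx_op_ampset H K E F m n (U : 'I_m -> 'B(H, E)) (V : 'I_n -> 'B(K, F)) X x :
  frame U -> frame V -> (forall i j, X (x i j)) -> ampset U V X (mx_op U V x).
Proof. by move=> Uf Vf Xx i j; rewrite mx_op_entry. Qed.

Lemma mx_op_entries H K E F m n (U : 'I_m -> 'B(H, E)) (V : 'I_n -> 'B(K, F)) T :
  frame U -> frame V -> mx_op U V (fun i j => adj (V i) *o T *o U j) = T.
Proof. by move=> Uf Vf; apply: (frame_ext Uf Vf) => i j; rewrite mx_op_entry. Qed.

Lemma completely_contractive_amp H K E F H' K' E' F' n
    (U : 'I_n -> 'B(H, E)) (V : 'I_n -> 'B(K, F))
    (U' : 'I_n -> 'B(H', E')) (V' : 'I_n -> 'B(K', F')) X f T :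
  frame U -> frame V -> frame U' -> frame V' ->
  completely_contractive X f -> ampset U V X T ->
  opnorm (amp U V U' V' f T) <= opnorm T.
Proof.
move=> Uf Vf U'f V'f [_ fcc] XT.
pose x := \matrix_(i, j) (adj (V i) *o T *o U j).
have xE : mx_op U V x = T.
  rewrite -[RHS](mx_op_entries _ Uf Vf); apply: (frame_ext Uf Vf) => i j.
  by rewrite !mx_op_entry// mxE.
rewrite -{1}xE -mx_opnorm_amp// -xE -mx_opnorm_op//.
by apply: fcc => i j; rewrite mxE.
Qed.

Lemma completely_isometric_amp H K E F H' K' E' F' n
    (U : 'I_n -> 'B(H, E)) (V : 'I_n -> 'B(K, F))
    (U' : 'I_n -> 'B(H', E')) (V' : 'I_n -> 'B(K', F')) X f T :
  frame U -> frame V -> frame U' -> frame V' ->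
  completely_isometric X f -> ampset U V X T ->
  opnorm (amp U V U' V' f T) = opnorm T.
Proof.
move=> Uf Vf U'f V'f [_ fci] XT.
pose x := \matrix_(i, j) (adj (V i) *o T *o U j).
have xE : mx_op U V x = T.
  rewrite -[RHS](mx_op_entries _ Uf Vf); apply: (frame_ext Uf Vf) => i j.
  by rewrite !mx_op_entry// mxE.
rewrite -{1}xE -mx_opnorm_amp// -xE -mx_opnorm_op//.
by apply: fci => i j; rewrite mxE.
Qed.

End Amplification.

(** * The Cauchy-Schwarz inequality *)

Section BimoduleCauchySchwarz.
Variables (R : realType).
Implicit Types (H K L E F G : hilbertType R).

Local Notation "r %:O" := ((r)%:C%C *: op_id _) (at level 2, format "r %:O").

(** The last clause makes [m n^*] the [A]-valued inner product of a left Hilbert module. *)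
Definition left_module H K (A : set 'B(K, K)) (M : set 'B(H, K)) : Prop :=
  [/\ M 0, forall c x y, M x -> M y -> M (c *: x + y),
      forall a m, A a -> M m -> M (a *o m) &
      forall m n, M m -> M n -> A (m *o adj n)].

(** The bound on [phi] is kept as a separate hypothesis with its own constant, since the transfer
    and the isometry argument use different constants. *)
Definition bimodule_rep K1 K2 L1 L2 (A : set 'B(K2, K2)) (X : set 'B(K1, K2))
    (B : set 'B(K1, K1)) (pi : 'B(K2, K2) -> 'B(L2, L2))
    (phi : 'B(K1, K2) -> 'B(L1, L2)) (sigma : 'B(K1, K1) -> 'B(L1, L1)) : Prop :=
  [/\ star_algebra A, star_algebra B, operator_space X,
      forall a x, A a -> X x -> X (a *o x) &
      forall x b, X x -> B b -> X (x *o b)] /\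
  [/\ star_representation A pi, star_representation B sigma, linear_on X phi,
      forall a x, A a -> X x -> phi (a *o x) = pi a *o phi x &
      forall x b, X x -> B b -> phi (x *o b) = phi x *o sigma b].

Lemma rnorm_sqrt_rep H K (A : set 'B(H, H)) (pi : 'B(H, H) -> 'B(K, K)) s a
    (beta : R) x :
  star_algebra A -> star_representation A pi -> A s -> adj s = s ->
  s *o s + (2 * beta)%:C%C *: s = a ->
  rnorm ((beta%:O + pi s) x) ^+ 2 =
    beta ^+ 2 * rnorm x ^+ 2 + complex.Re (hdot (pi a x) x).
Proof.
move=> [[cA A0 AP] AM _] [pil pim pia] As ssa sE.
have pis : adj (pi s) = pi s by rewrite -pia// ssa.
rewrite -sE (linear_onD pil) ?pim//; [|exact: AM|exact: lin_closedZ].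
rewrite (linear_onZ A0 pil)// rnorm_sqr_adj rnorm_sqr.
rewrite adjD adjZ adj_id conjC_real_complex pis.
by rewrite -Re_realM -ReD; congr complex.Re; expand_hdot; ring.
Qed.

Lemma le_of_le_eps (x y C : R) :
  0 <= C -> (forall e : R, 0 < e -> e <= 1 -> x <= y + C * e) -> x <= y.
Proof.
move=> C0 xy; apply/ler_addgt0Pr => e e0.
have C1 : 0 < C + 1 by rewrite ltr_wpDl.
have m0 : 0 < Num.min 1 (e / (C + 1)) by rewrite lt_min ltr01 divr_gt0.
rewrite (le_trans (xy _ m0 _)) ?ge_min ?lexx// lerD2l.
rewrite (@le_trans _ _ (C * (e / (C + 1))))//.
  by rewrite ler_wpM2l// ge_min lexx orbT.
by rewrite mulrC -mulrA ler_piMr ?(ltW e0)// mulrC ler_pdivrMr// mul1r lerDl.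
Qed.

(* With [n = (sqrt e + s) n'] and [m = (sqrt e + t) m'] for contractions [n'] and
   [m'], the vector [phi (n y m^* ) z] is
   [(sqrt e + pi s) phi (n' y m'^* ) (sqrt e + sigma t) z]. *)
Lemma bimodule_cs H1 H2 K1 K2 L1 L2 (A : set 'B(K2, K2)) (X : set 'B(K1, K2))
    (B : set 'B(K1, K1)) pi phi sigma (M1 : set 'B(H1, K1)) (M2 : set 'B(H2, K2))
    n m y (C : R) (z : L1) (t : L2) :
  bimodule_rep A X B pi phi sigma -> left_module A M2 -> left_module B M1 ->
  M2 n -> M1 m -> (forall e f, M2 e -> M1 f -> X (e *o y *o adj f)) -> 0 <= C ->
  (forall e f, M2 e -> M1 f -> opnorm e <= 1 -> opnorm f <= 1 ->
    opnorm (phi (e *o y *o adj f)) <= C) ->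
  cabs (hdot (phi (n *o y *o adj m) z) t) ^+ 2 <=
  C ^+ 2 * (complex.Re (hdot (sigma (m *o adj m) z) z) *
            complex.Re (hdot (pi (n *o adj n) t) t)).
Proof.
move=> [[Aalg Balg [cX X0 XP] AX XB] [pir sigmar phil phia phib]].
move=> [M20 M2P AM2 M2A] [M10 M1P BM1 M1B] M2n M1m yX C0 phiC.
set zz := complex.Re (hdot (sigma _ _) _); set tt := complex.Re (hdot (pi _ _) _).
have zz0 : 0 <= zz.
  have := @star_rep_pos _ _ _ B sigma (m *o adj m) 0 Balg sigmar (M1B _ _ M1m M1m).
  rewrite adj_comp adjK => /(_ erefl (lexx _)) H.
  suff : 0 <= 0 * rnorm z ^+ 2 + zz by rewrite mul0r add0r.
  by apply: H => x; rewrite mul0r add0r op_compE adjP -rnorm_sqr sqr_ge0.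
have tt0 : 0 <= tt.
  have := @star_rep_pos _ _ _ A pi (n *o adj n) 0 Aalg pir (M2A _ _ M2n M2n).
  rewrite adj_comp adjK => /(_ erefl (lexx _)) H.
  suff : 0 <= 0 * rnorm t ^+ 2 + tt by rewrite mul0r add0r.
  by apply: H => x; rewrite mul0r add0r op_compE adjP -rnorm_sqr sqr_ge0.
pose z2 := rnorm z ^+ 2; pose t2 := rnorm t ^+ 2.
have z20 : 0 <= z2 by exact: sqr_ge0.
have t20 : 0 <= t2 by exact: sqr_ge0.
(* For a given [e] the bound is [C^2 (e z2 + zz) (e t2 + tt)]; for [e <= 1] its excess over the
   claim is at most this constant times [e]. *)
apply: (@le_of_le_eps _ _ (C ^+ 2 * (z2 * tt + t2 * zz + z2 * t2))).
  by rewrite mulr_ge0 ?sqr_ge0// !addr_ge0// mulr_ge0.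
move=> e e0 e1.
have [beta [s [n' [[As ssa M2n'] [n'1 nE b2 sE]]]]] :=
  polar_factor Aalg M20 M2P AM2 M2n (M2A _ _ M2n M2n) e0.
have [beta' [s' [m' [[Bs' s'sa M1m'] [m'1 mE b'2 s'E]]]]] :=
  polar_factor Balg M10 M1P BM1 M1m (M1B _ _ M1m M1m) e0.
pose x := n' *o y *o adj m'.
have Xx : X x by exact: yX.
have Xsx : X ((beta%:O + s) *o x).
  rewrite op_compDl op_compZl op_comp1l; apply: XP => //; exact: AX.
have nymE : n *o y *o adj m = (beta%:O + s) *o x *o (beta'%:O + s').
  rewrite {1}nE {1}mE adj_comp adjD adjZ adj_id s'sa conjC_real_complex.
  by rewrite /x !op_compA.
have phiE : phi (n *o y *o adj m) =
    (beta%:O + pi s) *o phi x *o (beta'%:O + sigma s').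
  have phiR u : X u -> phi (u *o (beta'%:O + s')) = phi u *o (beta'%:O + sigma s').
    move=> Xu; rewrite !op_compDr !op_compZr !op_comp1r phil ?phib//; exact: XB.
  rewrite nymE phiR//; congr (_ *o _); rewrite op_compDl op_compZl op_comp1l phil//; last exact: AX.
  by rewrite phia// op_compDl op_compZl op_comp1l.
have pis : adj (beta%:O + pi s) = beta%:O + pi s.
  have [_ _ pia] := pir.
  by rewrite adjD adjZ adj_id conjC_real_complex -pia// ssa.
have bound : cabs (hdot (phi (n *o y *o adj m) z) t) <=
    C * rnorm ((beta'%:O + sigma s') z) * rnorm ((beta%:O + pi s) t).
  rewrite phiE -op_compA op_compE adjP pis op_compE (le_trans (cauchy_schwarz _ _))//.
  rewrite ler_wpM2r ?rnorm_ge0// (le_trans (rnorm_opE _ _))//.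
  by rewrite ler_wpM2r ?rnorm_ge0// phiC.
have := bound; rewrite -(@ler_pXn2r _ 2)// ?nnegrE ?cabs_ge0 ?mulr_ge0 ?rnorm_ge0//.
rewrite !exprMn (rnorm_sqrt_rep _ Balg sigmar Bs' s'sa s'E).
rewrite (rnorm_sqrt_rep _ Aalg pir As ssa sE) b2 b'2 -/zz -/tt -/z2 -/t2.
move/le_trans; apply; rewrite -mulrA -[X in _ <= _ + X]mulrA -mulrDr ler_wpM2l ?sqr_ge0//.
have : 0 <= z2 * t2 * (e * (1 - e))
  by apply: mulr_ge0; apply: mulr_ge0; rewrite ?subr_ge0//; exact: ltW.
lra.
Qed.

(** The amplification of a star representation is one again, and star representations are
    contractive. *)
Lemma star_rep_cc H K (A : set 'B(H, H)) (pi : 'B(H, H) -> 'B(K, K)) :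
  star_algebra A -> star_representation A pi -> completely_contractive A pi.
Proof.
move=> Aalg pir; split=> [|n x Ax]; first by case: pir.
have [F [V Vf]] := frame_exists H n; have [F' [V' V'f]] := frame_exists K n.
rewrite (mx_opnorm_amp pi x Vf Vf V'f V'f) (mx_opnorm_op x Vf Vf).
apply: (star_rep_contractive (ampset_star_algebra Vf Aalg)).
  exact: amp_star_rep.
exact: mx_op_ampset.
Qed.

Lemma sandwich_sum L1 L2 F1 F2 N (V1 : 'I_N -> 'B(L1, F1)) (V2 : 'I_N -> 'B(L2, F2))
    (T : 'B(F1, F2)) (z : 'I_N -> L1) (t : 'I_N -> L2) :
  hdot (T (\sum_p V1 p (z p))) (\sum_q V2 q (t q)) =
  \sum_p \sum_q hdot ((adj (V2 q) *o T *o V1 p) (z p)) (t q).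
Proof.
rewrite op_lin_sum hdot_suml; apply: eq_bigr => p _.
by rewrite hdot_sumr; apply: eq_bigr => q _; rewrite !op_compE adjP'.
Qed.

(** Row [p] has its only block in column [j p]. The map [j] lets elementary tensors from different
    summands of a [k]-fold direct sum be collected in one operator. *)
Definition column H K E F k N (U : 'I_k -> 'B(H, E)) (V : 'I_N -> 'B(K, F))
    (j : 'I_N -> 'I_k) (m : 'I_N -> 'B(H, K)) : 'B(E, F) :=
  \sum_p V p *o m p *o adj (U (j p)).

Lemma column_entry H K E F k N (U : 'I_k -> 'B(H, E)) (V : 'I_N -> 'B(K, F)) j m p :
  frame V -> adj (V p) *o column U V j m = m p *o adj (U (j p)).
Proof.
move=> [VV _]; rewrite /column op_comp_sumr (bigD1 p)//= big1 ?addr0.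
  by rewrite !op_compA VV eqxx op_comp1l.
by move=> q qp; rewrite !op_compA VV eq_sym (negPf qp) !op_comp0l.
Qed.

Lemma column_ampset H K E F k N (U : 'I_k -> 'B(H, E)) (V : 'I_N -> 'B(K, F)) j m M :
  frame U -> frame V -> M 0 -> (forall p, M (m p)) -> ampset U V M (column U V j m).
Proof.
move=> [UU _] Vf M0 Mm p i; rewrite column_entry// -op_compA UU.
by case: ifP => _; rewrite ?op_comp1r ?op_comp0r.
Qed.

Lemma ampset_left_module H K E F k N (U : 'I_k -> 'B(H, E)) (V : 'I_N -> 'B(K, F)) A M :
  frame U -> frame V -> operator_space M -> star_algebra A -> left_module A M ->
  left_module (ampset V V A) (ampset U V M).
Proof.
move=> Uf Vf sM [sA _ _] [M0 MP AM MA].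
have [_ aM0 aMP] := ampset_space U V sM; split => // [a m|m n Mm Mn].
  exact: (ampset_comp Vf sM AM).
apply: (ampset_comp Uf sA (Y := M) (X := [set adj m | m in M])) => //.
  by move=> y _ My [x Mx <-]; exact: MA.
by apply: ampset_adj Mn => x Mx; exists x.
Qed.

Lemma amp_bimodule_rep K1 K2 L1 L2 F1 F2 G1 G2 N
    (V1 : 'I_N -> 'B(K1, F1)) (V2 : 'I_N -> 'B(K2, F2))
    (V1' : 'I_N -> 'B(L1, G1)) (V2' : 'I_N -> 'B(L2, G2))
    (A : set 'B(K2, K2)) X (B : set 'B(K1, K1)) pi phi sigma :
  frame V1 -> frame V2 -> frame V1' -> frame V2' ->
  bimodule_rep A X B pi phi sigma ->
  bimodule_rep (ampset V2 V2 A) (ampset V1 V2 X) (ampset V1 V1 B)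
    (amp V2 V2 V2' V2' pi) (amp V1 V2 V1' V2' phi) (amp V1 V1 V1' V1' sigma).
Proof.
move=> V1f V2f V1'f V2'f [[Aalg Balg sX AX XB] [pir sigmar phil phia phib]].
split; split.
- exact: ampset_star_algebra.
- exact: ampset_star_algebra.
- exact: ampset_space.
- by move=> a x; exact: (ampset_comp V2f sX AX).
- by move=> x b; exact: (ampset_comp V1f sX XB).
- exact: amp_star_rep.
- exact: amp_star_rep.
- exact: amp_linear_on.
- by move=> a x; exact: (amp_comp V2f V1'f V2'f V2'f sX phil AX phia).
- by move=> x b; exact: (amp_comp V1f V1'f V1'f V2'f sX phil XB phib).
Qed.

(** For the column [c], the entry of [c c^*] at [q], [p] is [m q *o adj (m p)] if [j q = j p] and 0
    otherwise, so [sigma] turns it into the Gram matrix of the vectors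
    [U' (j p) (W (m p) (z p))]. *)
Lemma column_form H K E F L F' E' G' k N (U : 'I_k -> 'B(H, E)) (V : 'I_N -> 'B(K, F))
    (V' : 'I_N -> 'B(L, F')) (U' : 'I_k -> 'B(E', G')) (j : 'I_N -> 'I_k)
    (m : 'I_N -> 'B(H, K)) (z : 'I_N -> L) (M : set 'B(H, K)) sigma
    (W : 'B(H, K) -> 'B(L, E')) :
  frame U -> frame V -> frame V' -> frame U' -> sigma 0 = 0 ->
  (forall p, M (m p)) ->
  (forall m m', M m -> M m' -> adj (W m') *o W m = sigma (m' *o adj m)) ->
  complex.Re (hdot (amp V V V' V' sigma (column U V j m *o adj (column U V j m))
    (\sum_p V' p (z p))) (\sum_p V' p (z p))) =
  rnorm (\sum_p U' (j p) (W (m p) (z p))) ^+ 2.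
Proof.
move=> Uf Vf V'f U'f sigma0 Mm WE.
rewrite rnorm_sqr sandwich_sum hdot_suml; congr complex.Re; apply: eq_bigr => p _.
rewrite hdot_sumr; apply: eq_bigr => q _; rewrite amp_entry//.
have -> : adj (V q) *o (column U V j m *o adj (column U V j m)) *o V p =
    (adj (V q) *o column U V j m) *o adj (adj (V p) *o column U V j m).
  by rewrite adj_comp adjK !op_compA.
rewrite !column_entry// adj_comp adjK !op_compA -(op_compA (m q)) (proj1 Uf).
rewrite [RHS]adjP (frameE _ _ _ U'f) eq_sym.
case: ifP => _; last by rewrite op_comp0r op_comp0l sigma0 op0E hdot0l hdot0r.
by rewrite op_comp1r -WE// op_compE adjP'.
Qed.

(** Columns turn the two sums of elementary tensors into one scalar product for the amplified
    bimodule, where [bimodule_cs] applies. The matrix size [N] is the number of tensors. *)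
Lemma amp_cs H1 H2 K1 K2 L1 L2 E1 E2 G1 G2 G1' G2' k N
    (A : set 'B(K2, K2)) (X : set 'B(K1, K2))
    (B : set 'B(K1, K1)) pi phi sigma (M1 : set 'B(H1, K1)) (M2 : set 'B(H2, K2))
    (W1 : 'B(H1, K1) -> 'B(L1, E1)) (W2 : 'B(H2, K2) -> 'B(L2, E2))
    (U1 : 'I_k -> 'B(H1, G1)) (U2 : 'I_k -> 'B(H2, G2))
    (U1' : 'I_k -> 'B(E1, G1')) (U2' : 'I_k -> 'B(E2, G2'))
    (y : 'B(G1, G2)) (C : R) (m : 'I_N -> 'B(H1, K1)) (n : 'I_N -> 'B(H2, K2))
    (j i : 'I_N -> 'I_k) (z : 'I_N -> L1) (t : 'I_N -> L2) :
  bimodule_rep A X B pi phi sigma -> operator_space M1 -> operator_space M2 ->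
  left_module A M2 -> left_module B M1 ->
  frame U1 -> frame U2 -> frame U1' -> frame U2' ->
  (forall m m', M1 m -> M1 m' -> adj (W1 m') *o W1 m = sigma (m' *o adj m)) ->
  (forall m m', M2 m -> M2 m' -> adj (W2 m') *o W2 m = pi (m' *o adj m)) ->
  (forall e f i j, M2 e -> M1 f -> X (e *o (adj (U2 i) *o y *o U1 j) *o adj f)) ->
  0 <= C ->
  (forall F1 F2 F1' F2' (V1 : 'I_N -> 'B(K1, F1)) (V2 : 'I_N -> 'B(K2, F2))
    (V1' : 'I_N -> 'B(L1, F1')) (V2' : 'I_N -> 'B(L2, F2')) e f,
    frame V1 -> frame V2 -> frame V1' -> frame V2' ->
    ampset U2 V2 M2 e -> ampset U1 V1 M1 f -> opnorm e <= 1 -> opnorm f <= 1 ->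
    ampset V1 V2 X (e *o y *o adj f) ->
    opnorm (amp V1 V2 V1' V2' phi (e *o y *o adj f)) <= C) ->
  (forall p, M1 (m p)) -> (forall p, M2 (n p)) ->
  cabs (\sum_p \sum_q
    hdot (phi (n q *o (adj (U2 (i q)) *o y *o U1 (j p)) *o adj (m p)) (z p)) (t q)) <=
  C * rnorm (\sum_p U1' (j p) (W1 (m p) (z p))) *
      rnorm (\sum_p U2' (i p) (W2 (n p) (t p))).
Proof.
move=> rep sM1 sM2 AM2 BM1 U1f U2f U1'f U2'f W1E W2E yX C0 phiC M1m M2n.
have [F1 [V1 V1f]] := frame_exists K1 N; have [F2 [V2 V2f]] := frame_exists K2 N.
have [F1' [V1' V1'f]] := frame_exists L1 N; have [F2' [V2' V2'f]] := frame_exists L2 N.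
have arep := amp_bimodule_rep V1f V2f V1'f V2'f rep.
have [[Aalg Balg sX AX XB] [pir sigmar _ _ _]] := rep.
have aAM2 := ampset_left_module U2f V2f sM2 Aalg AM2.
have aBM1 := ampset_left_module U1f V1f sM1 Balg BM1.
have M1h : ampset U1 V1 M1 (column U1 V1 j m).
  by apply: column_ampset => //; have [] := BM1.
have M2h : ampset U2 V2 M2 (column U2 V2 i n).
  by apply: column_ampset => //; have [] := AM2.
have yXh e f : ampset U2 V2 M2 e -> ampset U1 V1 M1 f -> ampset V1 V2 X (e *o y *o adj f).
  move=> eM fM p q.
  rewrite -{1}(op_comp1r e) -(proj2 U2f) -(op_comp1r y) -(proj2 U1f).
  rewrite !(op_comp_sumr, op_comp_suml); have [_ X0 XP] := sX.
  apply: lin_closed_sum => // a _; rewrite !(op_comp_sumr, op_comp_suml).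
  apply: lin_closed_sum => // b _.
  have := yX _ _ a b (eM p a) (fM q b).
  by rewrite !adj_comp adjK !op_compA.
have := @bimodule_cs _ _ _ _ _ _ _ _ _ _ _ _ _ _ (column U2 V2 i n) (column U1 V1 j m) y C
  (\sum_p V1' p (z p)) (\sum_p V2' p (t p)) arep aAM2 aBM1 M2h M1h yXh C0.
move=> /(_ (fun e f eM fM e1 f1 =>
  phiC _ _ _ _ _ _ _ _ _ _ V1f V2f V1'f V2'f eM fM e1 f1 (yXh _ _ eM fM))).
have p0 : pi 0 = 0.
  by case: pir => pil _ _; case: Aalg => [[_ A0 _] _ _]; exact: (linear_on0 A0 pil).
have s0 : sigma 0 = 0.
  by case: sigmar => pil _ _; case: Balg => [[_ A0 _] _ _]; exact: (linear_on0 A0 pil).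
rewrite (column_form _ _ U1f V1f V1'f U1'f s0 M1m W1E).
rewrite (column_form _ _ U2f V2f V2'f U2'f p0 M2n W2E).
rewrite -!exprMn ler_pXn2r// ?nnegrE ?cabs_ge0 ?mulr_ge0 ?rnorm_ge0// mulrA.
apply: le_trans; rewrite le_eqVlt; apply/orP; left; apply/eqP; congr cabs.
rewrite sandwich_sum; apply: eq_bigr => p _; apply: eq_bigr => q _.
rewrite amp_entry//; congr (hdot (phi _ _) _).
have -> : adj (V2 q) *o (column U2 V2 i n *o y *o adj (column U1 V1 j m)) *o V1 p =
    (adj (V2 q) *o column U2 V2 i n) *o y *o adj (adj (V1 p) *o column U1 V1 j m).
  by rewrite adj_comp adjK !op_compA.
by rewrite !column_entry// adj_comp adjK !op_compA.
Qed.

End BimoduleCauchySchwarz.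

(** * Induced bimodule maps *)

Section ClosedSpanOperators.
Variables (R : realType).
Implicit Types (H K L : hilbertType R).

Lemma closed_lipschitz_preimage H K H' K' (Z : set 'B(H', K')) (f : 'B(H, K) -> 'B(H', K'))
    (C : R) : closed Z -> (forall x y, opnorm (f x - f y) <= C * opnorm (x - y)) ->
  closed [set x | Z (f x)].
Proof.
move=> /closed_rnorm cZ fC; apply/closed_rnorm => x xP /=; apply: cZ => e e0.
have C1 : 0 < `|C| + 1 by rewrite ltr_wpDl.
have [y Zy xy] := xP _ (divr_gt0 e0 C1).
exists (f y) => //; rewrite rnorm_opnorm (le_lt_trans (fC _ _))//.
rewrite (@le_lt_trans _ _ (`|C| * (e / (`|C| + 1))))//.
  rewrite (le_trans (ler_wpM2r (opnorm_ge0 _) (ler_norm C)))// ler_wpM2l//.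
  exact: ltW.
by rewrite mulrC -mulrA gtr_pMr// mulrC ltr_pdivrMr// mul1r ltrDl.
Qed.

Lemma closed_span_compl H K L (S : set 'B(K, L)) (Z : set 'B(H, L)) a b :
  operator_space Z -> (forall s, S s -> Z (s *o b)) -> closed_span S a -> Z (a *o b).
Proof.
move=> [cZ Z0 ZP] SZ; apply: (@closed_span_min _ _ S [set a | Z (a *o b)]) => //=.
- by rewrite op_comp0l.
- by move=> c x y Zx Zy; rewrite op_compDl op_compZl; exact: ZP.
- apply: (@closed_lipschitz_preimage _ _ _ _ _ _ (opnorm b)) => // x y.
  by rewrite -op_compBl mulrC opnorm_comp.
Qed.

Lemma closed_span_compr H K L (S : set 'B(H, K)) (Z : set 'B(H, L)) a b :
  operator_space Z -> (forall s, S s -> Z (b *o s)) -> closed_span S a -> Z (b *o a).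
Proof.
move=> [cZ Z0 ZP] SZ; apply: (@closed_span_min _ _ S [set a | Z (b *o a)]) => //=.
- by rewrite op_comp0r.
- by move=> c x y Zx Zy; rewrite op_compDr op_compZr; exact: ZP.
- apply: (@closed_lipschitz_preimage _ _ _ _ _ _ (opnorm b)) => // x y.
  by rewrite -op_compBr opnorm_comp.
Qed.

Lemma closed_span_adj H K (S : set 'B(H, K)) (Z : set 'B(K, H)) a :
  operator_space Z -> (forall s, S s -> Z (adj s)) -> closed_span S a -> Z (adj a).
Proof.
move=> [cZ Z0 ZP] SZ; apply: (@closed_span_min _ _ S [set a | Z (adj a)]) => //=.
- by rewrite adj0.
- by move=> c x y Zx Zy; rewrite adjD adjZ; exact: ZP.
- apply: (@closed_lipschitz_preimage _ _ _ _ _ _ 1) => // x y.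
  by rewrite -adjB mul1r opnorm_adj.
Qed.

Lemma operator_space_closed_span H K (S : set 'B(H, K)) :
  operator_space (closed_span S).
Proof.
by split; [exact: closed_closed_span|exact: closed_span0|exact: closed_spanP].
Qed.

Lemma operator_space_adj H K (M : set 'B(H, K)) :
  operator_space M -> operator_space M^*o.
Proof.
move=> [cM M0 MP]; have -> : M^*o = [set x | M (adj x)].
  by apply/seteqP; split=> [_ [m Mm <-]|x Mx] /=; [rewrite adjK|exists (adj x); rewrite ?adjK].
split=> /= [||c x y Mx My]; last by rewrite adjD adjZ; exact: MP.
  apply: (@closed_lipschitz_preimage _ _ _ _ _ _ 1) => // x y.
  by rewrite -adjB mul1r opnorm_adj.
by rewrite adj0.
Qed.

Lemma adj_setK H K (M : set 'B(H, K)) : (M^*o)^*o = M.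
Proof.
apply/seteqP; split=> [_ [_ [m Mm <-] <-]|m Mm]; first by rewrite adjK.
by exists (adj m); rewrite ?adjK//; exists m.
Qed.

Lemma TRO_comp H K (M : set 'B(H, K)) m n p :
  TRO M -> M m -> M n -> M p -> M (m *o adj n *o p).
Proof.
move=> [_ MMM] Mm Mn Mp; apply: MMM; exists (m *o adj n); last by exists p.
by exists m => //; exists (adj n) => //; exists n.
Qed.

Lemma TRO_adj H K (M : set 'B(H, K)) : TRO M -> TRO M^*o.
Proof.
move=> tM; split; first by apply: operator_space_adj; case: tM.
move=> _ [_ [_ [m Mm <-] [n [n' [n'' Mn'' <-] <-] <-]] [_ [p Mp <-] <-]].
exists (p *o adj n'' *o m); first exact: TRO_comp.
by rewrite !adj_comp !adjK op_compA.
Qed.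

Lemma left_algebra_gen H K (M : set 'B(H, K)) m n : M m -> M n ->
  closed_span (M `*o M^*o) (m *o adj n).
Proof. by move=> Mm Mn; apply: sub_closed_span; exists m => //; exists (adj n) => //; exists n. Qed.

Lemma right_algebra_gen H K (M : set 'B(H, K)) m n : M m -> M n ->
  closed_span (M^*o `*o M) (adj m *o n).
Proof. by move=> Mm Mn; apply: sub_closed_span; exists (adj m); [exists m|exists n]. Qed.

Lemma TRO_left_module H K (M : set 'B(H, K)) : TRO M ->
  left_module (closed_span (M `*o M^*o)) M.
Proof.
move=> tM; have [sM _] := tM; have [cM M0 MP] := sM.
split => // [a m Aa Mm|m n]; last exact: left_algebra_gen.
apply: closed_span_compl Aa => // _ [m' Mm' [_ [n Mn <-] <-]].
exact: TRO_comp.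
Qed.

Lemma TRO_star_algebra H K (M : set 'B(H, K)) : TRO M ->
  star_algebra (closed_span (M `*o M^*o)).
Proof.
move=> tM; have sA := operator_space_closed_span (M `*o M^*o).
have [_ _ AM _] := TRO_left_module tM.
split => // [a b Aa Ab|a Aa].
  apply: closed_span_compr Ab => // _ [m Mm [_ [n Mn <-] <-]].
  by rewrite op_compA; apply: left_algebra_gen => //; exact: AM.
apply: closed_span_adj Aa => // _ [m Mm [_ [n Mn <-] <-]].
by rewrite adj_comp adjK; exact: left_algebra_gen.
Qed.

Lemma TRO_right_module H K (M : set 'B(H, K)) m c : TRO M -> M m ->
  closed_span (M^*o `*o M) c -> M (m *o c).
Proof.
move=> tM Mm Cc; have [sM _] := tM.
apply: closed_span_compr Cc => // _ [_ [n Mn <-] [p Mp <-]].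
by rewrite op_compA; exact: TRO_comp.
Qed.

Lemma TRO_star_algebra_right H K (M : set 'B(H, K)) : TRO M ->
  star_algebra (closed_span (M^*o `*o M)).
Proof. by move=> /TRO_adj /TRO_star_algebra; rewrite adj_setK. Qed.

End ClosedSpanOperators.

(** * Interior tensor products and forms on them *)

Section Dilation.
Variables (R : realType).
Implicit Types (H K L E F G : hilbertType R).

Definition range_spanning H K L E (M : set 'B(H, K)) (W : 'B(H, K) -> 'B(L, E)) : Prop :=
  forall v, (forall m x, M m -> hdot (W m x) v = 0) -> v = 0.

Lemma range_spanning_ext H1 H2 K1 K2 L1 L2 E1 E2 (M1 : set 'B(H1, K1)) (M2 : set 'B(H2, K2))
    (W1 : 'B(H1, K1) -> 'B(L1, E1)) (W2 : 'B(H2, K2) -> 'B(L2, E2)) (T S : 'B(E1, E2)) :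
  range_spanning M1 W1 -> range_spanning M2 W2 ->
  (forall n m, M2 n -> M1 m -> adj (W2 n) *o T *o W1 m = adj (W2 n) *o S *o W1 m) -> T = S.
Proof.
move=> s1 s2 TS.
suff TSW m x : M1 m -> (T - S) (W1 m x) = 0.
  apply: opP => x; apply/eqP; rewrite -subr_eq0 -opBE -(adjK (T - S)); apply/eqP.
  apply: eq_hdotl => y; rewrite adjP' hdot0l hdotC.
  suff -> : adj (T - S) y = 0 by rewrite hdot0l conjC0.
  by apply: s1 => m z Mm; rewrite -adjP TSW// hdot0l.
move=> Mm; apply: s2 => n y Mn.
have := congr1 (fun Z : 'B(L1, L2) => Z x) (TS n m Mn Mm).
rewrite !op_compE => E; rewrite adjP opBE op_linB E subrr.
by rewrite hdot0r.
Qed.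

(** Brings two lists of different lengths to families over the same ['I_N]; the default entry has to
    contribute 0. *)
Lemma big_nth_pad (V : nmodType) (I : Type) (F : I -> V) d (l : seq I) N :
  (size l <= N)%N -> F d = 0 ->
  \sum_(p <- l) F p = \sum_(i < N) F (nth d l i).
Proof.
move=> lN Fd; rewrite (big_nth d) -(big_mkord xpredT (fun i => F (nth d l i))).
rewrite (@big_cat_nat _ _ _ (size l) 0 N)//= [X in _ + X]big1_seq ?addr0//.
by move=> i; rewrite mem_index_iota => /andP[_ /andP[li _]]; rewrite nth_default.
Qed.

(** [E] is the interior tensor product of [M^*] and [L] over [A], and [W m x] is the elementary
    tensor of [m^*] and [x]. Its kernel is positive because the form at a list is that of the
    amplified [pi] at [c c^*], for the column [c] of the elements of [M] in the list. *)
Lemma dilation H K L (A : set 'B(K, K)) (M : set 'B(H, K)) (pi : 'B(K, K) -> 'B(L, L)) :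
  star_algebra A -> operator_space M -> left_module A M -> star_representation A pi ->
  exists E (W : 'B(H, K) -> 'B(L, E)),
    (forall m m', M m -> M m' -> adj (W m') *o W m = pi (m' *o adj m)) /\
    range_spanning M W.
Proof.
move=> Aalg sM AM pir; have [[cA A0 AP] Amul Aadj] := Aalg; have [pil pim pia] := pir.
have [M0 MP AMM MA] := AM.
pose S := ({m : 'B(H, K) | M m} * L)%type.
pose k (s t : S) : R[i] := hdot (pi (sval t.1 *o adj (sval s.1)) s.2) t.2.
have kh s t : k s t = (k t s)^*.
  rewrite /k -hdotC -adjP' -pia; last by apply: MA; exact: svalP.
  by rewrite adj_comp adjK.
have kp l : 0 <= complex.Re (kform k l l).
  case: l => [|p0 l0]; first by rewrite /kform big_nil.
  set l := p0 :: l0; pose N := size l; pose p i := nth p0 l i.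
  have [F [V Vf]] := frame_exists K N; have [F' [V' V'f]] := frame_exists L N.
  pose m (i : 'I_N) := sval (p i).2.1.
  pose j0 (i : 'I_N) : 'I_1 := ord0.
  pose c := column (fun _ : 'I_1 => op_id H) V j0 m.
  pose z (i : 'I_N) := (p i).1 *: (p i).2.2.
  have cM : ampset (fun _ : 'I_1 => op_id H) V M c.
    apply: column_ampset => //; first exact: frame_id.
    by move=> i; exact: svalP.
  have [_ _ _ cA'] := ampset_left_module (frame_id H) Vf sM Aalg AM.
  have := star_rep_pos (ampset_star_algebra Vf Aalg) (amp_star_rep Vf V'f Aalg pir)
    (cA' _ _ cM cM) _ (lexx 0).
  rewrite adj_comp adjK => /(_ erefl) H1.
  have {H1} : 0 <= 0 * rnorm (\sum_i V' i (z i)) ^+ 2 +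
      complex.Re (hdot (amp V V V' V' pi (c *o adj c) (\sum_i V' i (z i))) (\sum_i V' i (z i))).
    by apply: H1 => x; rewrite mul0r add0r op_compE adjP -rnorm_sqr sqr_ge0.
  rewrite mul0r add0r; congr (_ <= complex.Re _).
  rewrite sandwich_sum /kform (big_nth p0) big_mkord; apply: eq_bigr => i _.
  rewrite (big_nth p0) big_mkord; apply: eq_bigr => j _.
  rewrite amp_entry//.
  have -> : adj (V j) *o (c *o adj c) *o V i =
      (adj (V j) *o c) *o adj (adj (V i) *o c) by rewrite adj_comp adjK !op_compA.
  rewrite !column_entry// adj_id !op_comp1r /z op_linZ hdotZl hdotZr mulrA.
  by rewrite /k.
have [E [d [dE /spanningP dS]]] := kolmogorov kh kp.
have exW m : exists W : 'B(L, E), forall (Mm : M m) x, W x = d (exist _ m Mm, x).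
  have [Mm|nM] := pselect (M m); last by exists 0.
  (* The squared norm of the tensor of [m^*] and [x] is [hdot (pi (m *o adj m) x) x], whence the
     constant. *)
  have [|x|W WE] := @bounded_linear_op _ L E (fun x => d (exist _ m Mm, x))
      (Num.sqrt (opnorm (pi (m *o adj m)))).
  - move=> c x y; apply/eqP; rewrite -subr_eq0; apply/eqP; apply: dS => _ [t _ <-].
    rewrite hdotC hdotBl hdotDl hdotZl !dE /k /= op_linD op_linZ hdotDl hdotZl.
    by rewrite subrr conjC0.
  - rewrite -(@ler_pXn2r _ 2)// ?nnegrE ?mulr_ge0 ?rnorm_ge0 ?sqrtr_ge0//.
    rewrite exprMn sqr_sqrtr ?opnorm_ge0// rnorm_sqr dE /k /=.
    by rewrite (le_trans (ler_norm _))// Re_hdot_le.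
  by exists W => Mm' x; rewrite WE (Prop_irrelevance Mm Mm').
have [W WE] := boolp.choice exW.
exists E, W; split=> [m m' Mm Mm'|v vW].
  apply: op_eq_hdot => x y; rewrite op_compE adjP' (WE _ Mm) (WE _ Mm').
  by rewrite dE.
by apply: dS => _ [[[m Mm] x] _ <-]; rewrite -WE; exact: vW.
Qed.

(* The operator transferred from [y] is [m^* (x) z |-> (y m^* ) (x) z] on the
   interior tensor products, here through its matrix of scalar products. *)
Lemma transfer_amp_bound H1 H2 K1 K2 L1 L2 E1 E2 G1 G2 G1' G2' k
    (A : set 'B(K2, K2)) (X : set 'B(K1, K2)) (B : set 'B(K1, K1)) pi phi sigma
    (Y : set 'B(H1, H2)) (M1 : set 'B(H1, K1)) (M2 : set 'B(H2, K2))
    (W1 : 'B(H1, K1) -> 'B(L1, E1)) (W2 : 'B(H2, K2) -> 'B(L2, E2))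
    (U1 : 'I_k -> 'B(H1, G1)) (U2 : 'I_k -> 'B(H2, G2))
    (U1' : 'I_k -> 'B(E1, G1')) (U2' : 'I_k -> 'B(E2, G2')) (y : 'B(G1, G2)) (C : R) :
  bimodule_rep A X B pi phi sigma -> operator_space M1 -> operator_space M2 ->
  left_module A M2 -> left_module B M1 ->
  0 <= C ->
  (forall N F1 F2 F1' F2' (V1 : 'I_N -> 'B(K1, F1)) (V2 : 'I_N -> 'B(K2, F2))
    (V1' : 'I_N -> 'B(L1, F1')) (V2' : 'I_N -> 'B(L2, F2')) e f,
    frame V1 -> frame V2 -> frame V1' -> frame V2' ->
    ampset U2 V2 M2 e -> ampset U1 V1 M1 f -> opnorm e <= 1 -> opnorm f <= 1 ->
    ampset V1 V2 X (e *o y *o adj f) ->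
    opnorm (amp V1 V2 V1' V2' phi (e *o y *o adj f)) <= C) ->
  (forall m m', M1 m -> M1 m' -> adj (W1 m') *o W1 m = sigma (m' *o adj m)) ->
  (forall m m', M2 m -> M2 m' -> adj (W2 m') *o W2 m = pi (m' *o adj m)) ->
  (forall e y f, M2 e -> Y y -> M1 f -> X (e *o y *o adj f)) ->
  frame U1 -> frame U2 -> frame U1' -> frame U2' -> ampset U1 U2 Y y ->
  exists T : 'B(G1', G2'), [/\ opnorm T <= C,
    forall i j n m, M2 n -> M1 m ->
      adj (W2 n) *o (adj (U2' i) *o T *o U1' j) *o W1 m =
      phi (n *o (adj (U2 i) *o y *o U1 j) *o adj m),
    forall x, (forall j m z, M1 m -> hdot (U1' j (W1 m z)) x = 0) -> T x = 0 &
    forall v, (forall i n t, M2 n -> hdot (U2' i (W2 n t)) v = 0) -> adj T v = 0].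
Proof.
move=> rep sM1 sM2 AM2 BM1 C0 phiC W1E W2E YX U1f U2f U1'f U2'f Yy.
pose I1 := ('I_k * {m : 'B(H1, K1) | M1 m} * L1)%type.
pose I2 := ('I_k * {m : 'B(H2, K2) | M2 m} * L2)%type.
pose f1 (p : I1) := U1' p.1.1 (W1 (sval p.1.2) p.2).
pose f2 (p : I2) := U2' p.1.1 (W2 (sval p.1.2) p.2).
pose q (s : I1) (t : I2) : R[i] :=
  hdot (phi (sval t.1.2 *o (adj (U2 t.1.1) *o y *o U1 s.1.1) *o adj (sval s.1.2)) s.2) t.2.
have [|l m|T [TE TC T0 Ts]] := @form_op _ G1' G2' I1 I2 f1 f2 q C.
- exact: C0.
- case: l => [|p0 l0].
    by rewrite big_nil cabs0 !mulr_ge0 ?C0 ?rnorm_ge0.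
  case: m => [|q0 m0].
    by rewrite big1 ?cabs0 ?mulr_ge0 ?C0 ?rnorm_ge0// => ? _; rewrite big_nil.
  (* Both columns must have the same number [N] of rows; the shorter list is padded with its first
     tensor, taken with coefficient 0. *)
  set l := p0 :: l0; set m := q0 :: m0; pose N := maxn (size l) (size m).
  pose dl := (0 : R[i], p0.2); pose dm := (0 : R[i], q0.2).
  pose p (i : 'I_N) := nth dl l i; pose r (i : 'I_N) := nth dm m i.
  have := @amp_cs _ _ _ _ _ _ _ _ _ _ _ _ _ k N A X B pi phi sigma M1 M2 W1 W2
    U1 U2 U1' U2' y C
    (fun a => sval (p a).2.1.2) (fun a => sval (r a).2.1.2)
    (fun a => (p a).2.1.1) (fun a => (r a).2.1.1)
    (fun a => (p a).1 *: (p a).2.2) (fun a => (r a).1 *: (r a).2.2)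
    rep sM1 sM2 AM2 BM1 U1f U2f U1'f U2'f W1E W2E.
  have yX e f i j : M2 e -> M1 f -> X (e *o (adj (U2 i) *o y *o U1 j) *o adj f).
    by move=> Me Mf; apply: YX => //; exact: Yy.
  move=> /(_ yX C0 (phiC N)).
  move=> /(_ (fun a => svalP _) (fun a => svalP _)).
  have -> : \sum_a U1' (p a).2.1.1 (W1 (sval (p a).2.1.2) ((p a).1 *: (p a).2.2)) = lincomb f1 l.
    rewrite /lincomb (@big_nth_pad _ _ _ dl l N) ?leq_maxl//; last by rewrite scale0r.
    by apply: eq_bigr => a _; rewrite !op_linZ.
  have -> : \sum_a U2' (r a).2.1.1 (W2 (sval (r a).2.1.2) ((r a).1 *: (r a).2.2)) = lincomb f2 m.
    rewrite /lincomb (@big_nth_pad _ _ _ dm m N) ?leq_maxr//; last by rewrite scale0r.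
    by apply: eq_bigr => a _; rewrite !op_linZ.
  congr (cabs _ <= _).
  rewrite (@big_nth_pad _ _ _ dl l N) ?leq_maxl//; last first.
    by rewrite big1// => b _; rewrite !mul0r.
  apply: eq_bigr => a _.
  rewrite (@big_nth_pad _ _ _ dm m N) ?leq_maxr//; last by rewrite conjC0 mulr0 mul0r.
  by apply: eq_bigr => b _; rewrite op_linZ hdotZl hdotZr mulrA.
exists T; split => // [i j n m Mn Mm|x xP|v vP].
- apply: op_eq_hdot => z t.
  have := TE (j, exist _ m Mm, z) (i, exist _ n Mn, t).
  by rewrite /q /f1 /f2 /= => <-; rewrite -!adjP'.
- by apply: T0 => -[[j [m Mm]] z]; exact: xP.
- apply: eq_hdotr => x; rewrite -adjP hdot0r.
  by apply: closed_span_orth (Ts x) => _ [[[i [n Mn]] t] _ <-]; exact: vP.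
Qed.

(** Complete contractivity enters here: for contractive matrices [e] and [f] of any size, the
    amplified [phi] at [e y f^*] has norm at most [|e y f^*| <= |y|], so [|y|] is an admissible
    constant. *)
Lemma transfer_amp H1 H2 K1 K2 L1 L2 E1 E2 G1 G2 G1' G2' k
    (A : set 'B(K2, K2)) (X : set 'B(K1, K2)) (B : set 'B(K1, K1)) pi phi sigma
    (Y : set 'B(H1, H2)) (M1 : set 'B(H1, K1)) (M2 : set 'B(H2, K2))
    (W1 : 'B(H1, K1) -> 'B(L1, E1)) (W2 : 'B(H2, K2) -> 'B(L2, E2))
    (U1 : 'I_k -> 'B(H1, G1)) (U2 : 'I_k -> 'B(H2, G2))
    (U1' : 'I_k -> 'B(E1, G1')) (U2' : 'I_k -> 'B(E2, G2')) (y : 'B(G1, G2)) :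
  bimodule_rep A X B pi phi sigma -> operator_space M1 -> operator_space M2 ->
  left_module A M2 -> left_module B M1 ->
  completely_contractive X phi ->
  (forall m m', M1 m -> M1 m' -> adj (W1 m') *o W1 m = sigma (m' *o adj m)) ->
  (forall m m', M2 m -> M2 m' -> adj (W2 m') *o W2 m = pi (m' *o adj m)) ->
  (forall e y f, M2 e -> Y y -> M1 f -> X (e *o y *o adj f)) ->
  frame U1 -> frame U2 -> frame U1' -> frame U2' -> ampset U1 U2 Y y ->
  exists T : 'B(G1', G2'), opnorm T <= opnorm y /\
    forall i j n m, M2 n -> M1 m ->
      adj (W2 n) *o (adj (U2' i) *o T *o U1' j) *o W1 m =
      phi (n *o (adj (U2 i) *o y *o U1 j) *o adj m).
Proof.
move=> rep sM1 sM2 AM2 BM1 phicc W1E W2E YX U1f U2f U1'f U2'f Yy.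
have [|T [TC TE _ _]] := transfer_amp_bound rep sM1 sM2 AM2 BM1 (opnorm_ge0 y) _
  W1E W2E YX U1f U2f U1'f U2'f Yy; last by exists T.
move=> N F1 F2 F1' F2' V1 V2 V1' V2' e f V1f V2f V1'f V2'f _ _ e1 f1 Xx.
rewrite (le_trans (completely_contractive_amp V1f V2f V1'f V2'f phicc Xx))//.
rewrite (le_trans (opnorm_comp _ _))// opnorm_adj.
rewrite (le_trans (ler_wpM2r (opnorm_ge0 _) (opnorm_comp _ _)))//.
rewrite mulrAC ler_piMl ?opnorm_ge0//.
by rewrite -[leRHS]mulr1 ler_pM ?opnorm_ge0.
Qed.

End Dilation.

(** * The transferred bimodule map *)

Section Transfer.
Variables (R : realType) (H1 H2 K1 K2 L1 L2 E1 E2 : hilbertType R).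
Variables (X : set 'B(K1, K2)) (Y : set 'B(H1, H2)).
Variables (M1 : set 'B(H1, K1)) (M2 : set 'B(H2, K2)).
Variables (A : set 'B(K2, K2)) (B : set 'B(K1, K1)).
Variables (pi : 'B(K2, K2) -> 'B(L2, L2)) (phi : 'B(K1, K2) -> 'B(L1, L2))
  (sigma : 'B(K1, K1) -> 'B(L1, L1)).
Variables (W1 : 'B(H1, K1) -> 'B(L1, E1)) (W2 : 'B(H2, K2) -> 'B(L2, E2)).
Hypotheses (rep : bimodule_rep A X B pi phi sigma)
  (sM1 : operator_space M1) (sM2 : operator_space M2) (sY : operator_space Y)
  (AM2 : left_module A M2) (BM1 : left_module B M1)
  (phicc : completely_contractive X phi)
  (W1E : forall m m', M1 m -> M1 m' -> adj (W1 m') *o W1 m = sigma (m' *o adj m))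
  (W2E : forall m m', M2 m -> M2 m' -> adj (W2 m') *o W2 m = pi (m' *o adj m))
  (W1s : range_spanning M1 W1) (W2s : range_spanning M2 W2)
  (YX : forall e y f, M2 e -> Y y -> M1 f -> X (e *o y *o adj f))
  (XY : forall e x f, M2 e -> X x -> M1 f -> Y (adj e *o x *o f)).

(** With [rho_i = adj W_i] this is one of the two intertwining identities. By the spanning
    hypotheses it determines [psi] on [Y], and it implies the other identity in [transfer_dual]. *)
Definition transfers (psi : 'B(H1, H2) -> 'B(E1, E2)) : Prop :=
  forall n y m, M2 n -> Y y -> M1 m ->
    adj (W2 n) *o psi y *o W1 m = phi (n *o y *o adj m).

Lemma transfer_exists : exists psi, transfers psi.
Proof.
have ex y : exists T, Y y -> forall n m, M2 n -> M1 m ->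
    adj (W2 n) *o T *o W1 m = phi (n *o y *o adj m).
  have [Yy|nY] := pselect (Y y); last by exists 0.
  have Yy' : ampset (fun _ : 'I_1 => op_id H1) (fun _ : 'I_1 => op_id H2) Y y.
    by move=> i j; rewrite adj_id op_comp1l op_comp1r.
  have [T [_ TE]] := transfer_amp rep sM1 sM2 AM2 BM1 phicc W1E W2E YX
    (frame_id H1) (frame_id H2) (frame_id E1) (frame_id E2) Yy'.
  exists T => _ n m Mn Mm; have := TE ord0 ord0 n m Mn Mm.
  by rewrite !adj_id !op_comp1l !op_comp1r.
have [psi psiE] := boolp.choice ex.
by exists psi => n y m Mn Yy Mm; exact: psiE.
Qed.

Variable psi : 'B(H1, H2) -> 'B(E1, E2).
Hypothesis psiE : transfers psi.

Lemma transfer_linear : linear_on Y psi.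
Proof.
have [[_ _ _ _ _] [_ _ phil _ _]] := rep; have [_ _ YP] := sY.
move=> c x y Yx Yy; apply: (range_spanning_ext W1s W2s) => n m Mn Mm.
rewrite (psiE Mn (YP c _ _ Yx Yy) Mm).
rewrite !op_compDr !op_compDl !op_compZr !op_compZl (psiE Mn Yx Mm) (psiE Mn Yy Mm).
by rewrite phil//; exact: YX.
Qed.

(** The operator built for a whole matrix obeys the norm bound, and its entries satisfy the
    identities that determine [psi]; so it is the amplification of [psi] at that matrix. *)
Lemma transfer_cc : completely_contractive Y psi.
Proof.
split=> [|k x Yx]; first exact: transfer_linear.
have [G1 [U1 U1f]] := frame_exists H1 k; have [G2 [U2 U2f]] := frame_exists H2 k.
have [G1' [U1' U1'f]] := frame_exists E1 k; have [G2' [U2' U2'f]] := frame_exists E2 k.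
rewrite (mx_opnorm_amp psi x U1f U2f U1'f U2'f) (mx_opnorm_op x U1f U2f).
have Yx' := mx_op_ampset U1f U2f Yx.
have [T [TC TE]] := transfer_amp rep sM1 sM2 AM2 BM1 phicc W1E W2E YX
    U1f U2f U1'f U2'f Yx'.
suff <- : T = amp U1 U2 U1' U2' psi (mx_op U1 U2 x) by [].
apply: (frame_ext U1'f U2'f) => i j; rewrite amp_entry//.
apply: (range_spanning_ext W1s W2s) => n m Mn Mm.
by rewrite TE// psiE.
Qed.

(** Compressed by further elements [n'] and [m'], both sides become [phi] at
    [(n' n^* ) x (m m'^* )]. The outer factors lie in [A] and [B], and [pi (n' n^* )] is the product
    of [adj (W2 n')] and [W2 n]. *)
Lemma transfer_dual n x m : M2 n -> X x -> M1 m ->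
  psi (adj n *o x *o m) = W2 n *o phi x *o adj (W1 m).
Proof.
move=> Mn Xx Mm; apply: (range_spanning_ext W1s W2s) => n' m' Mn' Mm'.
have [[_ _ _ AX XB] [_ _ _ phia phib]] := rep.
have [_ _ _ MA] := AM2; have [_ _ _ MB] := BM1.
rewrite psiE//; last exact: XY.
have -> : n' *o (adj n *o x *o m) *o adj m' = (n' *o adj n) *o (x *o (m *o adj m')).
  by rewrite !op_compA.
rewrite phia ?phib//; [|exact: MB|exact: MA|apply: XB => //; exact: MB].
by rewrite -W2E// -W1E// !op_compA.
Qed.

End Transfer.

(** * Representations of TRO's and related triples *)

Section TroRepresentation.
Variables (R : realType).
Implicit Types (H K L E : hilbertType R).

Definition lalg H K (M : set 'B(H, K)) := closed_span (M `*o M^*o).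
Definition ralg H K (M : set 'B(H, K)) := closed_span (M^*o `*o M).

Lemma lalg_adj H K (M : set 'B(H, K)) : lalg M^*o = ralg M.
Proof. by rewrite /lalg /ralg adj_setK. Qed.

Lemma ralg_adj H K (M : set 'B(H, K)) : ralg M^*o = lalg M.
Proof. by rewrite /lalg /ralg adj_setK. Qed.

(** Representations are contractive, so orthogonality to the images of the generators [p q^*]
    extends to the closed span [lalg M]. *)
Lemma nondegenerate_orth H K L (M : set 'B(H, K)) (pi : 'B(K, K) -> 'B(L, L)) w :
  TRO M -> star_representation (lalg M) pi -> star_nondegenerate (lalg M) pi ->
  (forall p q, M p -> M q -> forall z, hdot (pi (p *o adj q) z) w = 0) -> w = 0.
Proof.
move=> tM pir /spanningP pin piw; apply: pin => _ [a Aa [z _ <-]].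
have Aalg := TRO_star_algebra tM; have [[cA A0 AP] _ _] := Aalg; have [pil _ _] := pir.
pose P := [set a | lalg M a /\ hdot (pi a z) w = 0].
suff [] : P a by [].
apply: (@closed_span_min _ _ (M `*o M^*o) P) Aa => //.
- by split => //; rewrite (linear_on0 A0 pil) op0E hdot0l.
- move=> c x y [Ax xw] [Ay yw]; split; first exact: AP.
  by rewrite pil// opDE opZE hdotDl hdotZl xw yw mulr0 addr0.
- apply/closed_rnorm => x xP.
  have Ax : lalg M x by move/closed_rnorm: cA; apply => e /xP[y [Ay _] xy]; exists y.
  split => //; apply: cabs_eq0; apply/eqP.
  rewrite eq_le cabs_ge0 andbT; apply/ler_addgt0Pr => e e0; rewrite add0r.
  pose D := rnorm z * rnorm w + 1.
  have D0 : 0 < D by rewrite ltr_wpDl// mulr_ge0 ?rnorm_ge0.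
  have [y [Ay yw] xy] := xP _ (divr_gt0 e0 D0).
  rewrite -[hdot _ _]subr0 -yw -hdotBl -opBE -(linear_onB A0 AP pil)//.
  rewrite (le_trans (cauchy_schwarz _ _))//.
  rewrite (le_trans (ler_wpM2r (rnorm_ge0 _) (rnorm_opE _ _)))// -mulrA.
  have pC : opnorm (pi (x - y)) <= e / D.
    rewrite (le_trans (star_rep_contractive Aalg pir _))//; last exact: ltW.
    exact: (lin_closedB A0 AP).
  rewrite (@le_trans _ _ (e / D * (rnorm z * rnorm w)))//.
    by rewrite ler_wpM2r// mulr_ge0 ?rnorm_ge0.
  by rewrite -mulrA ler_piMr ?(ltW e0)// mulrC ler_pdivrMr// mul1r lerDl.
- move=> _ [p Mp [_ [q Mq <-] <-]]; split; first exact: left_algebra_gen.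
  exact: piw.
Qed.

(** [M] on both sides links [lalg M] and [ralg M] as [M1] and [M2] link [X] and [Y], so [pi] itself
    is transferred as a bimodule map. Multiplicativity comes from the action of [c] on tensors,
    which replaces [m^*] by [c m^*]. *)
Lemma algebra_transfer H K L E (M : set 'B(H, K)) (pi : 'B(K, K) -> 'B(L, L))
    (W : 'B(H, K) -> 'B(L, E)) :
  TRO M -> star_representation (lalg M) pi ->
  (forall m m', M m -> M m' -> adj (W m') *o W m = pi (m' *o adj m)) ->
  range_spanning M W ->
  exists pi', [/\ transfers (ralg M) M M pi W W pi',
    star_representation (ralg M) pi',
    forall m n, M m -> M n -> pi' (adj m *o n) = W m *o adj (W n),
    forall m c, M m -> ralg M c -> pi' c *o W m = W (m *o adj c) &
    forall n a m, M n -> lalg M a -> M m ->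
      pi' (adj n *o a *o m) = W n *o pi a *o adj (W m)].
Proof.
move=> tM pir WE Ws; have [sM _] := tM; have [pil pim pia] := pir.
have Aalg := TRO_star_algebra tM; have [sA AM Aa] := Aalg.
have [sC CM Ca] := TRO_star_algebra_right tM.
have lM := TRO_left_module tM.
have rep : bimodule_rep (lalg M) (lalg M) (lalg M) pi pi pi by [].
have MAM e a f : M e -> ralg M a -> M f -> lalg M (e *o a *o adj f).
  by move=> Me Ra Mf; apply: left_algebra_gen => //; exact: TRO_right_module.
have MAM' e a f : M e -> lalg M a -> M f -> ralg M (adj e *o a *o f).
  move=> Me La Mf; rewrite -op_compA; apply: right_algebra_gen => //.
  by have [_ _ + _] := lM; exact.
have pcc := star_rep_cc Aalg pir.
have [pi' pi'E] := transfer_exists rep sM sM lM lM pcc WE WE MAM.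
have pi'W m c : M m -> ralg M c -> pi' c *o W m = W (m *o adj c).
  move=> Mm Rc; have Mmc : M (m *o adj c) by apply: TRO_right_module => //; exact: Ca.
  apply: opP => x; apply/eqP; rewrite -subr_eq0; apply/eqP; apply: Ws => n y Mn.
  rewrite hdotC -adjP'.
  have := congr1 (fun Z : 'B(L, L) => Z x) (pi'E _ _ _ Mn Rc Mm).
  rewrite !op_compE op_linB => ->.
  rewrite -[adj (W n) (W _ x)]op_compE WE// adj_comp adjK op_compA subrr hdot0l.
  by rewrite conjC0.
have pi'D m n : M m -> M n -> pi' (adj m *o n) = W m *o adj (W n).
  move=> Mm Mn; apply: (range_spanning_ext Ws Ws) => n' m' Mn' Mm'.
  rewrite pi'E//; last exact: right_algebra_gen.
  have -> : n' *o (adj m *o n) *o adj m' = (n' *o adj m) *o (n *o adj m').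
    by rewrite !op_compA.
  rewrite pim; [|exact: left_algebra_gen|exact: left_algebra_gen].
  by rewrite -!WE// !op_compA.
exists pi'; split => //; last exact: (transfer_dual rep lM lM WE WE Ws Ws MAM' pi'E).
split.
- exact: (transfer_linear rep sC Ws Ws MAM pi'E).
- move=> c d Rc Rd; apply: (range_spanning_ext Ws Ws) => n m Mn Mm.
  have Mmd : M (m *o adj d) by apply: TRO_right_module => //; exact: Ca.
  rewrite pi'E//; last exact: CM.
  rewrite -(op_compA (adj (W n))) -(op_compA (pi' c)) pi'W// [RHS]op_compA.
  by rewrite pi'E// adj_comp adjK !op_compA.
- move=> c Rc; apply: (range_spanning_ext Ws Ws) => n m Mn Mm.
  rewrite pi'E//; last exact: Ca.
  have -> : adj (W n) *o adj (pi' c) *o W m = adj (adj (W m) *o pi' c *o W n).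
    by rewrite !adj_comp adjK op_compA.
  rewrite pi'E// -pia; last exact: MAM.
  by rewrite !adj_comp adjK op_compA.
Qed.

(* [(pi, rho, rho^*, pi')] is a representation of the linking algebra of [M]. *)
Definition tro_rep H K L E (M : set 'B(H, K)) (pi : 'B(K, K) -> 'B(L, L))
    (pi' : 'B(H, H) -> 'B(E, E)) (rho : 'B(H, K) -> 'B(E, L)) : Prop :=
  (forall m n, M m -> M n -> rho m *o adj (rho n) = pi (m *o adj n)) /\
  (forall m n, M m -> M n -> adj (rho m) *o rho n = pi' (adj m *o n)).

Definition intertwined H1 H2 K1 K2 L1 L2 E1 E2
    (M1 : set 'B(H1, K1)) (M2 : set 'B(H2, K2)) (X : set 'B(K1, K2)) (Y : set 'B(H1, H2))
    (rho1 : 'B(H1, K1) -> 'B(E1, L1)) (rho2 : 'B(H2, K2) -> 'B(E2, L2))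
    (phi : 'B(K1, K2) -> 'B(L1, L2)) (psi : 'B(H1, H2) -> 'B(E1, E2)) : Prop :=
  (forall n y m, M2 n -> Y y -> M1 m ->
    phi (n *o y *o adj m) = rho2 n *o psi y *o adj (rho1 m)) /\
  (forall n x m, M2 n -> X x -> M1 m ->
    psi (adj n *o x *o m) = adj (rho2 n) *o phi x *o rho1 m).

(** A relation and not a map, since tensor products are fixed only up to unitary equivalence; it is
    symmetric under passage to the adjoint TRO's. The last two clauses compare the representations
    on whole algebras and not just on products of two elements of the TRO's. *)
Definition related H1 H2 K1 K2 (X : set 'B(K1, K2)) (Y : set 'B(H1, H2))
    (M1 : set 'B(H1, K1)) (M2 : set 'B(H2, K2))
    (r : bimodule_triple K1 K2) (s : bimodule_triple H1 H2) : Prop :=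
  exists rho1 : 'B(H1, K1) -> 'B(bm_dom s, bm_dom r),
  exists rho2 : 'B(H2, K2) -> 'B(bm_cod s, bm_cod r),
  [/\ tro_rep M1 (bm_right r) (bm_right s) rho1,
      tro_rep M2 (bm_left r) (bm_left s) rho2,
      intertwined M1 M2 X Y rho1 rho2 (bm_map r) (bm_map s),
      intertwined M2 M2 (lalg M2) (ralg M2) rho2 rho2 (bm_left r) (bm_left s) &
      intertwined M1 M1 (lalg M1) (ralg M1) rho1 rho1 (bm_right r) (bm_right s)].

Definition tro_transfer H1 H2 K1 K2 (X : set 'B(K1, K2)) (Y : set 'B(H1, H2))
    (M1 : set 'B(H1, K1)) (M2 : set 'B(H2, K2)) : Prop :=
  [/\ operator_space X, operator_space Y & strongly_TRO_equiv X Y M1 M2].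

(** Adjoint TRO's exchange the roles of [X] and [Y], so later results apply in both directions. *)
Lemma tro_transfer_sym H1 H2 K1 K2 (X : set 'B(K1, K2)) (Y : set 'B(H1, H2))
    (M1 : set 'B(H1, K1)) (M2 : set 'B(H2, K2)) :
  tro_transfer X Y M1 M2 -> tro_transfer Y X M1^*o M2^*o.
Proof.
by move=> [sX sY [t1 t2 XE YE]]; split => //; split; rewrite ?adj_setK//; exact: TRO_adj.
Qed.

Section Bimodule.
Variables (H1 H2 K1 K2 : hilbertType R).
Variables (X : set 'B(K1, K2)) (Y : set 'B(H1, H2)).
Variables (M1 : set 'B(H1, K1)) (M2 : set 'B(H2, K2)).
Hypothesis XYM : tro_transfer X Y M1 M2.

Let tM1 : TRO M1. Proof. by case: XYM => _ _ []. Qed.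
Let tM2 : TRO M2. Proof. by case: XYM => _ _ []. Qed.
Let sX : operator_space X. Proof. by case: XYM. Qed.
Let sY : operator_space Y. Proof. by case: XYM. Qed.

Lemma tro_transfer_MYM n y m : M2 n -> Y y -> M1 m -> X (n *o y *o adj m).
Proof.
case: XYM => _ _ [_ _ -> _] Mn Yy Mm; apply: sub_closed_span.
exists (n *o y); first by exists n => //; exists y.
by exists (adj m) => //; exists m.
Qed.

Lemma tro_transfer_MXM n x m : M2 n -> X x -> M1 m -> Y (adj n *o x *o m).
Proof.
case: XYM => _ _ [_ _ _ ->] Mn Xx Mm; apply: sub_closed_span.
exists (adj n *o x); first by exists (adj n); [exists n|exists x].
by exists m.
Qed.

Lemma lalg_mul a x : lalg M2 a -> X x -> X (a *o x).
Proof.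
move=> Aa; case: (XYM) => _ _ [_ _ XE _]; rewrite {1}XE.
apply: closed_span_compr => // _ [_ [n Mn [y Yy <-]] [_ [m Mm <-] <-]].
rewrite !op_compA; apply: tro_transfer_MYM => //.
by have [_ _ + _] := TRO_left_module tM2; exact.
Qed.

Lemma mul_lalg x b : X x -> lalg M1 b -> X (x *o b).
Proof.
move=> Xx Bb; move: Xx; case: (XYM) => _ _ [_ _ XE _]; rewrite {1}XE.
apply: closed_span_compl => // _ [_ [n Mn [y Yy <-]] [_ [m Mm <-] <-]].
have -> : n *o y *o adj m *o b = n *o y *o adj (adj b *o m).
  by rewrite adj_comp adjK !op_compA.
apply: tro_transfer_MYM => //; have [_ _ + _] := TRO_left_module tM1; apply => //.
by have [_ _ +] := TRO_star_algebra tM1; exact.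
Qed.

End Bimodule.

Section Existence.
Variables (H1 H2 K1 K2 : hilbertType R).
Variables (X : set 'B(K1, K2)) (Y : set 'B(H1, H2)).
Variables (M1 : set 'B(H1, K1)) (M2 : set 'B(H2, K2)).
Hypothesis XYM : tro_transfer X Y M1 M2.

Let tM1 : TRO M1. Proof. by case: XYM => _ _ []. Qed.
Let tM2 : TRO M2. Proof. by case: XYM => _ _ []. Qed.
Let sX : operator_space X. Proof. by case: XYM. Qed.
Let sY : operator_space Y. Proof. by case: XYM. Qed.

Lemma related_exists (r : bimodule_triple K1 K2) :
  cc_bimodule_map (lalg M2) X (lalg M1) r -> nondegenerate (lalg M2) X (lalg M1) r ->
  exists s : bimodule_triple H1 H2,
    [/\ cc_bimodule_map (ralg M2) Y (ralg M1) s,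
        nondegenerate (ralg M2) Y (ralg M1) s & related X Y M1 M2 r s].
Proof.
case: r => L1 L2 pi phi sigma [/= phicc [pir sigmar] phi3 phia phib].
move=> [/= pin [phin phin'] sigman].
have [sM1 _] := tM1; have [sM2 _] := tM2.
have Aalg := TRO_star_algebra tM2; have Balg := TRO_star_algebra tM1.
have lM1 := TRO_left_module tM1; have lM2 := TRO_left_module tM2.
have [E1 [W1 [W1E W1s]]] := dilation Balg sM1 lM1 sigmar.
have [E2 [W2 [W2E W2s]]] := dilation Aalg sM2 lM2 pir.
have [pi' [pi'E pi'r pi'D pi'W pi'D2]] := algebra_transfer tM2 pir W2E W2s.
have [sigma' [sigma'E sigma'r sigma'D sigma'W sigma'D2]] := algebra_transfer tM1 sigmar W1E W1s.
have rep : bimodule_rep (lalg M2) X (lalg M1) pi phi sigma.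
  split; split => //; [exact: (lalg_mul XYM)|exact: (mul_lalg XYM)|].
  by case: phicc.
have [psi psiE] := transfer_exists rep sM1 sM2 lM2 lM1 phicc W1E W2E (tro_transfer_MYM XYM).
have psiD := transfer_dual rep lM2 lM1 W1E W2E W1s W2s (tro_transfer_MXM XYM) psiE.
have psicc := transfer_cc rep sM1 sM2 sY lM2 lM1 phicc W1E W2E W1s W2s (tro_transfer_MYM XYM) psiE.
have YM := tro_transfer_sym XYM.
have CY c y : ralg M2 c -> Y y -> Y (c *o y).
  by rewrite -lalg_adj; exact: (lalg_mul YM).
have YD y d : Y y -> ralg M1 d -> Y (y *o d).
  by rewrite -lalg_adj; exact: (mul_lalg YM).
have [_ CM Ca] := TRO_star_algebra_right tM2.
have [_ DM Da] := TRO_star_algebra_right tM1.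
have pi'L n c : M2 n -> ralg M2 c -> adj (W2 n) *o pi' c = adj (W2 (n *o c)).
  move=> Mn Cc; have [_ _ pi'a] := pi'r.
  by rewrite -[LHS]adjK adj_comp adjK -pi'a// pi'W ?adjK//; exact: Ca.
have psiL c y : ralg M2 c -> Y y -> psi (c *o y) = pi' c *o psi y.
  move=> Cc Yy; apply: (range_spanning_ext W1s W2s) => n m Mn Mm.
  have Mnc : M2 (n *o c) by exact: TRO_right_module.
  rewrite psiE//; last exact: CY.
  by rewrite [X in X *o W1 m]op_compA pi'L// psiE// !op_compA.
have psiR y d : Y y -> ralg M1 d -> psi (y *o d) = psi y *o sigma' d.
  move=> Yy Dd; apply: (range_spanning_ext W1s W2s) => n m Mn Mm.
  have Mmd : M1 (m *o adj d) by apply: TRO_right_module => //; exact: Da.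
  rewrite psiE//; last exact: YD.
  rewrite -(op_compA (adj (W2 n))) -(op_compA (psi y)) sigma'W// [RHS]op_compA.
  by rewrite psiE// adj_comp adjK !op_compA.
have sigma_orth := nondegenerate_orth tM1 sigmar sigman.
have pi_orth := nondegenerate_orth tM2 pir pin.
exists (BimoduleTriple pi' psi sigma'); split.
- split => //= c y d Cc Yy Dd; rewrite psiR ?psiL//; exact: CY.
- split=> /=.
  (* For [v] orthogonal to the range of [pi'], non-degeneracy of [pi] gives [adj (W2 m) v = 0]: its
     product with [pi (p q^* ) z] is that of [v] with [pi' (m^* p) (W2 q z)]. *)
  + apply/spanningP => v vP; apply: W2s => m x Mm.
    rewrite adjP; suff -> : adj (W2 m) v = 0 by rewrite hdot0r.
    apply: pi_orth => p q Mp Mq z; rewrite -W2E// -adjP -!op_compE !op_compA.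
    rewrite -pi'D//; apply: vP.
    by exists (adj m *o p); [exact: right_algebra_gen|exists (W2 q z)].
  (* Two non-degeneracies are combined: testing against [sigma (p q^* ) z] turns values of [phi]
     into values of [psi], so [adj (W2 n) v] is orthogonal to the range of [phi], hence 0. The case
     of the adjoints is similar, with [pi]. *)
  + split; apply/spanningP => v vP.
      apply: W2s => n x Mn; rewrite adjP.
      suff -> : adj (W2 n) v = 0 by rewrite hdot0r.
      move/spanningP: phin; apply => _ [x' Xx' [xi _ <-]].
      rewrite adjP; suff -> : adj (phi x') (adj (W2 n) v) = 0 by rewrite hdot0r.
      apply: sigma_orth => p q Mp Mq z.
      rewrite -W1E// -!adjP -!op_compE !op_compA -psiD//; apply: vP.
      by exists (adj n *o x' *o p); [exact: (tro_transfer_MXM XYM)|exists (W1 q z)].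
    apply: W1s => m x Mm; rewrite adjP.
    suff -> : adj (W1 m) v = 0 by rewrite hdot0r.
    move/spanningP: phin'; apply => _ [x' Xx' [xi _ <-]].
    rewrite adjP'; suff -> : phi x' (adj (W1 m) v) = 0 by rewrite hdot0r.
    apply: pi_orth => p q Mp Mq z.
    rewrite -W2E// op_compE adjP'.
    have -> : W2 p (phi x' (adj (W1 m) v)) = psi (adj p *o x' *o m) v by rewrite psiD.
    rewrite -adjP'; apply: vP.
    by exists (adj p *o x' *o m); [exact: (tro_transfer_MXM XYM)|exists (W2 q z)].
  + apply/spanningP => v vP; apply: W1s => m x Mm.
    rewrite adjP; suff -> : adj (W1 m) v = 0 by rewrite hdot0r.
    apply: sigma_orth => p q Mp Mq z; rewrite -W1E// -adjP -!op_compE !op_compA.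
    rewrite -sigma'D//; apply: vP.
    by exists (adj m *o p); [exact: right_algebra_gen|exists (W1 q z)].
- exists (fun m => adj (W1 m)), (fun m => adj (W2 m)); split => /=.
  + split=> m n Mm Mn; first by rewrite adjK W1E.
    by rewrite adjK sigma'D.
  + split=> m n Mm Mn; first by rewrite adjK W2E.
    by rewrite adjK pi'D.
  + by split=> [n y m|n x m] Mn Xx Mm; rewrite adjK ?psiE// psiD.
  + by split=> [n y m|n x m] Mn Xx Mm; rewrite adjK ?pi'E// pi'D2.
  + by split=> [n y m|n x m] Mn Xx Mm; rewrite adjK ?sigma'E// sigma'D2.
Qed.

End Existence.

End TroRepresentation.

(** * Uniqueness up to unitary equivalence *)

Section Unitaries.
Variables (R : realType).
Implicit Types (H K L E : hilbertType R).

Lemma unitary_compl H K (U : 'B(H, K)) : unitary U -> adj U *o U = op_id H.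
Proof. by move=> [UK _]; apply: opP => x; rewrite op_compE UK. Qed.

Lemma unitary_compr H K (U : 'B(H, K)) : unitary U -> U *o adj U = op_id K.
Proof. by move=> [_ UK]; apply: opP => x; rewrite op_compE UK. Qed.

Lemma unitary_id H : unitary (op_id H).
Proof. by split=> x; rewrite adj_id. Qed.

Lemma unitary_adj H K (U : 'B(H, K)) : unitary U -> unitary (adj U).
Proof. by move=> [U1 U2]; split; rewrite adjK. Qed.

Lemma unitary_comp H K L (U : 'B(K, L)) (V : 'B(H, K)) :
  unitary U -> unitary V -> unitary (U *o V).
Proof.
move=> [U1 U2] [V1 V2]; split=> x; rewrite adj_comp !op_compE.
  by rewrite U1 V1.
by rewrite V2 U2.
Qed.

(** Equal Gram matrices give combinations of equal norm, so [f i |-> g i] and its converse both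
    extend with bound 1; the extensions are adjoint and inverse to each other. *)
Lemma gram_unitary E E' (I : Type) (f : I -> E) (g : I -> E') :
  spanning (range f) -> spanning (range g) ->
  (forall i j, hdot (f i) (f j) = hdot (g i) (g j)) ->
  exists2 U : 'B(E, E'), unitary U & forall i, U (f i) = g i.
Proof.
have half (D D' : hilbertType R) (h : I -> D) (k : I -> D') : spanning (range k) ->
    (forall i j, hdot (h i) (h j) = hdot (k i) (k j)) ->
    exists T : 'B(D, D'), forall i, T (h i) = k i.
  move=> sk hk.
  have hl l : rnorm (lincomb h l) = rnorm (lincomb k l).
    apply/eqP; rewrite -(@eqrXn2 _ 2) ?rnorm_ge0// !rnorm_sqr !hdot_suml.
    apply/eqP; congr complex.Re; apply: eq_bigr => p _; rewrite !hdot_sumr.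
    by apply: eq_bigr => q _; rewrite !hdotZl !hdotZr hk.
  have [||T [TE _ _ _]] := @form_op _ D D' I I h k (fun i j => hdot (k i) (k j)) 1.
  - exact: ler01.
  - move=> l m; rewrite mul1r hl (le_trans _ (cauchy_schwarz _ _))//.
    rewrite le_eqVlt; apply/orP; left; apply/eqP; congr cabs.
    rewrite hdot_suml; apply: eq_bigr => p _; rewrite hdot_sumr.
    by apply: eq_bigr => q _; rewrite hdotZl hdotZr mulrA.
  exists T => i; apply/eqP; rewrite -subr_eq0; apply/eqP.
  move/spanningP: sk; apply => _ [j _ <-].
  by rewrite hdotC hdotBl TE subrr conjC0.
move=> sf sg fg; have [U UE] := half _ _ f g sg fg.
have [V VE] := half _ _ g f sf (fun i j => esym (fg i j)).
have ext (D D' : hilbertType R) (h : I -> D) (T S : 'B(D, D')) : spanning (range h) ->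
    (forall i, T (h i) = S (h i)) -> T = S.
  move=> sh TS; apply: op_eq_hdot => x y; rewrite !adjP; congr (hdot _ _).
  apply/eqP; rewrite -subr_eq0; apply/eqP; move/spanningP: sh; apply => _ [i _ <-].
  by rewrite hdotBr -!adjP TS subrr.
have UV : V = adj U.
  apply: (ext _ _ g) => // i; apply/eqP; rewrite -subr_eq0; apply/eqP.
  move/spanningP: sf; apply => _ [j _ <-].
  by rewrite hdotBr VE -adjP UE fg subrr.
exists U => //; rewrite /unitary -UV; split => x.
  by rewrite -op_compE (ext _ _ f (V *o U) (op_id E))// => i; rewrite op_compE UE VE.
by rewrite -op_compE (ext _ _ g (U *o V) (op_id E'))// => i; rewrite op_compE VE UE.
Qed.

Section UnitaryEquivalence.
Variables (K1 K2 : hilbertType R).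
Variables (A : set 'B(K2, K2)) (X : set 'B(K1, K2)) (B : set 'B(K1, K1)).
Implicit Types r s t : bimodule_triple K1 K2.

Lemma unitarily_equivalent_refl r : unitarily_equivalent A X B r r.
Proof.
exists (op_id _), (op_id _); split; first by split; exact: unitary_id.
- by move=> a _; rewrite adj_id op_comp1l op_comp1r.
- by move=> a _; rewrite adj_id op_comp1l op_comp1r.
- by move=> a _; rewrite adj_id op_comp1l op_comp1r.
Qed.

Lemma unitarily_equivalent_sym r s :
  unitarily_equivalent A X B r s -> unitarily_equivalent A X B s r.
Proof.
move=> [V [U [[Vu Uu] pE fE sE]]]; exists (adj V), (adj U).
split; first by split; exact: unitary_adj.
- move=> a Aa; rewrite pE// adjK !op_compA unitary_compl// op_comp1l.
  by rewrite -op_compA unitary_compl// op_comp1r.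
- move=> a Aa; rewrite fE// adjK !op_compA unitary_compl// op_comp1l.
  by rewrite -op_compA unitary_compl// op_comp1r.
- move=> a Aa; rewrite sE// adjK !op_compA unitary_compl// op_comp1l.
  by rewrite -op_compA unitary_compl// op_comp1r.
Qed.

Lemma unitarily_equivalent_trans r s t :
  unitarily_equivalent A X B r s -> unitarily_equivalent A X B s t ->
  unitarily_equivalent A X B r t.
Proof.
move=> [V [U [[Vu Uu] pE fE sE]]] [V' [U' [[Vu' Uu'] pE' fE' sE']]].
exists (V' *o V), (U' *o U); split; first by split; exact: unitary_comp.
- by move=> a Aa; rewrite pE'// pE// adj_comp !op_compA.
- by move=> a Aa; rewrite fE'// fE// adj_comp !op_compA.
- by move=> a Aa; rewrite sE'// sE// adj_comp !op_compA.
Qed.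

End UnitaryEquivalence.
End Unitaries.

Section RelatedTriples.
Variables (R : realType) (H1 H2 K1 K2 : hilbertType R).
Variables (X : set 'B(K1, K2)) (Y : set 'B(H1, H2)).
Variables (M1 : set 'B(H1, K1)) (M2 : set 'B(H2, K2)).
Hypothesis XYM : tro_transfer X Y M1 M2.
Implicit Types (r : bimodule_triple K1 K2) (s : bimodule_triple H1 H2)
  (H K L E N G : hilbertType R).

Let tM1 : TRO M1. Proof. by case: XYM => _ _ []. Qed.
Let tM2 : TRO M2. Proof. by case: XYM => _ _ []. Qed.
Let sX : operator_space X. Proof. by case: XYM. Qed.
Let sY : operator_space Y. Proof. by case: XYM. Qed.

Lemma tro_rep_adj H K L E (M : set 'B(H, K)) (p : 'B(K, K) -> 'B(L, L))
    (p' : 'B(H, H) -> 'B(E, E)) (rho : 'B(H, K) -> 'B(E, L)) :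
  tro_rep M p p' rho -> tro_rep M^*o p' p (fun m => adj (rho (adj m))).
Proof.
by move=> [r1 r2]; split=> _ _ [m Mm <-] [n Mn <-]; rewrite !adjK ?r2 ?r1.
Qed.

Lemma intertwined_adj N1 N2 G1 G2 L1 L2 E1 E2 (P1 : set 'B(N1, G1)) (P2 : set 'B(N2, G2))
    (Z : set 'B(G1, G2)) (Z' : set 'B(N1, N2))
    (rho1 : 'B(N1, G1) -> 'B(E1, L1)) (rho2 : 'B(N2, G2) -> 'B(E2, L2)) phi psi :
  intertwined P1 P2 Z Z' rho1 rho2 phi psi ->
  intertwined P1^*o P2^*o Z' Z (fun m => adj (rho1 (adj m))) (fun m => adj (rho2 (adj m)))
    psi phi.
Proof.
move=> [i1 i2]; split=> _ x _ [n Pn <-] Zx [m Pm <-]; rewrite !adjK.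
  exact: i2.
exact: i1.
Qed.

Lemma related_sym r s : related X Y M1 M2 r s -> related Y X M1^*o M2^*o s r.
Proof.
move=> [rho1 [rho2 [t1 t2 i i2 i1]]].
exists (fun m => adj (rho1 (adj m))), (fun m => adj (rho2 (adj m))); split.
- exact: tro_rep_adj.
- exact: tro_rep_adj.
- exact: intertwined_adj.
- by rewrite lalg_adj ralg_adj; exact: intertwined_adj.
- by rewrite lalg_adj ralg_adj; exact: intertwined_adj.
Qed.

(** The maps [rho_i] are conjugated by the unitaries of both sides, so the relation descends to
    equivalence classes. *)
Lemma related_unitarily_equivalent r r' s s' :
  related X Y M1 M2 r s ->
  unitarily_equivalent (lalg M2) X (lalg M1) r r' ->
  unitarily_equivalent (ralg M2) Y (ralg M1) s s' ->
  related X Y M1 M2 r' s'.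
Proof.
move=> [rho1 [rho2 [[t1 t1'] [t2 t2'] [i i'] [i2 i2'] [i1 i1']]]].
move=> [V [U [[Vu Uu] pE fE sE]]] [V' [U' [[Vu' Uu'] pE' fE' sE']]].
exists (fun m => V *o rho1 m *o adj V'), (fun m => U *o rho2 m *o adj U').
split; split.
- move=> m n Mm Mn; rewrite !adj_comp adjK !op_compA -(op_compA _ (adj V') V').
  rewrite unitary_compl// op_comp1r sE; last exact: left_algebra_gen.
  by rewrite -t1// !op_compA.
- move=> m n Mm Mn; rewrite !adj_comp adjK !op_compA -(op_compA _ (adj V) V).
  rewrite unitary_compl// op_comp1r sE'; last exact: right_algebra_gen.
  by rewrite -t1'// !op_compA.
- move=> m n Mm Mn; rewrite !adj_comp adjK !op_compA -(op_compA _ (adj U') U').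
  rewrite unitary_compl// op_comp1r pE; last exact: left_algebra_gen.
  by rewrite -t2// !op_compA.
- move=> m n Mm Mn; rewrite !adj_comp adjK !op_compA -(op_compA _ (adj U) U).
  rewrite unitary_compl// op_comp1r pE'; last exact: right_algebra_gen.
  by rewrite -t2'// !op_compA.
- move=> n y m Mn Yy Mm; rewrite fE; last exact: (tro_transfer_MYM XYM).
  rewrite fE'// i// !adj_comp adjK !op_compA.
  rewrite -(op_compA _ (adj U') U') unitary_compl// op_comp1r.
  by rewrite -(op_compA _ (adj V') V') unitary_compl// op_comp1r.
- move=> n x m Mn Xx Mm; rewrite fE'; last exact: (tro_transfer_MXM XYM).
  rewrite fE// i'// !adj_comp adjK !op_compA.
  rewrite -(op_compA _ (adj U) U) unitary_compl// op_comp1r.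
  by rewrite -(op_compA _ (adj V) V) unitary_compl// op_comp1r.
- move=> n y m Mn Yy Mm; rewrite pE; last by apply: left_algebra_gen => //; exact: TRO_right_module.
  rewrite pE'// i2// !adj_comp adjK !op_compA.
  rewrite -(op_compA _ (adj U') U') unitary_compl// op_comp1r.
  by rewrite -(op_compA _ (adj U') U') unitary_compl// op_comp1r.
- move=> n x m Mn Xx Mm; rewrite pE'; last first.
    rewrite -op_compA; apply: right_algebra_gen => //.
    by have [_ _ + _] := TRO_left_module tM2; exact.
  rewrite pE// i2'// !adj_comp adjK !op_compA.
  rewrite -(op_compA _ (adj U) U) unitary_compl// op_comp1r.
  by rewrite -(op_compA _ (adj U) U) unitary_compl// op_comp1r.
- move=> n y m Mn Yy Mm; rewrite sE; last by apply: left_algebra_gen => //; exact: TRO_right_module.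
  rewrite sE'// i1// !adj_comp adjK !op_compA.
  rewrite -(op_compA _ (adj V') V') unitary_compl// op_comp1r.
  by rewrite -(op_compA _ (adj V') V') unitary_compl// op_comp1r.
- move=> n x m Mn Xx Mm; rewrite sE'; last first.
    rewrite -op_compA; apply: right_algebra_gen => //.
    by have [_ _ + _] := TRO_left_module tM1; exact.
  rewrite sE// i1'// !adj_comp adjK !op_compA.
  rewrite -(op_compA _ (adj V) V) unitary_compl// op_comp1r.
  by rewrite -(op_compA _ (adj V) V) unitary_compl// op_comp1r.
Qed.

(** [p' (m^* n)] factors through [adj (rho m)], so a non-degenerate [p'] forces the ranges of these
    adjoints to span [E], as elementary tensors do. *)
Lemma tro_rep_spanning H K L E (M : set 'B(H, K)) (p : 'B(K, K) -> 'B(L, L))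
    (p' : 'B(H, H) -> 'B(E, E)) (rho : 'B(H, K) -> 'B(E, L)) :
  TRO M -> tro_rep M p p' rho -> star_representation (ralg M) p' ->
  star_nondegenerate (ralg M) p' -> range_spanning M (fun m => adj (rho m)).
Proof.
move=> tM [_ r2] p'r p'n v vP; move: p'r p'n; rewrite -lalg_adj => p'r p'n.
apply: (nondegenerate_orth (TRO_adj tM) p'r p'n) => _ _ [m Mm <-] [n Mn <-] z.
by rewrite adjK -r2// op_compE vP.
Qed.

(** The scalar products of the vectors [adj (rho m) x] are given by [p] alone, so a unitary
    equivalence on the [L] side yields equal Gram matrices, and hence a unitary, on the [E] side. *)
Lemma tro_rep_gram_unitary H K L E L' E' (M : set 'B(H, K))
    (p : 'B(K, K) -> 'B(L, L)) (p' : 'B(H, H) -> 'B(E, E)) (rho : 'B(H, K) -> 'B(E, L))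
    (q : 'B(K, K) -> 'B(L', L')) (q' : 'B(H, H) -> 'B(E', E')) (tau : 'B(H, K) -> 'B(E', L'))
    (V : 'B(L, L')) :
  TRO M -> tro_rep M p p' rho -> tro_rep M q q' tau -> unitary V ->
  (forall a, lalg M a -> q a = V *o p a *o adj V) ->
  range_spanning M (fun m => adj (rho m)) -> range_spanning M (fun m => adj (tau m)) ->
  exists2 V' : 'B(E, E'), unitary V' & forall m, M m -> V *o rho m = tau m *o V'.
Proof.
move=> tM [r1 _] [t1 _] Vu qE rs ts.
pose I := ({m : 'B(H, K) | M m} * L)%type.
have [||a b|V' V'u V'E] := @gram_unitary R E E' I
  (fun a => adj (rho (sval a.1)) a.2) (fun a => adj (tau (sval a.1)) (V a.2)).
- apply/spanningP => v vP; apply: rs => m x Mm; apply: vP.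
  by exists (exist _ m Mm, x).
- apply/spanningP => v vP; apply: ts => m x Mm; apply: vP.
  by exists (exist _ m Mm, adj V x) => //=; rewrite (proj2 Vu).
- case: a b => -[m Mm] x [[n Mn] y] /=.
  rewrite !adjP' -!op_compE r1// t1// qE; last exact: left_algebra_gen.
  by rewrite !op_compE (proj1 Vu) [RHS]adjP (proj1 Vu).
exists V' => // m Mm.
have /(congr1 adj) : V' *o adj (rho m) = adj (tau m) *o V.
  by apply: opP => x; have := V'E (exist _ m Mm, x).
rewrite !adj_comp !adjK => VE.
rewrite -[LHS]op_comp1r -(unitary_compl V'u) op_compA -(op_compA V) VE.
by rewrite op_compA unitary_compr// op_comp1l.
Qed.

(** The unitaries on the [s] side are induced from the two representations alone; compression by the
    adjoints of [tau1] and [tau2] and the intertwining identities show that they also carry the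
    middle maps to each other. *)
Lemma related_unique r r' s s' :
  related X Y M1 M2 r s -> related X Y M1 M2 r' s' ->
  cc_bimodule_map (ralg M2) Y (ralg M1) s -> nondegenerate (ralg M2) Y (ralg M1) s ->
  cc_bimodule_map (ralg M2) Y (ralg M1) s' -> nondegenerate (ralg M2) Y (ralg M1) s' ->
  unitarily_equivalent (lalg M2) X (lalg M1) r r' ->
  unitarily_equivalent (ralg M2) Y (ralg M1) s s'.
Proof.
move=> [rho1 [rho2 [t1 t2 [i _] [i2 _] [i1 _]]]] [tau1 [tau2 [u1 u2 [j _] [j2 _] [j1 _]]]].
move=> [_ [pr sr] _ _ _] [pn _ sn] [_ [pr' sr'] _ _ _] [pn' _ sn'].
move=> [V [U [[Vu Uu] pE fE sE]]].
have rho1s := tro_rep_spanning tM1 t1 sr sn.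
have rho2s := tro_rep_spanning tM2 t2 pr pn.
have tau1s := tro_rep_spanning tM1 u1 sr' sn'.
have tau2s := tro_rep_spanning tM2 u2 pr' pn'.
have [V' V'u V'E] := tro_rep_gram_unitary tM1 t1 u1 Vu sE rho1s tau1s.
have [U' U'u U'E] := tro_rep_gram_unitary tM2 t2 u2 Uu pE rho2s tau2s.
have V'E' m : M1 m -> adj V' *o adj (tau1 m) = adj (rho1 m) *o adj V.
  by move=> Mm; rewrite -!adj_comp V'E.
have U'E' m : M2 m -> adj U' *o adj (tau2 m) = adj (rho2 m) *o adj U.
  by move=> Mm; rewrite -!adj_comp U'E.
exists V', U'; split => //.
- move=> c Cc; apply: (range_spanning_ext tau2s tau2s) => n m Mn Mm.
  rewrite adjK -j2// pE; last by apply: left_algebra_gen => //; exact: TRO_right_module.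
  by rewrite i2// !op_compA -U'E// -!op_compA U'E'// !op_compA.
- move=> y Yy; apply: (range_spanning_ext tau1s tau2s) => n m Mn Mm.
  rewrite adjK -j// fE; last exact: (tro_transfer_MYM XYM).
  by rewrite i// !op_compA -U'E// -!op_compA V'E'// !op_compA.
- move=> c Cc; apply: (range_spanning_ext tau1s tau1s) => n m Mn Mm.
  rewrite adjK -j1// sE; last by apply: left_algebra_gen => //; exact: TRO_right_module.
  by rewrite i1// !op_compA -V'E// -!op_compA V'E'// !op_compA.
Qed.

End RelatedTriples.

(** * Faithful representations *)

Section Faithfulness.
Variables (R : realType).
Implicit Types (H K L E F G : hilbertType R).

Lemma opnorm_le1_comp_adj H K (T : 'B(H, K)) : opnorm (T *o adj T) <= 1 -> opnorm T <= 1.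
Proof.
move=> TT; rewrite -opnorm_adj; apply: opnorm_le_bound => // x; rewrite mul1r.
rewrite -(@ler_pXn2r _ 2)// ?nnegrE ?rnorm_ge0//.
rewrite rnorm_sqr_adj adjK (le_trans (ler_norm _))// (le_trans (Re_hdot_le _ _))//.
by rewrite ler_piMl ?sqr_ge0.
Qed.

(** Applied to families in the amplified ranges of M1^* and M2^*, which may fail to span; agreement
    of the forms is therefore completed by vanishing on the orthogonal complements. *)
Lemma op_eq_spanned H K (I J : Type) (f : I -> H) (g : J -> K) (T S : 'B(H, K)) :
  (forall i j, hdot (T (f i)) (g j) = hdot (S (f i)) (g j)) ->
  (forall x, (forall i, hdot (f i) x = 0) -> T x = 0 /\ S x = 0) ->
  (forall v, (forall j, hdot (g j) v = 0) -> adj T v = 0 /\ adj S v = 0) -> T = S.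
Proof.
move=> TS fTS gTS.
suff D0 : forall x v, hdot ((T - S) x) v = 0.
  by apply: op_eq_hdot => x v; apply/eqP; rewrite -subr_eq0 -hdotBl -opBE D0.
move=> x v.
have [p pf xp] := orth_projection (range f) x.
have [q qg vq] := orth_projection (range g) v.
have [|Tx Sx] := fTS (x - p); first by move=> i; apply: xp; exists i.
have [|Tv Sv] := gTS (v - q); first by move=> j; apply: vq; exists j.
have -> : (T - S) x = (T - S) p.
  by apply/eqP; rewrite -subr_eq0 -op_linB opBE Tx Sx subrr.
have -> : hdot ((T - S) p) v = hdot ((T - S) p) q.
  by apply/eqP; rewrite -subr_eq0 -hdotBr adjP adjB opBE Tv Sv subrr hdot0r.
rewrite hdotC (@closed_span_orth _ _ (range g)) ?conjC0// => _ [j _ <-].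
rewrite -adjP' (hdotC _ p) (@closed_span_orth _ _ (range f)) ?conjC0// => _ [i _ <-].
by rewrite -adjP opBE hdotBl TS subrr.
Qed.

Lemma completely_isometric_id H K (X : set 'B(H, K)) : completely_isometric X id.
Proof. by split=> // n x _; rewrite map_mx_id. Qed.

(** The square [rho(e) rho(e)^*] is [p] at [e e^*], for matrices as well, and [p] is contractive. *)
Lemma tro_rep_amp_contractive H K L E F G F' G' k N (M : set 'B(H, K))
    (p : 'B(K, K) -> 'B(L, L)) (p' : 'B(H, H) -> 'B(E, E)) (rho : 'B(H, K) -> 'B(E, L))
    (U : 'I_k -> 'B(H, F)) (V : 'I_N -> 'B(K, G))
    (U' : 'I_k -> 'B(E, F')) (V' : 'I_N -> 'B(L, G')) e :
  TRO M -> star_representation (lalg M) p -> tro_rep M p p' rho ->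
  frame U -> frame V -> frame U' -> frame V' ->
  ampset U V M e -> opnorm e <= 1 -> opnorm (amp U V U' V' rho e) <= 1.
Proof.
move=> tM pr [r1 _] Uf Vf U'f V'f Me e1.
have Aalg := TRO_star_algebra tM; have [sA _ _] := Aalg; have [pl _ _] := pr.
pose rho' (x : 'B(K, H)) := adj (rho (adj x)).
have Me' : ampset V U M^*o (adj e) by apply: ampset_adj Me => x Mx; exists x.
apply: opnorm_le1_comp_adj.
have -> : adj (amp U V U' V' rho e) = amp V U V' U' rho' (adj e).
  by rewrite (@amp_adj _ _ _ _ _ _ _ _ _ _ _ U V U' V' M rho rho')// /rho' => x Mx; rewrite adjK.
have MM x y : M x -> M^*o y -> lalg M (x *o y).
  by move=> Mx [m Mm <-]; exact: left_algebra_gen.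
have pM x y : M x -> M^*o y -> p (x *o y) = rho x *o rho' y.
  by move=> Mx [m Mm <-]; rewrite /rho' adjK r1.
rewrite -(amp_comp Uf V'f U'f V'f sA pl MM pM Me Me').
rewrite (le_trans (star_rep_contractive (ampset_star_algebra Vf Aalg) _ _))//.
- exact: amp_star_rep.
- exact: (ampset_comp Uf sA MM Me Me').
rewrite (le_trans (opnorm_comp _ _))// opnorm_adj -(mulr1 1).
by rewrite ler_pM ?opnorm_ge0.
Qed.

Lemma intertwined_amp H1 H2 K1 K2 L1 L2 E1 E2 F1 F2 G1 G2 F1' F2' G1' G2' k N
    (M1 : set 'B(H1, K1)) (M2 : set 'B(H2, K2)) (X : set 'B(K1, K2)) (Y : set 'B(H1, H2))
    (rho1 : 'B(H1, K1) -> 'B(E1, L1)) (rho2 : 'B(H2, K2) -> 'B(E2, L2)) phi psi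
    (U1 : 'I_k -> 'B(H1, F1)) (U2 : 'I_k -> 'B(H2, F2))
    (V1 : 'I_N -> 'B(K1, G1)) (V2 : 'I_N -> 'B(K2, G2))
    (U1' : 'I_k -> 'B(E1, F1')) (U2' : 'I_k -> 'B(E2, F2'))
    (V1' : 'I_N -> 'B(L1, G1')) (V2' : 'I_N -> 'B(L2, G2')) e y f :
  operator_space X -> linear_on X phi ->
  (forall n y m, M2 n -> Y y -> M1 m -> X (n *o y *o adj m)) ->
  intertwined M1 M2 X Y rho1 rho2 phi psi ->
  frame U1 -> frame U2 -> frame V1 -> frame V2 ->
  frame U1' -> frame U2' -> frame V1' -> frame V2' ->
  ampset U2 V2 M2 e -> ampset U1 U2 Y y -> ampset U1 V1 M1 f ->
  amp V1 V2 V1' V2' phi (e *o y *o adj f) =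
  amp U2 V2 U2' V2' rho2 e *o amp U1 U2 U1' U2' psi y *o
    adj (amp U1 V1 U1' V1' rho1 f).
Proof.
move=> [_ X0 XP] phil MYM [i _] U1f U2f V1f V2f U1'f U2'f V1'f V2'f Me Yy Mf.
have expand (A1 A2 B1 B2 C1 C2 D1 D2 : hilbertType R)
    (u1 : 'I_k -> 'B(A1, C1)) (u2 : 'I_k -> 'B(A2, C2))
    (v1 : 'I_N -> 'B(B1, D1)) (v2 : 'I_N -> 'B(B2, D2)) (P : 'B(C2, D2)) Q (T : 'B(C1, D1)) a b :
    frame u1 -> frame u2 ->
    adj (v2 a) *o (P *o Q *o adj T) *o v1 b =
    \sum_c \sum_d (adj (v2 a) *o P *o u2 c) *o (adj (u2 c) *o Q *o u1 d) *o
      adj (adj (v1 b) *o T *o u1 d).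
  move=> u1f u2f.
  rewrite -{1}(op_comp1r P) -(proj2 u2f) -{1}(op_comp1r Q) -(proj2 u1f).
  rewrite !(op_comp_sumr, op_comp_suml); apply: eq_bigr => c _.
  rewrite !(op_comp_sumr, op_comp_suml); apply: eq_bigr => d _.
  by rewrite !adj_comp adjK !op_compA.
apply: (frame_ext V1'f V2'f) => a b; rewrite amp_entry//.
rewrite (expand _ _ _ _ _ _ _ _ U1 U2)// (expand _ _ _ _ _ _ _ _ U1' U2')//.
rewrite (linear_on_sum X0 XP phil); last first.
  move=> c _; apply: lin_closed_sum => // d _.
  by apply: MYM; [exact: Me|exact: Yy|exact: Mf].
apply: eq_bigr => c _; rewrite (linear_on_sum X0 XP phil); last first.
  by move=> d _; apply: MYM; [exact: Me|exact: Yy|exact: Mf].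
apply: eq_bigr => d _; by rewrite !amp_entry// i.
Qed.

End Faithfulness.

Section FaithfulTriples.
Variables (R : realType).
Implicit Types (H K L E F G : hilbertType R).

Lemma operator_space0 H K : operator_space [set (0 : 'B(H, K))].
Proof.
split => //= [|c x y -> ->]; last by rewrite scaler0 addr0.
apply/closed_rnorm => x xP; apply: rnorm0_eq0; apply/eqP.
rewrite eq_le rnorm_ge0 andbT; apply/ler_addgt0Pr => e e0; rewrite add0r.
by have [_ -> +] := xP e e0; rewrite subr0 => /ltW.
Qed.

Lemma closed_op_ker H K w : closed [set T : 'B(H, K) | T w = 0].
Proof.
apply/closed_rnorm => x xP; apply: rnorm0_eq0; apply/eqP.
rewrite eq_le rnorm_ge0 andbT; apply/ler_addgt0Pr => e e0; rewrite add0r.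
have w0 : 0 < rnorm w + 1 by rewrite ltr_wpDl// rnorm_ge0.
have [y /= yw xy] := xP _ (divr_gt0 e0 w0).
rewrite -[x w]subr0 -yw -opBE (le_trans (rnorm_opE _ _))//.
rewrite (@le_trans _ _ (e / (rnorm w + 1) * rnorm w))//.
  by rewrite ler_wpM2r ?rnorm_ge0// -rnorm_opnorm ltW.
by rewrite mulrAC -mulrA ler_piMr ?(ltW e0)// ler_pdivrMr// mul1r lerDl.
Qed.

Lemma ampset_kernel H K E F m n (U : 'I_m -> 'B(H, E)) (V : 'I_n -> 'B(K, F))
    (X : set 'B(H, K)) T x : frame U -> frame V -> ampset U V X T ->
  (forall j S, X S -> S (adj (U j) x) = 0) -> T x = 0.
Proof.
move=> Uf Vf XT xP; rewrite -(frame_decomp (T x) Vf) big1// => i _.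
rewrite -{1}(frame_decomp x Uf) !op_lin_sum big1// => j _.
rewrite -[adj (V i) _]/((adj (V i) *o T *o U j) (adj (U j) x)).
by rewrite xP// op_lin0.
Qed.

(** With [C = ralg M], the relation [M c M^* = 0] yields [M c C = 0] and then [C c c^* = 0]. As
    [c c^*] lies in [C], its square is 0, which forces [c = 0]. *)
Lemma ralg_eq0 H K (M : set 'B(H, K)) c : TRO M -> ralg M c ->
  (forall n m, M n -> M m -> n *o c *o adj m = 0) -> c = 0.
Proof.
move=> tM Rc ncm.
have [_ RM Ra] := TRO_star_algebra_right tM.
have nca n a : M n -> ralg M a -> n *o c *o a = 0.
  move=> Mn; apply: (closed_span_compr (operator_space0 _ _)) => _ [_ [p Mp <-] [q _ <-]].
  by rewrite /= op_compA ncm// op_comp0l.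
have acc a : ralg M a -> a *o (c *o adj c) = 0.
  apply: (closed_span_compl (operator_space0 _ _)) => _ [_ [p _ <-] [q Mq <-]] /=.
  rewrite -op_compA [X in _ *o X]op_compA nca ?op_comp0r//; exact: Ra.
apply: comp_adj_eq0; apply: comp_adj_eq0; rewrite adj_comp adjK.
by apply: acc; apply: RM => //; exact: Ra.
Qed.

Lemma intertwined_set_inj H K L E (M : set 'B(H, K)) (p : 'B(K, K) -> 'B(L, L))
    (p' : 'B(H, H) -> 'B(E, E)) (rho : 'B(H, K) -> 'B(E, L)) :
  TRO M -> star_representation (lalg M) p -> star_representation (ralg M) p' ->
  intertwined M M (lalg M) (ralg M) rho rho p p' ->
  set_inj (lalg M) p -> set_inj (ralg M) p'.
Proof.
move=> tM [pl _ _] [pl' _ _] [i _] pinj c d; rewrite !inE => Rc Rd cd.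
have [[_ A0 _] _ _] := TRO_star_algebra tM.
have [[_ R0 RP] _ _] := TRO_star_algebra_right tM.
have Rcd : ralg M (c - d) by exact: (lin_closedB R0 RP).
apply/eqP; rewrite -subr_eq0; apply/eqP; apply: (ralg_eq0 tM Rcd) => n m Mn Mm.
apply: pinj; rewrite ?inE//; first by apply: left_algebra_gen => //; exact: TRO_right_module.
by rewrite i// (linear_onB R0 RP pl')// cd subrr op_comp0r op_comp0l (linear_on0 A0 pl).
Qed.

Section Bimodule.
Variables (H1 H2 K1 K2 : hilbertType R).
Variables (X : set 'B(K1, K2)) (Y : set 'B(H1, H2)).
Variables (M1 : set 'B(H1, K1)) (M2 : set 'B(H2, K2)).
Hypothesis XYM : tro_transfer X Y M1 M2.
Implicit Types (r : bimodule_triple K1 K2) (s : bimodule_triple H1 H2).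

Let tM1 : TRO M1. Proof. by case: XYM => _ _ []. Qed.
Let tM2 : TRO M2. Proof. by case: XYM => _ _ []. Qed.
Let sX : operator_space X. Proof. by case: XYM. Qed.
Let sY : operator_space Y. Proof. by case: XYM. Qed.

(** [Y] is the closed span of [M2^* X M1], whose generators apply an element of [M1] first. This
    supplies the vanishing of [y] on the complement in [related_isometric]. *)
Lemma tro_transfer_kernel w y : (forall m, M1 m -> m w = 0) -> Y y -> y w = 0.
Proof.
move=> Mw; case: (XYM) => _ _ [_ _ _ ->].
apply: (@closed_span_min _ _ _ [set y : 'B(H1, H2) | y w = 0]) => /=.
- by [].
- move=> c a b aw bw; rewrite -[LHS]/(c *: a w + b w).
  by rewrite aw bw scaler0 addr0.
- exact: closed_op_ker.
- by move=> _ [a _ [m Mm <-]]; rewrite /= -[LHS]/(a (m w)) Mw// op_lin0.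
Qed.

Lemma tro_transfer_kernel_adj w y : (forall n, M2 n -> n w = 0) -> Y y -> adj y w = 0.
Proof.
move=> Mw; case: (XYM) => _ _ [_ _ _ ->].
apply: (@closed_span_min _ _ _ [set y : 'B(H1, H2) | adj y w = 0]) => /=.
- by rewrite adj0.
- by move=> c a b aw bw; rewrite adjD adjZ opDE opZE aw bw scaler0 addr0.
- apply: (@closed_lipschitz_preimage _ _ _ _ _ [set T : 'B(H2, H1) | T w = 0] adj 1) => [|a b].
    exact: closed_op_ker.
  by rewrite -adjB mul1r opnorm_adj.
- move=> _ [_ [_ [n Mn <-] [x _ <-]] [m _ <-]] /=.
  by rewrite !adj_comp adjK !op_compE Mw// !op_lin0.
Qed.

Lemma related_isometric r s : related X Y M1 M2 r s ->
  cc_bimodule_map (lalg M2) X (lalg M1) r -> cc_bimodule_map (ralg M2) Y (ralg M1) s ->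
  completely_isometric X (bm_map r) -> completely_isometric Y (bm_map s).
Proof.
move=> [rho1 [rho2 [t1 t2 itw _ _]]] [[phil _] [pr sr] _ _ _] [[psil psicc] _ _ _ _] phici.
split => // k x Yx; apply/eqP; rewrite eq_le psicc//=.
have [G1 [U1 U1f]] := frame_exists H1 k; have [G2 [U2 U2f]] := frame_exists H2 k.
have [G1' [U1' U1'f]] := frame_exists (bm_dom s) k.
have [G2' [U2' U2'f]] := frame_exists (bm_cod s) k.
rewrite (mx_opnorm_amp _ x U1f U2f U1'f U2'f) (mx_opnorm_op x U1f U2f).
have Yy := mx_op_ampset U1f U2f Yx; move: (mx_op U1 U2 x) Yy => y Yy.
have [sM1 _] := tM1; have [sM2 _] := tM2.
(* The identity representation is transferred with [W = adj], so the operator obtained acts where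
   [y] does and will turn out to be [y]. The constant used is the norm of the image of [y] under the
   amplified [bm_map s]. *)
have rep : bimodule_rep (lalg M2) X (lalg M1) id id id.
  split; split => //; [exact: TRO_star_algebra|exact: TRO_star_algebra|
    exact: (lalg_mul XYM)|exact: (mul_lalg XYM)].
have [||m m' _ _|m m' _ _|T [TC TE Tx Tv]] :=
  @transfer_amp_bound _ H1 H2 K1 K2 K1 K2 H1 H2 _ _ _ _ k _ _ _ _ _ _ Y M1 M2 adj adj
    U1 U2 U1 U2 y (opnorm (amp U1 U2 U1' U2' (bm_map s) y)) rep sM1 sM2
    (TRO_left_module tM2) (TRO_left_module tM1) _ _ _ _ (tro_transfer_MYM XYM) U1f U2f U1f U2f Yy.
- exact: opnorm_ge0.
- move=> N F1 F2 F1' F2' V1 V2 V1' V2' e f V1f V2f V1'f V2'f Me Mf e1 f1 Xx.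
  rewrite (completely_isometric_amp V1f V2f V1'f V2'f (completely_isometric_id X) Xx).
  have [Q1 [V1r V1rf]] := frame_exists (bm_dom r) N.
  have [Q2 [V2r V2rf]] := frame_exists (bm_cod r) N.
  rewrite -(completely_isometric_amp V1f V2f V1rf V2rf phici Xx).
  rewrite (intertwined_amp sX phil (tro_transfer_MYM XYM) itw U1f U2f V1f V2f
    U1'f U2'f V1rf V2rf Me Yy Mf).
  have e1' := tro_rep_amp_contractive tM2 pr t2 U2f V2f U2'f V2rf Me e1.
  have f1' := tro_rep_amp_contractive tM1 sr t1 U1f V1f U1'f V1rf Mf f1.
  rewrite (le_trans (opnorm_comp _ _))// opnorm_adj.
  rewrite (le_trans (ler_wpM2l (opnorm_ge0 _) f1'))// mulr1.
  by rewrite (le_trans (opnorm_comp _ _))// ler_piMl// opnorm_ge0.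
- by rewrite adjK.
- by rewrite adjK.
suff Ty : T = y by rewrite -{1}Ty.
pose I1 := ('I_k * {m : 'B(H1, K1) | M1 m} * K1)%type.
pose I2 := ('I_k * {m : 'B(H2, K2) | M2 m} * K2)%type.
apply: (@op_eq_spanned _ _ _ I1 I2 (fun i => U1 i.1.1 (adj (sval i.1.2) i.2))
  (fun i => U2 i.1.1 (adj (sval i.1.2) i.2))).
- move=> [[j [m Mm]] z] [[i [n Mn]] t] /=.
  have /(congr1 (fun Q : 'B(K1, K2) => hdot (Q z) t)) := TE i j n m Mn Mm.
  by rewrite !op_compE -!adjP' adjK.
- move=> v vP; split.
    by apply: Tx => j m z Mm; exact: (vP (j, exist _ m Mm, z)).
  apply: (ampset_kernel U1f U2f Yy) => j S; apply: tro_transfer_kernel => m Mm.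
  (* The family contains [m^* m] applied to the component of [v]; its product with [v] is the
     squared norm of [m] at that component. *)
  apply: rnorm0_eq0; apply/eqP; rewrite -sqrf_eq0 rnorm_sqr -adjP'.
  by have := vP (j, exist _ m Mm, m (adj (U1 j) v)); rewrite /= adjP => ->.
- move=> v vP; split.
    by apply: Tv => j m z Mm; exact: (vP (j, exist _ m Mm, z)).
  have Yy' : ampset U2 U1 Y^*o (adj y) by apply: ampset_adj Yy => z Yz; exists z.
  apply: (ampset_kernel U2f U1f Yy') => j _ [S YS <-].
  apply: tro_transfer_kernel_adj YS => m Mm.
  apply: rnorm0_eq0; apply/eqP; rewrite -sqrf_eq0 rnorm_sqr -adjP'.
  by have := vP (j, exist _ m Mm, m (adj (U2 j) v)); rewrite /= adjP => ->.
Qed.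

Lemma related_faithful r s : related X Y M1 M2 r s ->
  cc_bimodule_map (lalg M2) X (lalg M1) r -> cc_bimodule_map (ralg M2) Y (ralg M1) s ->
  faithful_CES (lalg M2) X (lalg M1) r -> faithful_CES (ralg M2) Y (ralg M1) s.
Proof.
move=> rs rcc scc [ri rl rr]; split; first exact: related_isometric ri.
all: have [_ [lr rr'] _ _ _] := rcc; have [_ [ls rs'] _ _ _] := scc.
- by have [rho1 [rho2 [_ _ _ i _]]] := rs; exact: intertwined_set_inj i rl.
- by have [rho1 [rho2 [_ _ _ _ i]]] := rs; exact: intertwined_set_inj i rr.
Qed.

End Bimodule.
End FaithfulTriples.

(** * The bijection *)

Section ClassTransfer.
Variables (R : realType) (H1 H2 K1 K2 : hilbertType R).
Variables (X : set 'B(K1, K2)) (Y : set 'B(H1, H2)).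
Variables (M1 : set 'B(H1, K1)) (M2 : set 'B(H2, K2)).
Hypothesis XYM : tro_transfer X Y M1 M2.
Implicit Types (r : bimodule_triple K1 K2) (s : bimodule_triple H1 H2).

Definition transfer_class (c : bimodule_triple K1 K2 -> Prop) s : Prop :=
  [/\ cc_bimodule_map (ralg M2) Y (ralg M1) s, nondegenerate (ralg M2) Y (ralg M1) s &
      exists2 r, c r & related X Y M1 M2 r s].

(** The image is one full class: uniqueness shows that its members are equivalent, and invariance of
    the relation shows that it is closed under equivalence. *)
Lemma transfer_class_subproof (c : nondegenerate_class (lalg M2) X (lalg M1)) :
  exists s, [/\ cc_bimodule_map (ralg M2) Y (ralg M1) s,
    nondegenerate (ralg M2) Y (ralg M1) s &
    transfer_class (sval c) = fun s' => [/\ cc_bimodule_map (ralg M2) Y (ralg M1) s',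
      nondegenerate (ralg M2) Y (ralg M1) s' &
      unitarily_equivalent (ralg M2) Y (ralg M1) s s']].
Proof.
case: c => _ /= [r [rcc rn ->]].
have [s [scc sn rs]] := related_exists XYM rcc rn.
exists s; split => //; apply/funext => s'; apply/propext; split=> [][scc' sn'].
  by move=> [r' [rcc' rn' rr'] rs']; split => //; exact: (related_unique XYM rs rs').
move=> ss'; split => //; exists r; last first.
  by apply: (related_unitarily_equivalent XYM rs _ ss'); exact: unitarily_equivalent_refl.
by split => //; exact: unitarily_equivalent_refl.
Qed.

Definition transfer_nondegenerate_class (c : nondegenerate_class (lalg M2) X (lalg M1)) :
    nondegenerate_class (ralg M2) Y (ralg M1) :=
  exist _ _ (transfer_class_subproof c).

End ClassTransfer.

Section Bijection.
Variables (R : realType).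

Lemma nondegenerate_class_member (K1 K2 : hilbertType R) (A : set 'B(K2, K2))
    (X : set 'B(K1, K2)) (B : set 'B(K1, K1)) (c : nondegenerate_class A X B) r :
  sval c r -> [/\ cc_bimodule_map A X B r, nondegenerate A X B r &
    sval c = fun s => [/\ cc_bimodule_map A X B s, nondegenerate A X B s &
                          unitarily_equivalent A X B r s]].
Proof.
case: c => _ /= [r0 [rcc0 rn0 ->]] [rcc rn r0r]; split => //.
apply/funext => s; apply/propext; split=> [][scc sn rs]; split => //.
  by apply: unitarily_equivalent_trans rs; exact: unitarily_equivalent_sym.
exact: unitarily_equivalent_trans rs.
Qed.

Lemma nondegenerate_class_eq (K1 K2 : hilbertType R) (A : set 'B(K2, K2))
    (X : set 'B(K1, K2)) (B : set 'B(K1, K1)) (c d : nondegenerate_class A X B) r :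
  sval c r -> sval d r -> c = d.
Proof.
move=> /nondegenerate_class_member[_ _ cE] /nondegenerate_class_member[_ _ dE].
move: cE dE; case: c => P Pp; case: d => Q Qp /= PE QE.
by apply: eq_exist; rewrite PE QE.
Qed.

Lemma nondegenerate_class_inhabited (K1 K2 : hilbertType R) (A : set 'B(K2, K2))
    (X : set 'B(K1, K2)) (B : set 'B(K1, K1)) (c : nondegenerate_class A X B) :
  exists r, sval c r.
Proof.
case: c => _ /= [r [rcc rn ->]]; exists r; split => //.
exact: unitarily_equivalent_refl.
Qed.

Lemma nondegenerate_class_exists (K1 K2 : hilbertType R) (A : set 'B(K2, K2))
    (X : set 'B(K1, K2)) (B : set 'B(K1, K1)) (r : bimodule_triple K1 K2) :
  cc_bimodule_map A X B r -> nondegenerate A X B r ->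
  exists c : nondegenerate_class A X B, sval c r.
Proof.
move=> rcc rn; unshelve eexists; first by eexists; exists r; split.
by split => //; exact: unitarily_equivalent_refl.
Qed.

Variables (H1 H2 K1 K2 : hilbertType R).
Variables (X : set 'B(K1, K2)) (Y : set 'B(H1, H2)).
Variables (M1 : set 'B(H1, K1)) (M2 : set 'B(H2, K2)).
Hypothesis XYM : tro_transfer X Y M1 M2.
Implicit Types (r : bimodule_triple K1 K2) (s : bimodule_triple H1 H2).

Let f := transfer_nondegenerate_class XYM.

(** Two triples related to the same [s] are equivalent, by uniqueness for the adjoint TRO's. *)
Lemma transfer_nondegenerate_class_inj : injective f.
Proof.
move=> c d cd; have [s fcs] := nondegenerate_class_inhabited (f c).
have := fcs; rewrite cd => -[_ _ [r' dr' rs']].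
have [scc sn [r cr rs]] := fcs.
have [rcc rn cE] := nondegenerate_class_member cr.
have [rcc' rn' dE] := nondegenerate_class_member dr'.
apply: (nondegenerate_class_eq _ dr'); rewrite cE; split => //.
have := related_unique (tro_transfer_sym XYM) (related_sym rs) (related_sym rs').
rewrite !lalg_adj !ralg_adj; apply => //; exact: unitarily_equivalent_refl.
Qed.

(** Existence for the adjoint TRO's supplies the preimage. *)
Lemma transfer_nondegenerate_class_surj d : exists c, f c = d.
Proof.
have [s ds] := nondegenerate_class_inhabited d.
have [scc sn dE] := nondegenerate_class_member ds.
have := @related_exists _ _ _ _ _ _ _ _ _ (tro_transfer_sym XYM) s.
rewrite !lalg_adj !ralg_adj => /(_ scc sn)[r [rcc rn sr]].
have rs : related X Y M1 M2 r s by have := related_sym sr; rewrite !adj_setK.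
have [c cr] := nondegenerate_class_exists rcc rn.
exists c; apply: (nondegenerate_class_eq _ ds); split => //; by exists r.
Qed.

Lemma transfer_nondegenerate_class_bij : bijective f.
Proof.
have [g gE] := boolp.choice transfer_nondegenerate_class_surj.
exists g => // c; exact: transfer_nondegenerate_class_inj.
Qed.

(** Invariance makes any two representatives related; the two implications are then
    [related_faithful] for the TRO's and for their adjoints. *)
Lemma transfer_nondegenerate_class_faithful (c : nondegenerate_class (lalg M2) X (lalg M1)) r s :
  sval c r -> sval (f c) s ->
  (faithful_CES (lalg M2) X (lalg M1) r <-> faithful_CES (ralg M2) Y (ralg M1) s).
Proof.
move=> cr [scc sn [r' cr' rs']].
have [rcc rn cE] := nondegenerate_class_member cr.
have rs : related X Y M1 M2 r s.
  apply: (related_unitarily_equivalent XYM rs'); last exact: unitarily_equivalent_refl.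
  by move: cr'; rewrite cE => -[_ _]; exact: unitarily_equivalent_sym.
split; first exact: (related_faithful XYM rs).
have := related_faithful (tro_transfer_sym XYM) (related_sym rs).
by rewrite !lalg_adj !ralg_adj; apply.
Qed.

End Bijection.

Theorem proposition3p7 (R : realType) (H1 H2 K1 K2 : hilbertType R)
    (X : set 'B(K1, K2)) (Y : set 'B(H1, H2))
    (M1 : set 'B(H1, K1)) (M2 : set 'B(H2, K2))
    (A : set 'B(K2, K2)) (B : set 'B(K1, K1))
    (C : set 'B(H2, H2)) (D : set 'B(H1, H1))
    (hX : operator_space X) (hY : operator_space Y)
    (hXY : strongly_TRO_equiv X Y M1 M2)
    (hA : A = closed_span (M2 `*o M2^*o))
    (hB : B = closed_span (M1 `*o M1^*o))
    (hC : C = closed_span (M2^*o `*o M2))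
    (hD : D = closed_span (M1^*o `*o M1)) :
  exists f : nondegenerate_class A X B -> nondegenerate_class C Y D,
    bijective f /\
    forall (c : nondegenerate_class A X B) r s, sval c r -> sval (f c) s ->
      (faithful_CES A X B r <-> faithful_CES C Y D s).
Proof.
rewrite {}hA {}hB {}hC {}hD.
have XYM : tro_transfer X Y M1 M2 by [].
exists (transfer_nondegenerate_class XYM); split.
  exact: transfer_nondegenerate_class_bij.
exact: transfer_nondegenerate_class_faithful.
Qed.
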